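(* Let $b,q$ be integers with $2\le q<b$, and let $D=\{0=d_0,d_1,\dots,d_{q-1}\}\subset\mathbb{Z}$ be a set of cardinality $q$ such that there exists $L\subset\mathbb{Z}$ for which $(b,D,L)$ is a Hadamard triple. Let $\mu=\mu_{b,D}$ be the self-similar Borel probability measure on $\mathbb{R}$ satisfying $$\mu(\cdot)=\frac1q\sum_{j=0}^{q-1}\mu\big(b(\cdot)-d_j\big).$$ Then for any $t\in\left(0,\frac{\log q}{\log b}\right)$ and any $s\in[0,\infty]$, the set $$\mathcal{V}^{(s)}_{t}(\mu)=\{\Lambda:\ \Lambda\text{ is a spectrum of }\mu,\ \dim_{Be}(\Lambda)=t\text{ and }D_t^+(\Lambda)=s\}$$ has the cardinality of the continuum.
   Context: Hadamard triple: for $b\in\mathbb{Z}$ and finite sets $D,L\subset\mathbb{Z}$ with $\#D=\#L=q$, $(b,D,L)$ is a Hadamard triple if the $q\times q$ matrix $\frac{1}{\sqrt q}\left(e^{2\pi i d\ell/b}\right)_{d\in D,\,\ell\in L}$ is unitary. The measure $\mu_{b,D}$ is the unique Borel probability measure with compact support satisfying the displayed identity. Equivalently, it is the infinite convolution $\delta_{b^{-1}D}*\delta_{b^{-2}D}*\cdots$ (weak limit), where $\delta_E=\frac{1}{\#E}\sum_{e\in E}\delta_e$ for a finite set $E$. Spectrum: a countable set $\Lambda\subset\mathbb{R}$ is a spectrum of $\mu$ if $\{e^{2\pi i\lambda x}:\lambda\in\Lambda\}$ is an orthonormal basis of $L^2(\mu)$. Beurling density and dimension: for a countable set $\Lambda\subset\mathbb{R}$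 and $r\ge0$, the (upper) $r$-Beurling density is $$D_r^+(\Lambda)=\limsup_{h\to\infty}\sup_{x\in\mathbb{R}}\frac{\#\big(\Lambda\cap(x-h,x+h)\big)}{h^r}\in[0,\infty],$$ and the Beurling dimension is $\dim_{Be}(\Lambda)=\inf\{r:D_r^+(\Lambda)=0\}=\sup\{r:D_r^+(\Lambda)=\infty\}$. *)

(* Defs.v *)
From mathcomp Require Import all_boot all_order all_algebra.
From mathcomp Require Import finmap.
From mathcomp Require Import all_classical all_reals all_analysis.
From mathcomp Require Import complex.

Set Implicit Arguments.
Unset Strict Implicit.
Unset Printing Implicit Defensive.

Import Order.TTheory GRing.Theory Num.Theory.
Import numFieldTopology.Exports numFieldNormedType.Exports.

Local Open Scope classical_set_scope.
Local Open Scope ring_scope.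

Definition cis {R : realType} (theta : R) : R[i] :=
  Complex (cos theta) (sin theta).

(* Rows and columns follow the enumerations of D and L underlying {fset int};
   unitarity does not depend on this choice. *)
Definition hadamard_mx (R : realType) (q : nat) (b : int) (D L : {fset int})
    : 'M[R[i]]_q :=
  \matrix_(i < q, j < q)
    (((Num.sqrt q%:R)^-1)%:C%C *
     cis (2 * pi * (D`_i)%:~R * (L`_j)%:~R / b%:~R : R)).

Definition hadamard_triple (R : realType) (q : nat) (b : int)
    (D L : {fset int}) : Prop :=
  [/\ #|` D| = q, #|` L| = q & hadamard_mx R q b D L \is unitarymx].

Definition measure_support {R : realType}
    (mu : set (measurableTypeR R) -> \bar R) : set R :=
  [set x | forall U : set R, open U -> U x -> (0 < mu U)%E].

(* For 2 <= #D < b these conditions determine mu uniquely; it is the infinite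
   convolution of the uniform measures on b^-k D, k >= 1. *)
Definition is_self_similar_measure {R : realType} (b : int) (D : {fset int})
    (mu : probability (measurableTypeR R) R) : Prop :=
  compact (measure_support mu) /\
  forall A : set (measurableTypeR R), measurable A ->
    (mu A = ((#|` D|%:R)^-1 : R)%:E *
      \sum_(d <- D) mu [set (b%:~R * x - d%:~R)%R | x in A])%E.

Section L2.
Context {d : measure_display} {T : measurableType d} {R : realType}.
Variable mu : {measure set T -> \bar R}.
Implicit Types f g : T -> R[i].

Definition cmeasurable f : Prop :=
  measurable_fun setT (fun x => complex.Re (f x)) /\
  measurable_fun setT (fun x => complex.Im (f x)).

Definition cintegral f : R[i] :=
  Complex (\int[mu]_x complex.Re (f x))%R (\int[mu]_x complex.Im (f x))%R.

Definition L2norm f : \bar R :=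
  'N[mu]_2%:E[EFin \o (@ComplexField.Normc.normc R \o f)].

Definition in_L2 f : Prop := cmeasurable f /\ (L2norm f < +oo)%E.

Definition L2inner f g : R[i] := cintegral (fun x => f x * (g x)^*%C).

(* Elements of the complex space L^2(mu) are given by representatives; the
   last clause is density of the finite linear combinations. *)
Definition orthonormal_basis {J : choiceType} (I : set J)
    (e : J -> T -> R[i]) : Prop :=
  [/\ forall i, I i -> in_L2 (e i),
      forall i j, I i -> I j -> L2inner (e i) (e j) = (i == j)%:R &
      forall f, in_L2 f -> forall eps : R, 0 < eps ->
        exists (s : {fset J}) (c : J -> R[i]), [set` s] `<=` I /\
          (L2norm (fun x => f x - \sum_(i <- s) c i * e i x)%R < eps%:E)%E].

End L2.

Definition is_spectrum {R : realType}
    (mu : {measure set (measurableTypeR R) -> \bar R}) (Lambda : set R)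
    : Prop :=
  countable Lambda /\
  orthonormal_basis mu Lambda (fun l x => cis (2 * pi * l * x)).

Definition beurling_density {R : realType} (r : R) (Lambda : set R) : \bar R :=
  limf_esup (fun h : R =>
    ereal_sup [set (counting (Lambda `&` `](x - h)%R, (x + h)%R[) / (h `^ r)%:E)%E
              | x in [set: R]])
    (pinfty_nbhs R).

Definition beurling_dim {R : realType} (Lambda : set R) : \bar R :=
  ereal_inf [set r%:E | r in [set r : R | 0 <= r /\
                                 beurling_density r Lambda = 0%E]].

Definition spectra_dim_density {R : realType}
    (mu : {measure set (measurableTypeR R) -> \bar R}) (t : R) (s : \bar R)
    : set (set R) :=
  [set Lambda | [/\ is_spectrum mu Lambda,
                    beurling_dim Lambda = t%:E &
                    beurling_density t Lambda = s]].

(* Main.v *)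
Require Import Defs.
From mathcomp Require Import all_boot all_order all_algebra.
From mathcomp Require Import finmap.
From mathcomp Require Import all_classical all_reals all_analysis.
From mathcomp Require Import complex.
From mathcomp Require Import measurable_realfun.
From mathcomp Require Import zify ring lra.

Set Implicit Arguments.
Unset Strict Implicit.
Unset Printing Implicit Defensive.

Import Order.TTheory GRing.Theory Num.Theory.
Import numFieldTopology.Exports numFieldNormedType.Exports.

Local Open Scope classical_set_scope.
Local Open Scope ring_scope.

(** The construction starts from the Hadamard set [L], which yields, for every
    [m], spectra with [q ^ m] integer points of the [m]-th finite convolution
    approximating [mu] ([level_spectrum]). Such a finite spectrum may be moved
    a lot: the Fourier transform of the finite convolution is periodic with
    period [b ^ m] (in units of [1 / g], where [g] is the greatest common
    divisor of the digits), so each of its points may be translated by its own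
    multiple of the period.

    An increasing union of these finite spectra is always orthogonal for [mu],
    because the transform of [mu] vanishes wherever that of the finite
    convolution does. It is complete as soon as, at each stage, the transform
    of [mu], rescaled by the current power of [b], is bounded below at the new
    points: if some mass were missing from the Parseval sum of an exponential,
    the new points of each stage would recover a fixed part of it
    ([clustered_spectrum_exists]). Two facts supply the lower bound. The
    transform of [mu] does not vanish on any whole coset of the lattice, with
    a uniform bound by compactness ([Phi_shift_bounded]), and it does not
    vanish at some nonzero lattice point [J] ([Phi_int_neq0]). The first one
    corrects each point by a bounded multiple of the period, and the second
    one allows sending it to the neighbourhood of [b ^ M * J] for an
    arbitrarily large scale [M], still keeping the bound.

    The scales control the density. New points with pairwise distinct scales
    are so sparse that they contribute only logarithmically to the count of
    any interval. At each stage one cluster of new points is sent to a common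
    scale; it is chosen greedily so that no interval of radius [h] contains
    more than about [h ^ t * kappa h] of its points and some long interval
    attains this number ([greedy_cluster], [extension_exists]). Enough
    candidates are available because [t] is smaller than the logarithm of [q]
    in base [b] ([gauge_count_grow]). When the slowly varying function [kappa]
    tends to [s], the result has Beurling dimension [t] and [t]-density [s]
    ([gauge_exists], [affine_points_beurling]).

    That the Parseval identity for the exponentials suffices for a spectrum is
    the density of the exponentials in the square-integrable functions, proved
    by reaching indicators of half-lines through polynomials in sines
    ([spanned_L2], [frequencies_spectrum]).

    Finally, the translates of one such spectrum are again spectra with the
    same dimension and density ([translated_spectra]), and those with shifts in
    an open interval of length [1 / g] are distinct ([affine_points_inj]); so
    there are continuum many. There are no more, since a spectrum is a
    countable set of reals ([countable_sets_card]). *)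

(** * Sparse spectra of a scaling function on the integers *)

Section Tower.
Context {R : realType} (q b : nat) (w Phi : R -> R).

(** When [w] is the squared modulus of the mask of a digit set [D], this is
    the squared modulus of the Fourier transform of the convolution of the
    uniform measures on [b ^ -k D] for [1 <= k <= m]. *)
Definition level_factor (m : nat) (x : R) : R :=
  \prod_(k < m) w (x / b%:R ^+ k.+1).

Local Notation W := level_factor.

(** For such a [w], this is the Parseval identity: the first [q ^ m] values of
    [lam] form a spectrum of that convolution, a measure on [q ^ m] points. *)
Definition level_spectrum (m : nat) (lam : nat -> int) : Prop :=
  forall x : R, \sum_(i < q ^ m) W m (x + (lam i)%:~R) = 1.

Hypothesis b_gt0 : (0 < b)%N.
Hypothesis w_periodic : forall (x : R) (z : int), w (x + z%:~R) = w x.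
Hypothesis w_ge0 : forall x, 0 <= w x.
Hypothesis w0 : w 0 = 1.

Let bR_gt0 m : 0 < b%:R ^+ m :> R.
Proof. by rewrite exprn_gt0// ltr0n. Qed.

Let bR_neq0 m : b%:R ^+ m != 0 :> R.
Proof. by rewrite gt_eqF. Qed.

Lemma level_factorD m p x : W (m + p) x = W m x * W p (x / b%:R ^+ m).
Proof.
rewrite /W big_split_ord /=; congr (_ * _); apply: eq_bigr => k _.
by rewrite -addnS exprD invfM mulrA.
Qed.

Lemma level_factor_ge0 m x : 0 <= W m x.
Proof. by apply: prodr_ge0 => k _. Qed.

Lemma level_factor_periodic m x (z : int) :
  W m (x + ((b ^ m)%:Z * z)%:~R) = W m x.
Proof.
apply: eq_bigr => k _; rewrite mulrDl intrM -pmulrn natrX.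
have -> : b%:R ^+ m * z%:~R / b%:R ^+ k.+1 = ((b ^ (m - k.+1))%:Z * z)%:~R :> R.
  rewrite intrM -pmulrn natrX mulrAC; congr (_ * _).
  by apply: (mulIf (bR_neq0 k.+1)); rewrite -exprD subnK// divfK.
by rewrite w_periodic.
Qed.

Lemma level_factor_int m (z : int) : W m ((b ^ m)%:Z * z)%:~R = 1.
Proof.
rewrite -[X in W m X]add0r level_factor_periodic.
by apply: big1 => k _; rewrite mul0r.
Qed.

Lemma sum_ord_mul (V : nmodType) (n p : nat) (F : nat -> V) :
  \sum_(i < n * p) F i = \sum_(c < p) \sum_(a < n) F (a + n * c)%N.
Proof.
rewrite mulnC -(big_mkord xpredT F) big_nat_mul big_mkord.
apply: eq_bigr => c _.
rewrite -{1}[(c * n)%N]add0n big_addn mulSn addnK big_mkord.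
by apply: eq_bigr => a _; rewrite (mulnC n).
Qed.

(** Spectra of two levels combine digit by digit, as in a positional number
    system. The period [b ^ (m + p)] of the combined factor leaves every point
    free to move by its own multiple [z i] of this period; the construction of
    sparse spectra lives on this freedom. *)
Lemma level_spectrum_comp m p (lam ell z : nat -> int) :
  (0 < q)%N -> level_spectrum m lam -> level_spectrum p ell ->
  level_spectrum (m + p) (fun i => lam (i %% q ^ m)%N
    + (b ^ m)%:Z * ell (i %/ q ^ m)%N + (b ^ (m + p))%:Z * z i).
Proof.
move=> q_gt0 Hlam Hell x; rewrite expnD.
pose G i := W (m + p) (x + (lam (i %% q ^ m)%N
    + (b ^ m)%:Z * ell (i %/ q ^ m)%N + (b ^ (m + p))%:Z * z i)%:~R).
rewrite (sum_ord_mul _ _ G) exchange_big /= -[RHS](Hlam x).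
apply: eq_bigr => a _.
rewrite -[RHS]mulr1 -[X in _ * X](Hell ((x + (lam a)%:~R) / b%:R ^+ m)) mulr_sumr.
apply: eq_bigr => c _.
rewrite /G (addnC (a : nat)) [(_ * c)%N]mulnC modnMDl modn_small// divnMDl ?expn_gt0 ?q_gt0// divn_small//.
rewrite addn0 intrD addrA level_factor_periodic intrD addrA level_factorD.
rewrite level_factor_periodic mulrDl intrM -pmulrn natrX.
by congr (_ * W _ (_ + _)); rewrite mulrAC divff ?mul1r.
Qed.

(** Points congruent modulo [b ^ m] would each contribute 1 to the Parseval
    sum based at one of them. *)
Lemma level_spectrum_inj m lam (i j : 'I_(q ^ m)) (z : int) :
  level_spectrum m lam -> lam i = lam j + (b ^ m)%:Z * z -> i = j.
Proof.
move=> Hlam lamij; apply/eqP; apply: contraT => nij.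
have := Hlam (- (lam j)%:~R); rewrite (bigD1 j)//= (bigD1 i)//=.
rewrite !(addrC (- (lam j)%:~R)) subrr lamij intrD addrAC subrr add0r level_factor_int.
have -> : W m 0 = 1 by have := level_factor_int m 0; rewrite mulr0.
set S := (X in 1 + (1 + X)).
have : 0 <= S by apply: sumr_ge0 => k _; exact: level_factor_ge0.
lra.
Qed.

Hypothesis Phi_ge0 : forall x, 0 <= Phi x.
Hypothesis Phi_le1 : forall x, Phi x <= 1.
Hypothesis Phi0 : Phi 0 = 1.
Hypothesis Phi_scale : forall x, Phi x = w (x / b%:R) * Phi (x / b%:R).

Lemma Phi_level m x : Phi x = W m x * Phi (x / b%:R ^+ m).
Proof.
elim: m x => [|m IH] x; first by rewrite /W big_ord0 mul1r expr0 divr1.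
rewrite -addn1 level_factorD -mulrA IH; congr (_ * _).
by rewrite Phi_scale /W big_ord1 expr1 -mulrA -invfM exprD.
Qed.

Context (ell1 : nat -> int) (C : R).
Hypothesis q_lt_b : (q < b)%N.
Hypothesis ell1_spectrum : level_spectrum 1 ell1.
Hypothesis w_eq1 : forall x, w x = 1 -> exists z : int, x = z%:~R.
Hypothesis w_zeros : finite_set [set x | 0 <= x <= 1 /\ w x = 0].
Hypothesis Phi_lip : forall x y, `|Phi x - Phi y| <= C * `|x - y|.

Lemma sum_w x : \sum_(i < q) w ((x + (ell1 i)%:~R) / b%:R) = 1.
Proof.
have := ell1_spectrum x; rewrite -(big_mkord xpredT (fun i => W 1 (x + (ell1 i)%:~R))).
rewrite expn1 big_mkord => E; rewrite -[RHS]E.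
by apply: eq_bigr => i _; rewrite /W big_ord1 expr1.
Qed.

Lemma lip_ge0 : 0 <= C.
Proof. by have := Phi_lip 1 0; rewrite subr0 normr1 mulr1; apply: le_trans. Qed.

Hypothesis q_gt1 : (1 < q)%N.

Let b_gt1 : (1 < b)%N. Proof. exact: ltn_trans q_lt_b. Qed.

Let b1 : 1 < b%:R :> R. Proof. by rewrite ltr1n. Qed.

Lemma expn_big (x : R) : exists m, x < b%:R ^+ m.
Proof.
exists (Num.truncn x).+1; apply: lt_trans (truncnS_gt x) _.
by rewrite -natrX ltr_nat ltn_expl.
Qed.

Lemma Phi_near0 : exists2 d : R, 0 < d & forall x, `|x| <= d -> Phi x > 0.
Proof.
have C0 := lip_ge0; exists (C + 1)^-1; first by rewrite invr_gt0; lra.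
move=> x xd; have := Phi_lip x 0; rewrite Phi0 subr0 => Px.
have : C * `|x| < 1.
  apply: (le_lt_trans (ler_wpM2l C0 xd)); rewrite ltr_pdivrMr; lra.
move: Px; rewrite ler_distl => /andP[]; lra.
Qed.

(** After division by a large power of [b] the argument falls where [Phi] is
    positive, so a zero of [Phi] in the unit interval is a zero of one of
    finitely many factors. *)
Lemma Phi_zeros_finite : finite_set [set x | 0 <= x < 1 /\ Phi x = 0].
Proof.
have [d d0 Hd] := Phi_near0.
have [m Hm] := expn_big d^-1.
apply: (@sub_finite_set _ _ (\bigcup_(k in `I_m)
   [set y * b%:R ^+ k.+1 | y in [set x | 0 <= x <= 1 /\ w x = 0]])); last first.
  apply: bigcup_finite; first exact: finite_II.
  by move=> k _; apply: finite_image.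
move=> x /= [/andP[x0 x1]]; rewrite (Phi_level m) => /eqP.
rewrite mulf_eq0 => /orP[|]; last first.
  rewrite gt_eqF// Hd// normrM (ger0_norm x0) gtr0_norm ?invr_gt0//.
  rewrite ler_pdivrMr//; apply: (@le_trans _ _ 1); first lra.
  rewrite mulrC -ler_pdivrMr// div1r; exact: ltW.
rewrite /W prodf_seq_eq0 => /hasP[k _ /= /eqP wk].
exists k => //=; exists (x / b%:R ^+ k.+1); last by rewrite divfK.
split=> //; rewrite divr_ge0//= ?ler_pdivrMr// ?(ltW (bR_gt0 _))// mul1r.
by apply: (le_trans (ltW x1)); rewrite exprn_ege1// ltW.
Qed.

(** Suppose that [Phi] vanishes on the whole coset of some point. The set [Z]
    of such points modulo 1 is finite, and it is stable under every inverse
    branch [y -> (y + ell1 i) / b] at which [w] does not vanish. Different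
    points, or different branches, have different images modulo 1, so choosing
    one branch for each point permutes [Z], and no point of [Z] has a second
    branch of this kind. As the values of [w] at the branches add up to 1, the
    only surviving value is 1, which forces the branch to end at an integer.
    Then [Phi] vanishes at 0, where it equals 1. *)
Lemma Phi_shift_neq0 x : exists k : int, Phi (x + k%:~R) != 0.
Proof.
apply: contrapT => /forallNP x_zero.
pose Z := [set x : R | 0 <= x < 1 /\ forall k : int, Phi (x + k%:~R) = 0].
have Zfrac y : (forall k : int, Phi (y + k%:~R) = 0) -> Z (y - (Num.floor y)%:~R).
  move=> y0; split; first by have := floor_itv y; rewrite intrD; lra.
  by move=> k; rewrite -addrA -intrN -intrD.
have [s Zs] : exists s : seq R, Z = [set` s].
  apply/finite_seqP; apply: sub_finite_set Phi_zeros_finite => y [y01 /(_ 0)].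
  by rewrite addr0.
have Zs' y : y \in undup s <-> Z y by rewrite mem_undup Zs.
have Zstep y i : Z y -> w ((y + (ell1 i)%:~R) / b%:R) != 0 ->
    Z ((y + (ell1 i)%:~R) / b%:R - (Num.floor ((y + (ell1 i)%:~R) / b%:R))%:~R).
  move=> [_ yZ] wy; apply: Zfrac => k.
  have := yZ (ell1 i + b%:Z * k); rewrite Phi_scale.
  have -> : (y + (ell1 i + b%:Z * k)%:~R) / b%:R = (y + (ell1 i)%:~R) / b%:R + k%:~R.
    by rewrite intrD intrM -pmulrn addrA mulrDl mulrAC divff ?mul1r//; have := bR_neq0 1.
  by rewrite w_periodic => /eqP; rewrite mulf_eq0 (negPf wy) => /eqP.
have [f fP] : exists f : R -> R, forall y, Z y -> Z (f y) /\ exists i : 'I_q, exists z : int,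
    f y = (y + (ell1 i)%:~R) / b%:R - z%:~R.
  suff /choice[f fP] : forall y, exists p : R, Z y -> Z p /\ exists i : 'I_q, exists z : int,
    p = (y + (ell1 i)%:~R) / b%:R - z%:~R by exists f.
  move=> y; have [Zy|nZy] := pselect (Z y); last by exists 0.
  have [i wi] : exists i : 'I_q, w ((y + (ell1 i)%:~R) / b%:R) != 0.
    apply: contrapT => /forallNP wi; have := sum_w y.
    rewrite big1 => [/eqP|i _]; first by rewrite eq_sym oner_eq0.
    by apply/eqP; apply: contrapT => /negP; exact: wi.
  eexists => _; split; first exact: Zstep wi.
  by exists i; eexists; reflexivity.
have branch_inj y y' (i i' : 'I_q) (z z' : int) : Z y -> Z y' ->
    (y + (ell1 i)%:~R) / b%:R - z%:~R = (y' + (ell1 i')%:~R) / b%:R - z'%:~R ->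
    y = y' /\ i = i'.
  move=> [y01 _] [y'01 _] E.
  have bN0 : b%:R != 0 :> R by have := bR_neq0 1.
  have E' : y - y' = (ell1 i' - ell1 i + b%:Z * (z - z'))%:~R.
    rewrite intrD intrM !intrB -pmulrn.
    have := congr1 (fun t => t * b%:R) E; rewrite !mulrBl !divfK//; lra.
  have yy' : y = y'.
    have : (`|(ell1 i' - ell1 i + b%:Z * (z - z'))%:~R : R| < 1).
      by rewrite -E' ltr_norml; lra.
    rewrite -intr_norm -[X in _ < X]/((1 : int)%:~R) ltr_int => E0.
    have {}E0 : ell1 i' - ell1 i + b%:Z * (z - z') = 0 by lia.
    by move: E'; rewrite E0 => /eqP; rewrite subr_eq0 => /eqP.
  split => //; move: E'; rewrite yy' subrr => /esym/eqP.
  rewrite intr_eq0 => /eqP E0.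
  have q1 : (q = q ^ 1)%N by rewrite expn1.
  have := @level_spectrum_inj 1 ell1 (cast_ord q1 i) (cast_ord q1 i') (z - z') ell1_spectrum.
  rewrite /= expn1 => /(_ _)/(congr1 val)/= ii; apply/val_inj/ii.
  by rewrite -[LHS]addr0 -E0; ring.
have f_onto : map f (undup s) =i undup s.
  have f_uniq : uniq (map f (undup s)).
    rewrite map_inj_in_uniq ?undup_uniq// => y y' /Zs' Zy /Zs' Zy' ff.
    have [_ [i [z fy]]] := fP _ Zy; have [_ [i' [z' fy']]] := fP _ Zy'.
    by rewrite fy fy' in ff; have [] := branch_inj _ _ _ _ _ _ Zy Zy' ff.
  have [] := uniq_min_size f_uniq _ (_ : (size (undup s) <= _)%N) => //.
    by move=> _ /mapP[y /Zs' Zy ->]; apply/Zs'; have [] := fP _ Zy.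
  by rewrite size_map.
have Z0 : Z (x - (Num.floor x)%:~R).
  by apply: Zfrac => k; apply/eqP; apply: contrapT => /negP; exact: x_zero.
set y := x - _ in Z0.
have [Zfy [i [z fy]]] := fP _ Z0.
have w1 : w ((y + (ell1 i)%:~R) / b%:R) = 1.
  rewrite -[RHS](sum_w y) (bigD1 i)//= big1 ?addr0// => j ji.
  apply/eqP; apply: contraT => wj.
  have := Zstep _ _ Z0 wj => /Zs'; rewrite -f_onto => /mapP[y' /Zs' Zy' E].
  have [_ [i' [z' fy']]] := fP _ Zy'; rewrite fy' in E.
  have [yy' ji'] := branch_inj _ _ _ _ _ _ Z0 Zy' E.
  move: fy'; rewrite -yy' fy => /(branch_inj _ _ _ _ _ _ Z0 Z0)[_ ii'].
  by rewrite ji' -ii' eqxx in ji.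
have [u Eu] := w_eq1 w1.
have [fy01 /(_ (z - u))] := Zfy.
rewrite fy Eu -intrB -intrD (_ : u - z + (z - u) = 0) ?Phi0; last by ring.
by move/eqP; rewrite oner_eq0.
Qed.

(** Uniform version of [Phi_shift_neq0], by continuity of [Phi] and
    compactness of the unit interval. *)
Lemma Phi_shift_bounded : exists (K e : R),
  [/\ 0 <= K, 0 < e & forall x, exists k : int, `|x + k%:~R| <= K /\ e <= Phi (x + k%:~R)].
Proof.
pose U (n : nat) : set R :=
  [set x | exists k : int, `|k%:~R| <= n%:R :> R /\ n.+1%:R^-1 < Phi (x + k%:~R)].
have Ule n m : (n <= m)%N -> U n `<=` U m.
  move=> nm x [k [kn Pk]]; exists k; split; first by apply: le_trans kn _; rewrite ler_nat.
  by apply: le_lt_trans Pk; rewrite lef_pV2 ?posrE ?ltr0n// ler_nat.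
have C0 := lip_ge0.
have Uopen n : open (U n).
  rewrite openE => x [k [kn Pk]].
  have C1 : 0 < C + 1 by lra.
  move: Pk; set e := _^-1 => Pk.
  apply/nbhs_ballP; exists ((Phi (x + k%:~R) - e) / (C + 1)) => /=.
    by rewrite divr_gt0// subr_gt0.
  move=> y; rewrite /ball /= ltr_pdivlMr// => xy.
  exists k; split => //; rewrite -/e.
  have := Phi_lip (x + k%:~R) (y + k%:~R).
  rewrite (_ : x + k%:~R - (y + k%:~R) = x - y); last by ring.
  rewrite ler_distl => /andP[_ L]; have := normr_ge0 (x - y); nra.
have := @segment_compact R 0 1; rewrite compact_cover.
move=> /(_ nat setT U)[] //.
  move=> x _; have [k Pk] := Phi_shift_neq0 x.
  have Pk0 : 0 < Phi (x + k%:~R) by rewrite lt0r Pk Phi_ge0.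
  pose n1 := Num.truncn (Phi (x + k%:~R))^-1.
  exists (maxn n1 `|k|%N) => //; exists k; split.
    by rewrite -intr_norm -abszE -pmulrn ler_nat leq_maxr.
  rewrite -[ltRHS]invrK ltf_pV2 ?posrE ?invr_gt0 ?ltr0n//.
  apply: lt_le_trans (truncnS_gt _) _; by rewrite ler_nat ltnS leq_maxl.
move=> D _ Dcov; pose N := (\max_(n <- D) n)%N.
exists (N%:R + 1), N.+1%:R^-1; split; [by rewrite addr_ge0 ?ler0n|by rewrite invr_gt0 ltr0n|].
move=> x; have xf := floor_itv x; rewrite intrD in xf.
have /Dcov[n /= nD Un] : [set` `[0, 1]] (x - (Num.floor x)%:~R).
  by rewrite /= in_itv /=; lra.
have /(_ N) [|k [kN Pk]] := Ule _ _ _ _ Un; first exact: leq_bigmax_seq.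
exists (k - Num.floor x); rewrite intrB.
have -> : x + (k%:~R - (Num.floor x)%:~R) = x - (Num.floor x)%:~R + k%:~R by ring.
split; last exact: ltW.
apply: le_trans (ler_normD _ _) _; rewrite addrC lerD// ger0_norm; lra.
Qed.

(** As [q < b], the opposites of the points of the first level miss a residue
    class modulo [b]. *)
Lemma residue_avoiding : exists r : int, forall i, (i < q)%N -> ~~ (b%:Z %| r + ell1 i)%Z.
Proof.
pose s := [seq `|((- ell1 i) %% b%:Z)%Z|%N | i <- iota 0 q].
have [r rb rs] : exists2 r, (r < b)%N & r \notin s.
  apply: contrapT => H.
  have : {subset iota 0 b <= s}.
    move=> r; rewrite mem_iota /= add0n => rb; apply: contraT => rs.
    by exfalso; apply: H; exists r.
  move=> /(uniq_leq_size (iota_uniq 0 b)).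
  by rewrite size_map !size_iota leqNgt q_lt_b.
exists r%:Z => i iq; apply: contra rs => /dvdzP[c Ec].
apply/mapP; exists i; first by rewrite mem_iota.
have -> : - ell1 i = (- c) * b%:Z + r%:Z by lia.
by rewrite modzMDl modz_small.
Qed.

(** Start from a class that [- ell1] misses: then every [r + ell1 i + b k] is
    nonzero, and one can choose [i] with a nonzero value of [w] at the branch
    and then [k] such that [Phi] does not vanish there. *)
Lemma Phi_int_neq0 : exists2 J : int, J != 0 & 0 < Phi J%:~R.
Proof.
have [r Hr] := residue_avoiding.
have [i wi] : exists i : 'I_q, w ((r%:~R + (ell1 i)%:~R) / b%:R) != 0.
  apply: contrapT => /forallNP wi; have := sum_w r%:~R.
  rewrite big1 => [/eqP|i _]; first by rewrite eq_sym oner_eq0.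
  by apply/eqP; apply: contrapT => /negP; exact: wi.
have [k Pk] := Phi_shift_neq0 ((r%:~R + (ell1 i)%:~R) / b%:R).
exists (r + ell1 i + b%:Z * k).
  apply: contra (Hr i (ltn_ord i)) => /eqP E; apply/dvdzP; exists (- k).
  by rewrite mulNr mulrC; apply/eqP; rewrite -addr_eq0 E.
rewrite lt0r Phi_ge0 andbT Phi_scale !intrD intrM -pmulrn.
have bN0 : b%:R != 0 :> R by have := bR_neq0 1.
rewrite mulrDl [X in _ + X]mulrAC divff// mul1r w_periodic mulf_neq0//.
Qed.

Lemma level_spectrum_ext m lam lam' : (forall i, (i < q ^ m)%N -> lam i = lam' i) ->
  level_spectrum m lam -> level_spectrum m lam'.
Proof.
by move=> E H x; rewrite -[RHS](H x); apply: eq_bigr => i _; rewrite E.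
Qed.

Hypothesis ell1_0 : ell1 0%N = 0.

Lemma level_spectrum_exists p : exists2 ell, level_spectrum p ell & ell 0%N = 0.
Proof.
have q_gt0 : (0 < q)%N by exact: ltnW.
elim: p => [|p [ell Hell ell0]].
  exists (fun=> 0) => // x; rewrite expn0 big_ord1 /W big_ord0//.
rewrite -addn1; eexists; first exact: (level_spectrum_comp (fun=> 0) q_gt0 Hell ell1_spectrum).
by rewrite /= mod0n div0n ell0 ell1_0 !mulr0 !addr0.
Qed.

Definition window_count (n : nat) (P : pred nat) (lam : nat -> int) (x h : R) : nat :=
  count (fun i => P i && (`|(lam i)%:~R - x| < h)) (iota 0 n).

Lemma count_iota_two n (P : pred nat) : (1 < count P (iota 0 n))%N ->
  exists i j, [/\ (i < n)%N, (j < n)%N, i != j, P i & P j].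
Proof.
rewrite -size_filter => H.
set s := [seq i <- iota 0 n | P i] in H.
have us : uniq s by rewrite filter_uniq ?iota_uniq.
have mem k : (k < size s)%N -> P (nth 0%N s k) && (nth 0%N s k < n)%N.
  by move=> /(mem_nth 0%N); rewrite mem_filter mem_iota add0n.
have /andP[P0 n0] := mem 0%N (ltnW H); have /andP[P1 n1] := mem 1%N H.
by exists (nth 0%N s 0), (nth 0%N s 1); split => //; rewrite nth_uniq// ltnW.
Qed.

(** Among separated candidates, keep the longest initial segment none of whose
    windows exceeds the bound [G h + 1]. The next candidate breaks the bound
    in some window; removing it leaves at least [G h] points there. That
    window holds two candidates, so it is at least as long as their
    separation. *)
Lemma greedy_cluster (G : R -> R) (n : nat) (P0 : pred nat) (y : nat -> int) (sep h0 x0 : R) :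
  (forall h, 0 <= G h) ->
  (forall i j, (i < n)%N -> (j < n)%N -> i != j -> P0 i -> P0 j ->
     sep <= `|(y i)%:~R - (y j)%:~R|) ->
  0 < h0 -> G h0 + 1 < (window_count n P0 y x0 h0)%:R ->
  exists j,
    (forall x h, 0 < h ->
       (window_count n (fun i => P0 i && (i < j)%N) y x h)%:R <= G h + 1) /\
    exists x h, [/\ 0 < h, sep <= 2 * h &
       G h <= (window_count n (fun i => P0 i && (i < j)%N) y x h)%:R].
Proof.
move=> G0 Hsep h00 Hfull.
pose c j x h := window_count n (fun i => P0 i && (i < j)%N) y x h.
pose bad j := `[< exists x h, 0 < h /\ G h + 1 < (c j x h)%:R >].
have exbad : exists j, bad j.
  exists n; apply/asboolP; exists x0, h0; split=> //.
  rewrite /c /window_count (_ : count _ _ = window_count n P0 y x0 h0)//.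
  by apply: eq_in_count => i; rewrite mem_iota add0n /= => ->; rewrite andbT.
have [j /asboolP[x [h [h_gt0 jbad]]] jmin] := ex_minnP exbad.
case: j => [|j] in jbad jmin *.
  exfalso; move: jbad; rewrite /c /window_count (@eq_count _ _ pred0) ?count_pred0.
    by have := G0 h; rewrite /=; lra.
  by move=> i; rewrite /= ltn0 andbF.
have cS : (c j.+1 x h <= c j x h + 1)%N.
  rewrite /c /window_count.
  apply: (@leq_trans (count (predU (fun i => P0 i && (i < j)%N && (`|(y i)%:~R - x| < h))
     (pred1 j)) (iota 0 n))).
    apply: sub_count => i /= /andP[/andP[Pi]]; rewrite ltnS leq_eqVlt => /orP[->|ij d].
      by rewrite orbT.
    by rewrite Pi ij d.
  rewrite -(leq_add2r (count (predI (fun i => P0 i && (i < j)%N && (`|(y i)%:~R - x| < h))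
     (pred1 j)) (iota 0 n))) count_predUI.
  apply: leq_trans (leq_addr _ _); rewrite leq_add2l.
  by rewrite count_uniq_mem ?iota_uniq// leq_b1.
exists j; split.
  move=> x' h' h'0; rewrite leNgt; apply/negP => H.
  suff /jmin : bad j by rewrite ltnn.
  by apply/asboolP; exists x', h'.
exists x, h; split => //; last first.
  have : G h + 1 < (c j x h + 1)%:R by apply: lt_le_trans jbad _; rewrite ler_nat.
  by rewrite natrD ltrD2r => /ltW.
have : (1 < c j.+1 x h)%N.
  by rewrite -(ltr_nat R); apply: le_lt_trans jbad; have := G0 h; lra.
case/count_iota_two => i [k [ni nk ik /andP[/andP[Pi _] di] /andP[/andP[Pk _] dk]]].
apply: le_trans (Hsep _ _ ni nk ik Pi Pk) _.
move: di dk; rewrite !ltr_norml => /andP[? ?] /andP[? ?].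
by rewrite ler_norml; lra.
Qed.

Context (G : R -> R) (J : int).
Hypothesis G_ge0 : forall h, 0 <= G h.

(** The point [lam i] lies close to [b ^ M i * J], so [M i] is its scale.
    Points of one scale form a cluster, whose windows [G] controls. Since [i <
    M i], at most [N] points have a scale at most [N]. *)
Definition well_placed (m : nat) (lam : nat -> int) (M : nat -> nat) : Prop :=
  [/\ forall i, (i < q ^ m)%N -> (i < M i)%N,
      forall i, (i < q ^ m)%N ->
        8 * `|(lam i)%:~R - b%:R ^+ M i * J%:~R| <= b%:R ^+ M i :> R &
      forall N x h, 0 < h ->
        (window_count (q ^ m) (fun i => M i == N) lam x h)%:R <= G h + 1].

(** One step of the construction keeps the old points and saturates [G] in a
    window of radius at least [b ^ m / 2]. On the new scale [b ^ m'] the old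
    points become negligible, while [Phi] stays bounded below at the new ones;
    this dichotomy is what makes the limit complete. *)
Definition extends (n m m' : nat) (lam lam' : nat -> int) (M M' : nat -> nat) (e : R) : Prop :=
  [/\ (m < m')%N,
      forall i, (i < q ^ m)%N -> lam' i = lam i /\ M' i = M i,
      exists x h, [/\ 0 < h, b%:R ^+ m <= 2 * h &
        G h <= (window_count (q ^ m') predT lam' x h)%:R],
      forall i, (i < q ^ m)%N -> `|(lam i)%:~R| * n.+1%:R <= b%:R ^+ m' :> R &
      forall i, (q ^ m <= i < q ^ m')%N -> e <= Phi ((lam' i)%:~R / b%:R ^+ m')].

Lemma count_iota_dvd (d p : nat) : (0 < d)%N ->
  count (fun i => (d <= i)%N && (d %| i)%N) (iota 0 (d * p)) = p.-1.
Proof.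
move=> d0; case: p => [|p]; first by rewrite muln0.
rewrite mulnS iotaD count_cat add0n /= (@eq_in_count _ _ pred0) ?count_pred0 ?add0n; last first.
  by move=> i; rewrite mem_iota add0n /= => id; rewrite leqNgt id.
elim: p => [|p IH]; first by rewrite muln0.
rewrite mulnS addnC iotaD count_cat IH -addn1; congr addn.
rewrite (@eq_in_count _ _ (pred1 (d + d * p)%N)).
  by rewrite count_uniq_mem ?iota_uniq// mem_iota leqnn /= -[X in (X < _)%N]addn0 ltn_add2l d0.
move=> i; rewrite mem_iota /= => /andP[i1 i2].
rewrite (leq_trans (leq_addr _ _) i1) /=; apply/idP/eqP => [/dvdnP[c ci]|->].
  have : (d * p.+1 <= d * c < d * p.+2)%N by rewrite (mulnC d c) -ci; apply/andP; split; nia.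
  rewrite leq_pmul2l// ltn_pmul2l// => cp; have {}cp : c = p.+1 by lia.
  by rewrite ci cp mulnC mulnS.
by rewrite -mulnS dvdn_mulr.
Qed.

(** Three freedoms are used in turn. A bounded multiple [k i] of the period [b
    ^ m'] brings each new point, on the scale [b ^ m'], to a place where [Phi]
    is at least [e0]. Then [greedy_cluster] selects, among the new points with
    trivial low digits, a cluster that saturates [G]; its candidates run out
    of room because [q ^ p - 1] of them lie in a window in which [G] allows
    fewer. Finally a translation by [b ^ M' i * J] sends the cluster to a
    common new scale and every other new point to a scale of its own; as [Phi]
    is bounded below near [J], this costs only the factor [c0]. *)
Lemma extension_exists (K e0 c0 d0 : R) :
  (forall B, 0 <= B -> exists p0, forall p, (p0 <= p)%N ->
     G (B * b%:R ^+ p + 1) + 1 < (q ^ p).-1%:R) ->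
  J != 0 -> 0 <= K -> 0 < d0 -> 0 <= e0 ->
  (forall x, exists k : int, `|x + k%:~R| <= K /\ e0 <= Phi (x + k%:~R)) ->
  (forall y, `|y| <= d0 -> c0 <= Phi (y + J%:~R)) -> 0 <= c0 ->
  forall n m lam M, level_spectrum m lam -> well_placed m lam M ->
  exists m' lam' M', [/\ level_spectrum m' lam', well_placed m' lam' M' &
     extends n m m' lam lam' M M' (e0 * c0)].
Proof.
move=> G_grow J0 K0 d0_gt0 e00 HK HJ c00 n m lam M Hlam [Mi Mlam Mcount].
have q_gt0 : (0 < q)%N by exact: ltnW.
have [N0 HN0] := expn_big (8 * K + K / d0).
pose A := (\sum_(i < q ^ m) `|lam i|)%N.
have Ai i : (i < q ^ m)%N -> (`|lam i| <= A)%N.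
  by move=> im; rewrite /A (bigD1 (Ordinal im))//= leq_addr.
have [p0 Hp0] := G_grow (K * b%:R ^+ m) (mulr_ge0 K0 (ltW (bR_gt0 m))).
(* [p0] provides enough candidates for the cluster, and the second term makes
   [b ^ m'] exceed [n.+1] times every old point. *)
pose p := (p0 + A * n.+1).+1.
have [ell Hell ell0] := level_spectrum_exists p.
pose m' := (m + p)%N.
pose base i := lam (i %% q ^ m)%N + (b ^ m)%:Z * ell (i %/ q ^ m)%N.
have /choice[k Hk] : forall i, exists k : int,
   `|(base i)%:~R / b%:R ^+ m' + k%:~R| <= K /\ e0 <= Phi ((base i)%:~R / b%:R ^+ m' + k%:~R) :> R.
  by move=> i; exact: HK.
pose y i := base i + (b ^ m')%:Z * k i.
have yE i : (y i)%:~R / b%:R ^+ m' = (base i)%:~R / b%:R ^+ m' + (k i)%:~R :> R.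
  by rewrite intrD intrM -pmulrn natrX mulrDl mulrAC divff ?mul1r.
have yK i : `|(y i)%:~R| <= K * b%:R ^+ m' :> R.
  have [+ _] := Hk i; rewrite -yE normrM normfV (gtr0_norm (bR_gt0 m')).
  by rewrite ler_pdivrMr.
have Hy : level_spectrum m' y by exact: level_spectrum_comp.
have y_inj i j : (i < q ^ m')%N -> (j < q ^ m')%N -> y i = y j -> i = j.
  move=> im jm yij; have := @level_spectrum_inj m' y (Ordinal im) (Ordinal jm) 0 Hy.
  by rewrite /= mulr0 addr0 => /(_ yij)/(congr1 val).
(* The indices with trivial low digits: they all extend [lam 0], so their
   points differ by nonzero multiples of [b ^ m]. *)
pose P0 i := (q ^ m <= i)%N && (q ^ m %| i)%N.
have y_sep i j : (i < q ^ m')%N -> (j < q ^ m')%N -> i != j -> P0 i -> P0 j ->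
    b%:R ^+ m <= `|(y i)%:~R - (y j)%:~R| :> R.
  move=> im jm ij /andP[_ /dvdnP[ci Ei]] /andP[_ /dvdnP[cj Ej]].
  have yy : y i - y j = (b ^ m)%:Z * (ell ci - ell cj + (b ^ p)%:Z * (k i - k j)).
    rewrite /y /base Ei Ej !modnMl !mulnK ?expn_gt0 ?q_gt0// /m' expnD PoszM; ring.
  rewrite -intrB yy intrM normrM -pmulrn natrX (gtr0_norm (bR_gt0 m)).
  rewrite ler_peMr ?(ltW (bR_gt0 m))// -intr_norm -[X in X <= _]/((1 : int)%:~R) ler_int.
  suff : ell ci - ell cj + (b ^ p)%:Z * (k i - k j) != 0 by lia.
  apply: contra ij => /eqP E; apply/eqP/y_inj => //; apply/eqP; rewrite -subr_eq0 yy E.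
  by rewrite mulr0.
have qm'E : (q ^ m' = q ^ m * q ^ p)%N by rewrite expnD.
have h00 : 0 < K * b%:R ^+ m' + 1 by rewrite ltr_wpDl// mulr_ge0// ltW.
have Hfull : G (K * b%:R ^+ m' + 1) + 1 <
    (window_count (q ^ m') P0 y 0 (K * b%:R ^+ m' + 1))%:R.
  rewrite /window_count (@eq_count _ _ P0); last first.
    move=> i; rewrite subr0 (_ : (_ < _) = true) ?andbT//.
    by apply: le_lt_trans (yK i) _; rewrite ltrDl.
  rewrite qm'E count_iota_dvd ?expn_gt0 ?q_gt0// exprD mulrA.
  by apply: Hp0; rewrite /p; lia.
have [j [cl_small [xc [hc [hc_gt0 hc_sep cl_big]]]]] :=
  greedy_cluster G_ge0 y_sep h00 Hfull.
(* Above all the scales of old points, and such that the bound [K * b ^ m']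
   for [y] is at most [b ^ T / 8] and at most [d0 * b ^ T]. *)
pose T := (\sum_(i < q ^ m) M i + q ^ m' + m' + N0).+1.
have TM i : (i < q ^ m)%N -> (M i < T)%N.
  move=> im; rewrite /T ltnS (bigD1 (Ordinal im))//= -!addnA; exact: leq_addr.
pose cl i := P0 i && (i < j)%N.
pose M' i := if (i < q ^ m)%N then M i else if cl i then T else (T + 1 + i)%N.
have M'T i : (q ^ m <= i)%N -> (T <= M' i)%N.
  by move=> im; rewrite /M' ltnNge im /=; case: ifP => // _; rewrite -addnA leq_addr.
pose lam' i := if (i < q ^ m)%N then lam i else y i + (b ^ M' i)%:Z * J.
have qmm' : (q ^ m <= q ^ m')%N by rewrite leq_exp2l// leq_addr.
have lam'_new i : (q ^ m <= i)%N -> (lam' i)%:~R = (y i)%:~R + b%:R ^+ M' i * J%:~R :> R.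
  by move=> im; rewrite /lam' ltnNge im /= intrD intrM -pmulrn natrX.
have T_gt : [/\ (q ^ m' < T)%N & (m' + N0 < T)%N].
  by rewrite /T !ltnS; split; [rewrite -!addnA addnCA leq_addr|rewrite -addnA leq_addl].
have [Tq Tm] := T_gt.
exists m', lam', M'; split.
- pose z i := if (i < q ^ m)%N then 0 else k i + (b ^ (M' i - m'))%:Z * J.
  apply: (@level_spectrum_ext _ (fun i => base i + (b ^ m')%:Z * z i)); last exact: level_spectrum_comp.
  move=> i im'; rewrite /lam' /z; case: ltnP => im.
    by rewrite mulr0 addr0 /base modn_small// divn_small// ell0 mulr0 addr0.
  rewrite mulrDr mulrA -PoszM -expnD subnKC ?addrA//.
  by apply: leq_trans (M'T _ im); apply: ltnW; apply: leq_ltn_trans Tm; exact: leq_addr.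
- split.
  + move=> i im'; have [im|im] := ltnP i (q ^ m); first by rewrite /M' im Mi.
    by apply: leq_trans (M'T _ im); apply: ltn_trans Tq.
  + move=> i im'; have [im|im] := ltnP i (q ^ m); first by rewrite /lam' /M' im Mlam.
    rewrite lam'_new// addrK.
    apply: (@le_trans _ _ (8 * (K * b%:R ^+ m'))); first by rewrite ler_wpM2l.
    rewrite mulrA; apply: (@le_trans _ _ (b%:R ^+ N0 * b%:R ^+ m')).
      rewrite ler_wpM2r ?(ltW (bR_gt0 m'))//; apply: le_trans (ltW HN0).
      by rewrite lerDl divr_ge0// ltW.
    by rewrite -exprD ler_eXn2l// addnC; apply: leq_trans (M'T _ im); exact: ltnW.
  + move=> N x h h0; rewrite /window_count.
    have -> : (q ^ m' = q ^ m + (q ^ m' - q ^ m))%N by rewrite subnKC.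
    rewrite iotaD count_cat add0n.
    have old : count (fun i => (M' i == N) && (`|(lam' i)%:~R - x| < h)) (iota 0 (q ^ m)) =
        window_count (q ^ m) (fun i => M i == N) lam x h.
      by apply: eq_in_count => i; rewrite mem_iota add0n /= /M' /lam' => ->.
    rewrite old; have [NT|NT] := ltnP N T.
      rewrite [X in (_ + X)%N](_ : _ = 0%N) ?addn0; first exact: Mcount.
      rewrite (@eq_in_count _ _ pred0) ?count_pred0// => i; rewrite mem_iota => /andP[im _].
      by rewrite (_ : M' i == N = false)//; apply/negbTE; rewrite neq_ltn (leq_trans NT (M'T _ im)) orbT.
    rewrite [X in (X + _)%N](_ : _ = 0%N) ?add0n; last first.
      rewrite /window_count (@eq_in_count _ _ pred0) ?count_pred0// => i.
      rewrite mem_iota add0n => /= im.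
      by rewrite (_ : M i == N = false)//; apply/negbTE; rewrite neq_ltn (leq_trans (TM _ im) NT).
    have [{old NT}->|NT'] := eqVneq N T.
      apply: (le_trans _ (cl_small (x - b%:R ^+ T * J%:~R) h h0)); rewrite ler_nat.
      rewrite /window_count -[X in iota 0 X](subnKC qmm') iotaD count_cat add0n.
      apply: leq_trans (leq_addl _ _).
      rewrite -!size_filter; apply: eq_leq; congr size; apply: eq_in_filter => i.
      rewrite mem_iota => /andP[im _]; rewrite lam'_new//.
      rewrite /M' ltnNge im /= -/(cl i); case: (boolP (cl i)) => [ci|nci].
        by rewrite eqxx opprB addrA.
      by rewrite -addnA -[X in _ == X]addn0 eqn_add2l.
    set c := count _ _; suff : (c <= 1)%N; rewrite /c.
      by rewrite -(ler_nat R) => /le_trans; apply; rewrite lerDr.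
    apply: leq_trans (_ : (count (pred1 (N - T - 1)%N) (iota (q ^ m) (q ^ m' - q ^ m)) <= _)%N).
      rewrite -!size_filter; apply: uniq_leq_size; first by rewrite filter_uniq ?iota_uniq.
      move=> i; rewrite !mem_filter => /andP[/andP[/eqP MiN _] ii]; rewrite ii andbT /=.
      move: ii MiN; rewrite mem_iota => /andP[im _]; rewrite /M' ltnNge im /=.
      case: ifP => _ TN; first by rewrite TN eqxx in NT'.
      by rewrite -TN -subnDA addKn.
    by rewrite count_uniq_mem ?iota_uniq// leq_b1.
- split.
  + by rewrite /m' -[X in (X < _)%N]addn0 ltn_add2l.
  + by move=> i im; rewrite /lam' /M' im.
  + exists (xc + b%:R ^+ T * J%:~R), hc; split => //.
    apply: le_trans cl_big _; rewrite ler_nat; apply: sub_count => i /= /andP[ci d].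
    have im : (q ^ m <= i)%N by case/andP: ci => /andP[].
    rewrite lam'_new// /M' ltnNge im /= -/(cl i) /cl ci.
    by move: d; congr (`|_| < _); ring.
  + move=> i im; apply: (@le_trans _ _ ((A * n.+1)%:R)).
      by rewrite natrM ler_wpM2r// -intr_norm -abszE -pmulrn ler_nat Ai.
    rewrite -natrX ler_nat; apply: ltnW; apply: leq_trans (ltn_expl _ b_gt1) _.
    rewrite leq_exp2l//; apply: leq_trans (leq_addl m p).
    by apply: leqW; exact: leq_addl.
  + move=> i /andP[im im'].
    (* Divide by the remaining power [b ^ N] of the scale: the point then lies
       within [d0] of [J], while the discarded factor [W N] is the one at [u],
       by periodicity. *)
    have [N MN NN] : exists2 N, (M' i = m' + N)%N & (N0 <= N)%N.
      have N0M : (m' + N0 <= M' i)%N by apply: leq_trans (ltnW Tm) (M'T _ im).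
      by exists (M' i - m')%N; rewrite ?subnKC ?leq_subRL//; apply: leq_trans N0M; exact: leq_addr.
    rewrite lam'_new// mulrDl yE MN exprD.
    have -> : b%:R ^+ m' * b%:R ^+ N * J%:~R / b%:R ^+ m' = ((b ^ N)%:Z * J)%:~R :> R.
      by rewrite -(mulrA (b%:R ^+ m')) mulrAC divff// mul1r intrM -pmulrn natrX.
    have [uK ue] := Hk i; move: uK ue; set u := _ / _ + _ => uK ue.
    rewrite (Phi_level N) level_factor_periodic intrM -pmulrn natrX mulrDl.
    rewrite [X in _ + X]mulrAC divff// mul1r.
    apply: ler_pM => //.
      apply: (le_trans ue); rewrite (Phi_level N) ler_piMr//; exact: level_factor_ge0.
    apply: HJ; rewrite normrM normfV (gtr0_norm (bR_gt0 N)) ler_pdivrMr//.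
    apply: (le_trans uK); rewrite mulrC -ler_pdivrMr//.
    apply: (@le_trans _ _ (b%:R ^+ N0)); last by rewrite ler_eXn2l.
    by apply: le_trans (ltW HN0); rewrite lerDr mulr_ge0.
Qed.

(** In the Parseval sum based at [- lam j] the term of [j] is already 1, so
    the term of [i] vanishes. *)
Lemma level_spectrum_orth m lam i j : level_spectrum m lam ->
  (i < q ^ m)%N -> (j < q ^ m)%N -> i != j -> Phi ((lam i)%:~R - (lam j)%:~R) = 0.
Proof.
move=> Hlam im jm ij; have := Hlam (- (lam j)%:~R).
rewrite (bigD1 (Ordinal jm))//= (bigD1 (Ordinal im))//=.
rewrite !(addrC (- (lam j)%:~R)) subrr.
have -> : W m 0 = 1 by have := level_factor_int m 0; rewrite mulr0.
set S := (X in 1 + (_ + X)).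
have S0 : 0 <= S by apply: sumr_ge0 => k _; exact: level_factor_ge0.
have := level_factor_ge0 m ((lam i)%:~R - (lam j)%:~R) => W0 E.
have {W0 S0}W0 : W m ((lam i)%:~R - (lam j)%:~R) = 0 by lra.
by rewrite (Phi_level m) W0 mul0r.
Qed.

Lemma window_count_mono n n' P lam x h : (n <= n')%N ->
  (window_count n P lam x h <= window_count n' P lam x h)%N.
Proof.
by move=> nn'; rewrite /window_count -(subnKC nn') iotaD count_cat leq_addr.
Qed.

Lemma window_count_le n P lam x h : (window_count n P lam x h <= n)%N.
Proof. by rewrite /window_count (leq_trans (count_size _ _))// size_iota. Qed.

Lemma window_count_ext n P lam P' lam' x h :
  (forall i, (i < n)%N -> P i = P' i /\ lam i = lam' i) ->
  window_count n P lam x h = window_count n P' lam' x h.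
Proof.
move=> E; apply: eq_in_count => i; rewrite mem_iota add0n => /= iN.
by have [-> ->] := E _ iN.
Qed.

(** Iterate [extension_exists]. Orthogonality and the counting bounds hold at
    each stage. For completeness, suppose that the sums of [Phi (x + lam i)]
    over all stages stay below [1 - eta]. Writing [Phi] at level [m'] as a
    Parseval weight [W m'] times a value of [Phi] on the scale [b ^ m'], the
    old points have values near 1, so they carry weight at most [1 - eta / 2];
    the new points carry the remaining weight [eta / 2] and have values at
    least [e / 2]. Each stage would thus add a fixed positive amount to a
    bounded sum. *)
Lemma clustered_spectrum_exists :
  (forall B, 0 <= B -> exists p0, forall p, (p0 <= p)%N ->
     G (B * b%:R ^+ p + 1) + 1 < (q ^ p).-1%:R) ->
  J != 0 -> 0 < Phi J%:~R ->
  exists (lam : nat -> int) (M : nat -> nat),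
  [/\ forall i j, i != j -> Phi ((lam i)%:~R - (lam j)%:~R) = 0,
      forall x eta, 0 < eta -> exists n, 1 - eta < \sum_(i < n) Phi (x + (lam i)%:~R),
      forall i, (i < M i)%N /\ 8 * `|(lam i)%:~R - b%:R ^+ M i * J%:~R| <= b%:R ^+ M i :> R,
      forall n N x h, 0 < h ->
        (window_count n (fun i => M i == N) lam x h)%:R <= G h + 1 &
      forall H, exists n x h, [/\ H <= h, 0 < h &
        G h <= (window_count n predT lam x h)%:R]].
Proof.
move=> G_grow J0 PhiJ.
have C0 := lip_ge0.
have [K [e0 [K0 e0_gt0 HK]]] := Phi_shift_bounded.
pose c0 := Phi J%:~R / 2; have c00 : 0 < c0 by rewrite divr_gt0.
pose d0 := c0 / (C + 1); have d00 : 0 < d0 by rewrite divr_gt0// ltr_wpDl.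
have HJ y : `|y| <= d0 -> c0 <= Phi (y + J%:~R).
  move=> yd; have := Phi_lip (y + J%:~R) J%:~R; rewrite addrK ler_distl => /andP[+ _].
  have : C * `|y| <= c0.
    move: yd; rewrite /d0 ler_pdivlMr ?ltr_wpDl// mulrC; apply: le_trans.
    by rewrite ler_wpM2r// lerDl.
  rewrite /c0; lra.
pose e := e0 * c0; have e_gt0 : 0 < e by rewrite mulr_gt0.
pose good (s : nat * (nat -> int) * (nat -> nat)) :=
  level_spectrum s.1.1 s.1.2 /\ well_placed s.1.1 s.1.2 s.2.
pose ext n (s s' : nat * (nat -> int) * (nat -> nat)) :=
  extends n s.1.1 s'.1.1 s.1.2 s'.1.2 s.2 s'.2 e.
have stepP n s : exists s', good s -> good s' /\ ext n s s'.
  have [gs|] := pselect (good s); last by exists s.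
  case: s gs => [[m lam] M] [/= Hlam Hpl].
  have [m' [lam' [M' [H1 H2 H3]]]] :=
    extension_exists G_grow J0 K0 d00 (ltW e0_gt0) HK HJ (ltW c00) n Hlam Hpl.
  by exists (m', lam', M').
have /choice[step {}stepP] : forall n, exists f, forall s, good s -> good (f s) /\ ext n s (f s).
  by move=> n; have [f Hf] := choice (stepP n); exists f.
pose s0 : nat * (nat -> int) * (nat -> nat) := (0%N, fun=> b%:Z * J, fun=> 1%N).
have good0 : good s0.
  split=> /=.
    by move=> x; rewrite expn0 big_ord1 /W big_ord0.
  split.
  - by move=> i; rewrite expn0.
  - by move=> i _; rewrite intrM -pmulrn expr1 subrr normr0 mulr0 ler0n.
  - move=> N x h _; apply: (@le_trans _ _ 1%:R); last by rewrite lerDr.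
    by rewrite ler_nat; apply: leq_trans (window_count_le _ _ _ _ _) _; rewrite expn0.
pose st := fix st n := if n is n'.+1 then step n' (st n') else s0.
have gst n : good (st n) by elim: n => [//|n IH] /=; have [] := stepP n _ IH.
have est n : ext n (st n) (st n.+1) by have [] := stepP n _ (gst n).
pose m n := (st n).1.1.
have mS n : (m n < m n.+1)%N by have [] := est n.
have m_ge n : (n <= m n)%N by elim: n => [//|n IH]; exact: leq_ltn_trans (mS n).
have m_mono n n' : (n <= n')%N -> (m n <= m n')%N.
  move=> /subnK <-; elim: (n' - n)%N => [//|k IH].
  by apply: (leq_trans IH); rewrite addSn; exact: ltnW.
have agree n n' i : (n <= n')%N -> (i < q ^ m n)%N ->
    (st n').1.2 i = (st n).1.2 i /\ (st n').2 i = (st n).2 i.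
  move=> nn' im; move: nn' => /subnK <-; elim: (n' - n)%N => [//|k [<- <-]].
  have [_ + _ _ _] := est (k + n)%N; apply; apply: leq_trans im _.
  by rewrite leq_exp2l//; apply: m_mono; exact: leq_addl.
pose lam i := (st i).1.2 i; pose M i := (st i).2 i.
have iqm i : (i < q ^ m i)%N.
  by apply: leq_trans (ltn_expl i q_gt1) _; rewrite leq_exp2l.
have lamE n i : (i < q ^ m n)%N -> (st n).1.2 i = lam i /\ (st n).2 i = M i.
  move=> im; have [ni|iN] := leqP n i; first by have [] := agree n i i ni im.
  by have [-> ->] := agree i n i (ltnW iN) (iqm i).
have lev n : level_spectrum (m n) lam.
  by have [+ _] := gst n; apply: level_spectrum_ext => i im; have [] := lamE n i im.
have oldnew n : [/\
     exists x h, [/\ 0 < h, b%:R ^+ m n <= 2 * h &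
        G h <= (window_count (q ^ m n.+1) predT lam x h)%:R],
      forall i, (i < q ^ m n)%N -> `|(lam i)%:~R| * n.+1%:R <= b%:R ^+ m n.+1 :> R &
      forall i, (q ^ m n <= i < q ^ m n.+1)%N -> e <= Phi ((lam i)%:~R / b%:R ^+ m n.+1)].
  have [_ _ [x [h [h0 hb hG]]] Hold Hnew] := est n; split.
  - exists x, h; split => //; apply: le_trans hG _.
    rewrite (@window_count_ext _ _ _ predT lam)// => i im.
    by split => //; have [] := lamE n.+1 i im.
  - by move=> i im; have [<- _] := lamE n i im; exact: Hold.
  - by move=> i im; have [<- _] := lamE n.+1 i (andP im).2; exact: Hnew.
have nb n : n%:R <= b%:R ^+ m n :> R.
  rewrite -natrX ler_nat; apply: ltnW; apply: leq_trans (ltn_expl n b_gt1) _.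
  by rewrite leq_exp2l.
exists lam, M; split.
- move=> i j ij; pose n := maxn i j.
  apply: (level_spectrum_orth (lev n)) => //.
    by apply: leq_trans (iqm i) _; rewrite leq_exp2l// m_mono// leq_maxl.
  by apply: leq_trans (iqm j) _; rewrite leq_exp2l// m_mono// leq_maxr.
- move=> x eta eta0; apply: contrapT => /forallNP Hs.
  pose S n := \sum_(i < q ^ m n) Phi (x + (lam i)%:~R).
  have Sle n : S n <= 1 - eta by rewrite leNgt; apply/negP; exact: Hs.
  have S0 n : 0 <= S n by exact: sumr_ge0.
  have eta1 : eta <= 1 by have := Sle 0%N; have := S0 0%N; lra.
  pose d := Num.min (eta / 2) (e / 2).
  have d_gt0 : 0 < d by rewrite lt_min !divr_gt0.
  pose n0 := Num.truncn (C * (`|x| + 1) / d).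
  have small n : (n0 <= n)%N -> C * (`|x| + 1) <= d * n.+1%:R.
    move=> nn; rewrite -ler_pdivrMl// mulrC.
    by apply: ltW; apply: lt_le_trans (truncnS_gt _) _; rewrite ler_nat ltnS.
  have Sstep n : (n0 <= n)%N -> S n + e / 2 * (eta / 2) <= S n.+1.
    move=> nn; have [_ Hold Hnew] := oldnew n.
    have bm1 : 0 < b%:R ^+ m n.+1 :> R by [].
    have xs : C * (`|x| / b%:R ^+ m n.+1) <= d.
      rewrite mulrA ler_pdivrMr//; apply: le_trans (_ : C * (`|x| + 1) <= _).
        by rewrite ler_wpM2l// lerDl.
      by apply: (le_trans (small n nn)); rewrite ler_pM2l.
    have HW i : W (m n.+1) (x + (lam i)%:~R) * Phi ((x + (lam i)%:~R) / b%:R ^+ m n.+1) =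
       Phi (x + (lam i)%:~R) by rewrite -Phi_level.
    have Pold i : (i < q ^ m n)%N -> 1 - eta / 2 <= Phi ((x + (lam i)%:~R) / b%:R ^+ m n.+1).
      move=> im; have := Phi_lip ((x + (lam i)%:~R) / b%:R ^+ m n.+1) 0.
      rewrite Phi0 subr0 ler_distl => /andP[+ _].
      rewrite normrM normfV (gtr0_norm bm1).
      suff : C * (`|x + (lam i)%:~R| / b%:R ^+ m n.+1) <= eta / 2 by lra.
      apply: (@le_trans _ _ (C * ((`|x| + 1) / n.+1%:R))).
        rewrite ler_wpM2l// ler_pdivrMr//.
        apply: (le_trans (ler_normD _ _)); rewrite mulrAC mulrDl mul1r mulrDl; apply: lerD.
          by rewrite ler_pdivlMr// ler_wpM2l.
        by rewrite ler_pdivlMr//; exact: Hold.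
      rewrite mulrA ler_pdivrMr//; apply: (le_trans (small n nn)).
      by rewrite ler_pM2r// ge_min lexx.
    have Pnew i : (q ^ m n <= i < q ^ m n.+1)%N -> e / 2 <= Phi ((x + (lam i)%:~R) / b%:R ^+ m n.+1).
      move=> im; have := Phi_lip ((x + (lam i)%:~R) / b%:R ^+ m n.+1) ((lam i)%:~R / b%:R ^+ m n.+1).
      rewrite mulrDl addrK normrM normfV (gtr0_norm bm1) ler_distl => /andP[+ _].
      have := Hnew i im; have : d <= e / 2 by rewrite ge_min lexx orbT.
      by move: xs; lra.
    have qq : (q ^ m n <= q ^ m n.+1)%N by rewrite leq_exp2l// ltnW.
    pose wf i := W (m n.+1) (x + (lam i)%:~R).
    pose pf i := Phi (x + (lam i)%:~R).
    have split_sum (F : nat -> R) : \sum_(i < q ^ m n.+1) F i =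
       \sum_(i < q ^ m n) F i + \sum_(q ^ m n <= i < q ^ m n.+1) F i.
      by rewrite -!(big_mkord xpredT F) (@big_cat_nat _ _ _ (q ^ m n)).
    have := lev n.+1 x; rewrite (split_sum wf) => W1.
    rewrite {2}/S (split_sum pf) lerD2l.
    (* The Parseval weights of the old and of the new points add up to 1. *)
    have old : (1 - eta / 2) * \sum_(i < q ^ m n) wf i <= 1 - eta.
      apply: le_trans (Sle n); rewrite mulr_sumr; apply: ler_sum => i _.
      by rewrite -HW mulrC ler_wpM2l ?level_factor_ge0// Pold.
    have new : e / 2 * \sum_(q ^ m n <= i < q ^ m n.+1) wf i <=
        \sum_(q ^ m n <= i < q ^ m n.+1) pf i.
      rewrite mulr_sumr !big_nat; apply: ler_sum => i im.
      by rewrite /pf -HW mulrC ler_wpM2l ?level_factor_ge0// Pnew.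
    apply: le_trans new; rewrite ler_pM2l ?divr_gt0//.
    have : \sum_(i < q ^ m n) wf i <= 1 - eta / 2.
      have h1 : 0 < 1 - eta / 2 by lra.
      rewrite -(ler_pM2l h1); apply: (le_trans old); nra.
    by move: W1; lra.
  have Sbig k : k%:R * (e / 2 * (eta / 2)) <= S (n0 + k)%N.
    elim: k => [|k IH]; first by rewrite mul0r.
    rewrite addnS; apply: le_trans (Sstep _ (leq_addr _ _)).
    by rewrite -natr1 mulrDl mul1r lerD2r.
  have g0 : 0 < e / 2 * (eta / 2) by rewrite mulr_gt0// divr_gt0.
  pose k := (Num.truncn (e / 2 * (eta / 2))^-1).+1.
  have : 1 < k%:R * (e / 2 * (eta / 2)).
    by rewrite -ltr_pdivrMr// div1r; exact: truncnS_gt.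
  by have := Sbig k; have := Sle (n0 + k)%N; lra.
- move=> i; have [_ [Hi Hp _]] := gst i.
  by split; [exact: Hi|exact: Hp].
- move=> n N x h h0.
  have nq : (n <= q ^ m n)%N by exact: ltnW.
  apply: (@le_trans _ _ (window_count (q ^ m n) (fun i => M i == N) lam x h)%:R).
    by rewrite ler_nat; exact: window_count_mono.
  have [_ [_ _ /(_ N x h h0)]] := gst n; rewrite -/(m n); apply: le_trans.
  rewrite (@window_count_ext _ _ lam (fun i => (st n).2 i == N) (st n).1.2)// => i im.
  by have [-> ->] := lamE n i im.
- move=> H; pose n := Num.truncn (2 * H).
  have [[x [h [h0 hb hG]]] _ _] := oldnew n.+1.
  exists (q ^ m n.+2)%N, x, h; split => //.
  have := truncnS_gt (2 * H); rewrite -/n => H2.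
  by have := le_trans (ltW H2) (le_trans (nb n.+1) hb); rewrite ler_pM2l.
Qed.

End Tower.

(** * Beurling density of clustered point sets *)

Section Density.
Context {R : realType}.
Implicit Types (Lambda : set R) (r c h : R).

Definition window Lambda (x h : R) : set R := Lambda `&` `](x - h), (x + h)[.

Lemma counting_le (A : set R) c :
  (forall B : {fset R}, [set` B] `<=` A -> #|` B|%:R <= c) ->
  (counting A <= c%:E :> \bar R)%E.
Proof.
move=> AB; rewrite /counting; case: asboolP => [fA|iA].
  by rewrite lee_fin; apply: AB; rewrite fset_setK.
have [B BA] := infinite_set_fset (Num.truncn c).+1 iA.
rewrite -(ler_nat R) => /(lt_le_trans (truncnS_gt c)).
by rewrite ltNge AB.
Qed.

Lemma counting_ge (A : set R) (s : seq R) : uniq s -> [set` s] `<=` A ->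
  ((size s)%:R%:E <= counting A :> \bar R)%E.
Proof.
move=> us sA; rewrite /counting; case: asboolP => [fA|_]; last by rewrite leey.
rewrite lee_fin ler_nat; apply: uniq_leq_size => // x xs.
by rewrite in_fset_set// inE; exact: sA.
Qed.

Lemma density_le Lambda r c H :
  (forall h x, H < h -> (counting (window Lambda x h) <= (c * h `^ r)%:E)%E) ->
  (beurling_density r Lambda <= c%:E)%E.
Proof.
move=> HB; rewrite /beurling_density limf_esupE.
apply: (@le_trans _ _ (ereal_sup ((fun h : R =>
    ereal_sup [set (counting (Lambda `&` `](x - h)%R, (x + h)%R[) / (h `^ r)%:E)%E
              | x in [set: R]]) @` [set h | Num.max H 0 < h]))).
  apply: ereal_inf_lbound; exists [set h | Num.max H 0 < h] => //.
  by exists (Num.max H 0); split; [exact: num_real|].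
apply: ge_ereal_sup => _ [h /= + <-]; rewrite gt_max => /andP[Hh h0].
apply: ge_ereal_sup => _ [x _ <-].
have hr0 : 0 < h `^ r by rewrite powR_gt0.
by rewrite inver gt_eqF// lee_pdivrMr// -EFinM; exact: HB.
Qed.

Lemma density_ge Lambda r c :
  (forall H, exists h x, H < h /\ ((c * h `^ r)%:E <= counting (window Lambda x h))%E) ->
  (c%:E <= beurling_density r Lambda)%E.
Proof.
move=> HB; rewrite /beurling_density limf_esupE.
apply: le_ereal_inf_tmp => _ [V [H0 [_ HV]] <-].
have [h [x [Hh Hc]]] := HB (Num.max H0 0).
move: Hh; rewrite gt_max => /andP[H0h h0].
have hr0 : 0 < h `^ r by rewrite powR_gt0.
apply: (@le_trans _ _ (counting (window Lambda x h) / (h `^ r)%:E)%E).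
  by rewrite inver gt_eqF// lee_pdivlMr// -EFinM.
apply: (@le_trans _ _ (ereal_sup [set (counting (Lambda `&` `](x - h)%R, (x + h)%R[) / (h `^ r)%:E)%E
              | x in [set: R]])).
  by apply: ereal_sup_ubound; exists x.
by apply: ereal_sup_ubound; exists h => //; exact: HV.
Qed.

Lemma density_ge0 Lambda r : (0 <= beurling_density r Lambda)%E.
Proof.
apply: density_ge => H; exists (H + 1), 0; by rewrite ltrDl ltr01 mul0r.
Qed.

Lemma beurling_dimP Lambda t : 0 <= t ->
  (forall r, t < r -> beurling_density r Lambda = 0%E) ->
  (forall r, 0 <= r -> r < t -> (beurling_density r Lambda != 0)%E) ->
  beurling_dim Lambda = t%:E.
Proof.
move=> t0 Hgt Hlt; apply/eqP; rewrite eq_le; apply/andP; split.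
  apply/lee_addgt0Pr => e e0; rewrite -EFinD.
  apply: ereal_inf_lbound; exists (t + e) => //; split; first by rewrite addr_ge0// ltW.
  by apply: Hgt; rewrite ltrDl.
apply: le_ereal_inf_tmp => _ [r [r0 Dr] <-]; rewrite lee_fin leNgt.
by apply/negP => /(Hlt r r0); rewrite Dr eqxx.
Qed.

Definition affine_points (lam : nat -> int) (g a : R) : set R :=
  [set (lam i)%:~R / g + a | i in [set: nat]].

Lemma affine_window (lam : nat -> int) (g a x h : R) (i : nat) : 0 < g ->
  (`](x - h), (x + h)[%classic ((lam i)%:~R / g + a)) =
  (`|(lam i)%:~R - g * (x - a)| < g * h).
Proof.
move=> g0; rewrite /= in_itv /= -ltr_distl.
rewrite -(ltr_pM2l g0) -{1}(gtr0_norm g0) -normrM.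
by congr (is_true (`|_| < _)); field; rewrite gt_eqF.
Qed.

Lemma counting_affine_le (lam : nat -> int) (g a x h c : R) : 0 < g ->
  (forall n, (window_count n predT lam (g * (x - a)) (g * h))%:R <= c) ->
  (counting (window (affine_points lam g a) x h) <= c%:E)%E.
Proof.
move=> g0 Hc; apply: counting_le => B BL.
have /choice[idx Hidx] : forall y : R, exists i : nat, y \in B ->
    y = (lam i)%:~R / g + a /\ `|(lam i)%:~R - g * (x - a)| < g * h.
  move=> y; have [yB|] := boolP (y \in B); last by exists 0%N.
  have [[i _ <-]] := BL y yB; rewrite affine_window// => iw.
  by exists i.
pose n := (\max_(y <- B) (idx y).+1)%N.
apply: le_trans (Hc n); rewrite ler_nat /window_count -size_filter.
rewrite -(size_map idx B).
apply: uniq_leq_size.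
  rewrite map_inj_in_uniq ?fset_uniq// => y y' yB y'B E.
  by have [-> _] := Hidx y yB; have [-> _] := Hidx y' y'B; rewrite E.
move=> _ /mapP[y yB ->]; rewrite mem_filter mem_iota add0n /=.
have [_ ->] := Hidx y yB; rewrite /= /n.
exact: (@leq_bigmax_seq _ _ xpredT (fun y => (idx y).+1)).
Qed.

Lemma counting_affine_ge (lam : nat -> int) (g a x h : R) n : 0 < g -> injective lam ->
  ((window_count n predT lam (g * (x - a)) (g * h))%:R%:E <=
   counting (window (affine_points lam g a) x h) :> \bar R)%E.
Proof.
move=> g0 lam_inj; rewrite /window_count -size_filter.
rewrite -(size_map (fun i => (lam i)%:~R / g + a : R)).
apply: counting_ge.
  rewrite map_inj_uniq ?filter_uniq ?iota_uniq// => i j /addIr/mulIf E.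
  by apply: lam_inj; apply: (@intr_inj R); apply: E; rewrite invr_eq0 gt_eqF.
move=> _ /= /mapP[i + ->]; rewrite mem_filter /= => /andP[iw _]; split; first by exists i.
by rewrite affine_window.
Qed.

(** If all points of a window have one scale, the bound for a single scale
    applies. Otherwise let [j] have the largest scale in the window: the point
    [j] and a point of smaller scale are at a distance comparable to [b ^ M
    j], so [b ^ M j <= 8 h]; since [i < M i <= M j] for every [i] in the
    window, it contains at most [M j] points. *)
Lemma scattered_window_bound (b : nat) (lam : nat -> int) (M : nat -> nat) (J : int)
    (G : R -> R) (n : nat) (x h : R) :
  (1 < b)%N -> J != 0 -> (forall h, 0 <= G h) ->
  (forall i, (i < M i)%N /\ 8 * `|(lam i)%:~R - b%:R ^+ M i * J%:~R| <= b%:R ^+ M i :> R) ->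
  (forall n N x h, 0 < h ->
        (window_count n (fun i => M i == N) lam x h)%:R <= G h + 1) ->
  1 <= h ->
  (window_count n predT lam x h)%:R <= G h + 1 + ln (8 * h) / ln b%:R.
Proof.
move=> b1 J0 G0 HM Hc h1.
have h0 : 0 < h by lra.
have bR1 : 1 < b%:R :> R by rewrite ltr1n.
have lnb : 0 < ln b%:R :> R by exact: ln_gt0.
have ln8 : 0 <= ln (8 * h) by apply: ln_ge0; lra.
pose P i := `|(lam i)%:~R - x| < h.
have [[i0 [j0 [i0n j0n Pi0 Pj0 ij]]]|same] := pselect (exists i j,
    [/\ (i < n)%N, (j < n)%N, P i, P j & M i != M j]); last first.
  have [/hasP[i0]|no] := boolP (has P (iota 0 n)).
    rewrite mem_iota add0n => /= i0n Pi0.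
    apply: (@le_trans _ _ (G h + 1)); last by rewrite lerDl divr_ge0// ltW.
    apply: le_trans (Hc n (M i0) x h h0).
    rewrite ler_nat; apply: eq_leq; rewrite /window_count; apply: eq_in_count => i.
    rewrite mem_iota add0n /= => iN; rewrite -/(P i).
    case: (boolP (P i)) => Pi; rewrite ?andbF// andbT; apply/esym.
    apply: contrapT => /negP Mi; apply: same; exists i, i0; split => //.
  have -> : window_count n predT lam x h = 0%N.
    by apply/eqP; rewrite -leqn0 leqNgt -has_count.
  by rewrite -[X in X <= _]addr0 lerD// ?divr_ge0 ?(ltW lnb)// addr_ge0.
case: (@arg_maxnP _ (Ordinal i0n) (fun i : 'I_n => P i) (fun i : 'I_n => M i) Pi0) => j Pj jmax'.
have {jmax'}jmax k (kn : (k < n)%N) : P k -> (M k <= M j)%N := jmax' (Ordinal kn).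
have [i [iN Pi Mij]] : exists i, [/\ (i < n)%N, P i & (M i < M j)%N].
  have [Mi|Mi] := ltnP (M i0) (M j); first by exists i0.
  exists j0; split => //; rewrite ltn_neqAle (jmax j0 j0n Pj0) andbT.
  have -> : M j = M i0 by apply/eqP; rewrite eqn_leq Mi (jmax i0 i0n Pi0).
  by rewrite eq_sym.
have bM : b%:R ^+ M j <= 8 * h.
  have [_ Hi] := HM i; have [_ Hj] := HM j.
  have bij : 2 * b%:R ^+ M i <= b%:R ^+ M j :> R.
    apply: (@le_trans _ _ (b%:R ^+ (M i).+1)).
      by rewrite exprS ler_wpM2r ?exprn_ge0// ler_nat.
    by rewrite ler_eXn2l.
  have bi0 : 0 < b%:R ^+ M i :> R by rewrite exprn_gt0// (lt_trans ltr01).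
  have J1 : 1 <= `|J%:~R| :> R.
    by rewrite -intr_norm -[X in X <= _]/((1 : int)%:~R) ler_int -gtz0_ge1 normr_gt0.
  have dJ : (b%:R ^+ M j - b%:R ^+ M i) <= `|b%:R ^+ M j * J%:~R - b%:R ^+ M i * J%:~R| :> R.
    have uv : 0 <= b%:R ^+ M j - b%:R ^+ M i :> R by lra.
    by rewrite -mulrBl normrM (ger0_norm uv) ler_peMr.
  move: Pi Pj Hi Hj dJ; rewrite /P.
  set u := b%:R ^+ M j in bij *; set v := b%:R ^+ M i in bij bi0 *; set Ju := u * _; set Jv := v * _.
  move=> Pi Pj Hi Hj dJ.
  have : `|Ju - Jv| <= `|(lam j)%:~R - Ju| + `|(lam i)%:~R - Jv| + `|(lam j)%:~R - x| + `|(lam i)%:~R - x|.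
    rewrite (_ : Ju - Jv = - ((lam j)%:~R - Ju) + ((lam i)%:~R - Jv) + ((lam j)%:~R - x) - ((lam i)%:~R - x)); last by ring.
    apply: le_trans (ler_normB _ _) _; rewrite lerD2r.
    apply: le_trans (ler_normD _ _) _; rewrite lerD2r.
    by apply: le_trans (ler_normD _ _) _; rewrite lerD2r normrN.
  lra.
have cM : (window_count n predT lam x h <= M j)%N.
  rewrite /window_count -size_filter -[leqRHS](size_iota 0).
  apply: uniq_leq_size; first by rewrite filter_uniq ?iota_uniq.
  move=> k; rewrite mem_filter !mem_iota !add0n /= => /andP[Pk kn].
  have [kM _] := HM k; apply: (leq_trans kM); exact: jmax.
apply: (@le_trans _ _ (M j)%:R); first by rewrite ler_nat.
apply: (@le_trans _ _ (ln (8 * h) / ln b%:R)).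
  have b0 : 0 < b%:R :> R by lra.
  rewrite ler_pdivlMr//.
  have <- : ln (b%:R ^+ M j) = (M j)%:R * ln b%:R :> R by rewrite lnXn// mulr_natl.
  by rewrite ler_ln ?posrE ?exprn_gt0// mulr_gt0.
by rewrite lerDr addr_ge0.
Qed.

Lemma powRDpos (x r s : R) : 0 < x -> x `^ (r + s) = x `^ r * x `^ s.
Proof. by move=> x0; rewrite powRD// (gt_eqF x0) implybT. Qed.

Lemma ln_le_powR (e c : R) : 0 < e -> 0 < c ->
  exists H, 1 <= H /\ forall h, H <= h -> 1 + ln (1 + h) <= c * h `^ e.
Proof.
move=> e0 c0; pose d := e / 2; have d0 : 0 < d by rewrite divr_gt0.
pose B := 1 + d^-1 * 2 `^ d.
have B0 : 0 < B by rewrite addr_gt0// mulr_gt0 ?invr_gt0// powR_gt0.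
exists (Num.max 1 ((B / c) `^ d^-1)); split; first by rewrite le_max lexx.
move=> h; rewrite ge_max => /andP[h1 Hh].
have h0 : 0 < h by lra.
have hd0 : 0 < h `^ d by rewrite powR_gt0.
have hd1 : 1 <= h `^ d.
  by rewrite -[X in X <= _](powRr0 h) ler_powR// ltW.
have Bh : B <= c * h `^ d.
  rewrite -ler_pdivrMl// mulrC.
  have := @ge0_ler_powR R d (ltW d0) _ _ _ _ Hh; rewrite -powRrM mulVf ?gt_eqF// powRr1; last first.
    by rewrite divr_ge0// ltW.
  by apply; rewrite nnegrE ?powR_ge0// ltW.
have -> : h `^ e = h `^ d * h `^ d.
  by rewrite -powRDpos// /d -splitr.
rewrite mulrA; apply: le_trans (_ : B * h `^ d <= _); last by rewrite ler_wpM2r// ltW.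
rewrite /B mulrDl mul1r lerD//.
have -> : ln (1 + h) = d^-1 * ln ((1 + h) `^ d) by rewrite ln_powR mulKf// gt_eqF.
rewrite -mulrA ler_pM2l ?invr_gt0//.
apply: le_trans (ltW (ln_sublinear _)) _; first by rewrite powR_gt0//; lra.
rewrite -powRM ?ler0n ?(ltW h0)//.
by apply: ge0_ler_powR; rewrite ?nnegrE; lra.
Qed.

Lemma powR_unbounded (e c : R) : 0 < e -> exists H, 1 <= H /\ forall h, H <= h -> c <= h `^ e.
Proof.
move=> e0; have c1 : 0 < Num.max c 1 by rewrite lt_max ltr01 orbT.
have c1' : 0 < (Num.max c 1)^-1 by rewrite invr_gt0.
have [H [H1 HH]] := ln_le_powR e0 c1'.
exists H; split => // h Hh; apply: (@le_trans _ _ (Num.max c 1)).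
  by rewrite le_max lexx.
have := HH _ Hh; rewrite -ler_pdivrMl// invrK; apply: le_trans.
by rewrite ler_peMr ?(ltW c1)// lerDl ln_ge0//; have := le_trans H1 Hh; lra.
Qed.

(** A weight that tends to [s] while being too slow to affect exponents: a
    function growing like [h ^ t * kappa h] has exponent [t], and density [s]
    at this exponent. *)
Definition gauge (kappa : R -> R) (s : \bar R) : Prop :=
  [/\ forall h, 0 <= kappa h,
      exists A, 0 <= A /\ forall h, 0 <= h -> kappa h <= A * (1 + ln (1 + h)),
      forall e c, 0 < e -> exists H, forall h, H <= h -> c <= kappa h * h `^ e,
      forall c, (c%:E < s)%E -> exists H, forall h, H <= h -> c <= kappa h &
      forall c, (s < c%:E)%E -> exists H, forall h, H <= h -> kappa h <= c].

(** The constant [s] works for positive finite [s]; the logarithm and its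
    inverse work for the two extreme values. *)
Lemma gauge_exists (s : \bar R) : (0 <= s)%E -> exists kappa, gauge kappa s.
Proof.
have ln1_ge0 (h : R) : 0 <= ln (1 + `|h|) by apply: ln_ge0; rewrite lerDl.
have ln1_big (c h : R) : expR c <= h -> c <= ln (1 + `|h|).
  move=> ch; rewrite -[X in X <= _](@expRK R) ler_ln ?posrE ?expR_gt0//.
    by apply: (le_trans ch); apply: (le_trans (ler_norm h)); rewrite lerDr.
case: s => [s| |] //; last first.
  move=> _; exists (fun h => 1 + ln (1 + `|h|)); split => //.
  - by move=> h; rewrite addr_ge0.
  - by exists 1; split => // h h0; rewrite ger0_norm// mul1r.
  - move=> e c e0; have [H [H1 HH]] := powR_unbounded c e0; exists H => h /HH ch.
    by apply: (le_trans ch); rewrite ler_peMl ?powR_ge0// lerDl.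
  - move=> c _; exists (expR c) => h /ln1_big ch; apply: (le_trans ch); by rewrite lerDr.
rewrite lee_fin le_eqVlt => /predU1P[<-|s0]; last first.
  exists (fun=> s); split => //.
  - by move=> _; exact: ltW.
  - exists s; split; first exact: ltW.
    by move=> h h0; rewrite ler_peMr ?(ltW s0)// lerDl ln_ge0// lerDl.
  - move=> e c e0; have [H [H1 HH]] := powR_unbounded (c / s) e0; exists H => h /HH.
    by rewrite ler_pdivrMr// mulrC.
  - by move=> c; rewrite lte_fin => /ltW; exists 0.
  - by move=> c; rewrite lte_fin => /ltW; exists 0.
have k0 (h : R) : 0 < 1 + ln (1 + `|h|) by rewrite ltr_wpDr.
exists (fun h => (1 + ln (1 + `|h|))^-1); split.
- by move=> h; rewrite invr_ge0 ltW.
- exists 1; split => // h h0; rewrite mul1r -{2}(ger0_norm h0).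
  by apply: (@le_trans _ _ 1); [rewrite invf_le1// lerDl|rewrite lerDl].
- move=> e c e0; have c1 : 0 < Num.max c 1 by rewrite lt_max ltr01 orbT.
  have c1' : 0 < (Num.max c 1)^-1 by rewrite invr_gt0.
  have [H [H1 HH]] := ln_le_powR e0 c1'; exists H => h Hh.
  have h0 : 0 <= h by lra.
  rewrite mulrC ler_pdivlMr//; apply: (@le_trans _ _ (Num.max c 1 * (1 + ln (1 + `|h|)))).
    by rewrite ler_wpM2r ?(ltW (k0 h))// le_max lexx.
  by rewrite -ler_pdivlMl// ger0_norm// HH.
- by move=> c; rewrite lte_fin => c0; exists 0 => h _; apply: ltW; apply: (lt_trans c0); rewrite invr_gt0.
- move=> c; rewrite lte_fin => c0; exists (expR c^-1) => h /ln1_big ch.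
  by rewrite -[leRHS]invrK lef_pV2 ?posrE ?invr_gt0// (le_trans ch)// lerDr.
Qed.

(** The largest number of points admitted in an interval of radius [u] before
    the integers are divided by [g]. *)
Definition gauge_count (g t : R) (kappa : R -> R) (u : R) : R := (u / g) `^ t * kappa (u / g).

Lemma gauge_count_ge0 g t kappa u : (forall h, 0 <= kappa h) -> 0 <= gauge_count g t kappa u.
Proof. by move=> k0; rewrite mulr_ge0// powR_ge0. Qed.

Lemma expr_unbounded (rho c : R) : 1 < rho ->
  exists p0, forall p, (p0 <= p)%N -> c < rho ^+ p.
Proof.
move=> rho1; have d0 : 0 < rho - 1 by rewrite subr_gt0.
have bern p : 1 + p%:R * (rho - 1) <= rho ^+ p.
  elim: p => [|p IH]; first by rewrite mul0r addr0 expr0.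
  rewrite exprS; apply: le_trans (_ : rho * (1 + p%:R * (rho - 1)) <= _).
    rewrite -natr1; have : 0 <= p%:R * (rho - 1) by rewrite mulr_ge0// ltW.
    move: (p%:R : R) => P X0; have : 0 <= (rho - 1) * (P * (rho - 1)) by rewrite mulr_ge0// ltW.
    lra.
  by rewrite ler_wpM2l// (le_trans ler01)// ltW.
exists (Num.truncn (c / (rho - 1))).+1 => p Hp.
apply: lt_le_trans (bern p); apply: ltr_wpDl => //.
rewrite -ltr_pdivrMr//; apply: lt_le_trans (truncnS_gt _) _.
by rewrite ler_nat.
Qed.

(** As [t] is less than the logarithm of [q] in base [b], there is room
    between the two for an exponent [r] that also absorbs the logarithmic
    growth of [kappa]. *)
Lemma gauge_count_grow (q b : nat) (g t : R) kappa s : gauge kappa s ->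
  (1 < q)%N -> (1 < b)%N -> 0 < g -> 0 < t -> t < ln q%:R / ln b%:R ->
  forall B, 0 <= B -> exists p0, forall p, (p0 <= p)%N ->
     gauge_count g t kappa (B * b%:R ^+ p + 1) + 1 < (q ^ p).-1%:R.
Proof.
move=> [k0 [A [A0 kA]] _ _ _] q1 b1 g0 t0 tq B B0.
have bR1 : 1 < b%:R :> R by rewrite ltr1n.
have bR0 : 0 < b%:R :> R by lra.
have lnb : 0 < ln b%:R :> R by exact: ln_gt0.
pose r := (t + ln q%:R / ln b%:R) / 2.
have tr : t < r by rewrite /r; lra.
have rq : r < ln q%:R / ln b%:R by rewrite /r; lra.
pose D := (B + 1) / g; have D0 : 0 < D by rewrite divr_gt0//; lra.
have c0 : 0 < (A + 1)^-1 by rewrite invr_gt0; lra.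
have rt0 : 0 < r - t by rewrite subr_gt0.
have [H [H1 HH]] := ln_le_powR rt0 c0.
pose rho := q%:R / b%:R `^ r : R.
have br0 : 0 < b%:R `^ r by rewrite powR_gt0.
have rho1 : 1 < rho.
  rewrite /rho ltr_pdivlMr// mul1r -ltr_ln ?posrE ?ltr0n//; last exact: ltnW.
  by rewrite ln_powR -ltr_pdivlMr.
have [p1 Hp1] := expr_unbounded (H / D) bR1.
have [p2 Hp2] := expr_unbounded (D `^ r + 2) rho1.
exists (maxn p1 p2) => p; rewrite geq_max => /andP[/Hp1 pH /Hp2 pq].
have bp1 : 1 <= b%:R ^+ p :> R by rewrite exprn_ege1// ltW.
set u := B * b%:R ^+ p + 1.
have u0 : 0 < u by rewrite /u ltr_wpDl// mulr_ge0// (le_trans ler01).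
have ug : u / g <= D * b%:R ^+ p.
  rewrite /D mulrAC ler_pM2r ?invr_gt0// mulrDl mul1r /u.
  by rewrite lerD2l.
have ug0 : 0 <= u / g by rewrite divr_ge0// ltW.
set v := D * b%:R ^+ p in ug.
have v0 : 0 < v by rewrite mulr_gt0// exprn_gt0.
have vH : H <= v by rewrite /v mulrC -ler_pdivrMr// ltW.
have Guv : gauge_count g t kappa u <= v `^ r.
  rewrite /gauge_count; apply: (@le_trans _ _ (v `^ t * ((A + 1) * (1 + ln (1 + v))))).
    apply: ler_pM; rewrite ?powR_ge0//.
      by apply: ge0_ler_powR; rewrite ?nnegrE// ltW.
    apply: (le_trans (kA _ ug0)); apply: ler_pM => //.
    - by rewrite addr_ge0// ln_ge0// lerDl.
    - by rewrite lerDl.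
    - have u1 : 0 < 1 + u / g by rewrite ltr_pwDl.
      have v1 : 0 < 1 + v by rewrite ltr_pwDl// ltW.
      by rewrite lerD2l ler_ln ?posrE// lerD2l.
  have -> : v `^ r = v `^ t * v `^ (r - t).
    by rewrite -powRDpos// addrC subrK.
  rewrite ler_pM2l ?powR_gt0// -ler_pdivlMl; last lra.
  exact: HH.
have q0 : (0 < q ^ p)%N by rewrite expn_gt0 ltnW.
rewrite -(ltrD2r 1) [X in _ < X]natr1 prednK// natrX.
have vr : v `^ r = D `^ r * (b%:R `^ r) ^+ p.
  rewrite /v powRM ?(ltW D0) ?exprn_ge0 ?(ltW bR0)//; congr (_ * _).
  by rewrite -powR_mulrn ?(ltW bR0)// powRAC powR_mulrn ?powR_ge0.
have brp1 : 1 <= (b%:R `^ r) ^+ p.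
  by rewrite exprn_ege1// -[X in X <= _](powRr0 b%:R) ler_powR// ltW// (lt_trans t0).
have qE : q%:R = rho * b%:R `^ r by rewrite /rho divfK// gt_eqF.
rewrite qE exprMn.
apply: (@le_lt_trans _ _ ((D `^ r + 2) * (b%:R `^ r) ^+ p)).
  rewrite mulrDl -vr; lra.
by rewrite ltr_pM2r// (lt_le_trans ltr01).
Qed.

(** The windows of the clusters hold at most [h ^ t * kappa h + 1] points and
    sometimes hold [h ^ t * kappa h]. Mixing different clusters adds only a
    logarithm, which is negligible against [h ^ t], so the counting function
    has the density that [kappa] prescribes. Translations do not matter
    because the density takes a supremum over all centres. *)
Lemma affine_points_beurling (b : nat) (lam : nat -> int) (M : nat -> nat) (J : int)
    (g t : R) (kappa : R -> R) (s : \bar R) :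
  let G := gauge_count g t kappa in
  (1 < b)%N -> J != 0 -> 0 < g -> 0 < t -> (0 <= s)%E -> gauge kappa s -> injective lam ->
  (forall i, (i < M i)%N /\ 8 * `|(lam i)%:~R - b%:R ^+ M i * J%:~R| <= b%:R ^+ M i :> R) ->
  (forall n N x h, 0 < h ->
        (window_count n (fun i => M i == N) lam x h)%:R <= G h + 1) ->
  (forall H, exists n x h, [/\ H <= h, 0 < h &
        G h <= (window_count n predT lam x h)%:R]) ->
  forall a, beurling_dim (affine_points lam g a) = t%:E /\
            beurling_density t (affine_points lam g a) = s.
Proof.
move=> G b1 J0 g0 t0 s0 Hgauge lam_inj HM Hsmall Hbig a.
have [k0 [A [A0 kA]] kpow klow kup] := Hgauge.
have gN0 : g != 0 by rewrite gt_eqF.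
have bR1 : 1 < b%:R :> R by rewrite ltr1n.
have lnb : 0 < ln b%:R :> R by exact: ln_gt0.
set L := affine_points lam g a.
have GgE h : G (g * h) = h `^ t * kappa h by rewrite /G /gauge_count mulrAC divff// mul1r.
have upper h x : Num.max 1 g^-1 <= h ->
    (counting (window L x h) <= (h `^ t * kappa h + (1 + ln (8 * (g * h)) / ln b%:R))%:E)%E.
  rewrite ge_max => /andP[h1 gh]; apply: counting_affine_le => // n.
  rewrite -GgE addrA; apply: (scattered_window_bound _ _ b1 J0) => //.
    by move=> u; exact: gauge_count_ge0.
  by rewrite mulrC -ler_pdivrMr// div1r.
have lower H : exists h x, H < h /\ ((h `^ t * kappa h)%:E <= counting (window L x h))%E.
  have [n [x [u [Hu u0 Gu]]]] := Hbig (g * (H + 1)).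
  exists (u / g), (x / g + a); split.
    rewrite ltr_pdivlMr// mulrC; apply: lt_le_trans Hu.
    by rewrite ltr_pM2l// ltrDl.
  have := counting_affine_ge a (x / g + a) (u / g) n g0 lam_inj; apply: le_trans.
  have -> : g * (x / g + a - a) = x by rewrite addrK mulrC divfK.
  have -> : g * (u / g) = u by rewrite mulrC divfK.
  by rewrite lee_fin.
pose A' := 1 + (`|ln (8 * g)| + 1) / ln b%:R.
have A'0 : 0 < A' by rewrite ltr_pwDl// divr_ge0 ?(ltW lnb)// addr_ge0.
have log_part h : 1 <= h -> 1 + ln (8 * (g * h)) / ln b%:R <= A' * (1 + ln (1 + h)).
  move=> h1; have h0 : 0 < h by lra.
  have l0 : 0 <= ln (1 + h) by apply: ln_ge0; lra.
  rewrite mulrA lnM ?posrE ?mulr_gt0//.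
  have lh : ln h <= ln (1 + h) by rewrite ler_ln ?posrE; lra.
  rewrite /A' [X in _ <= X]mulrDl mul1r; apply: lerD; first by rewrite lerDl.
  rewrite mulrAC ler_pM2r ?invr_gt0//.
  have := ler_norm (ln (8 * g)); have := normr_ge0 (ln (8 * g)).
  by move: (`|_|) => X X0 lX; nra.
have Dgt r : t < r -> beurling_density r L = 0%E.
  move=> tr; apply/eqP; rewrite eq_le density_ge0 andbT.
  apply/lee_addgt0Pr => c c0; rewrite add0e.
  have AA : 0 < A + A' by rewrite ltr_wpDl.
  have rt0 : 0 < r - t by rewrite subr_gt0.
  have [H [H1 HH]] := ln_le_powR rt0 (divr_gt0 c0 AA).
  apply: (@density_le _ _ _ (Num.max H (Num.max 1 g^-1))) => h x.
  rewrite gt_max => /andP[/ltW Hh /ltW h1]; apply: le_trans (upper h x h1) _.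
  have {}h1 : 1 <= h by move: h1; rewrite ge_max => /andP[].
  have h0 : 0 < h by lra.
  have ht1 : 1 <= h `^ t by rewrite -(powRr0 h) ler_powR// ltW.
  have l0 : 0 <= 1 + ln (1 + h) by rewrite addr_ge0// ln_ge0//; lra.
  rewrite lee_fin; apply: (@le_trans _ _ (h `^ t * ((A + A') * (1 + ln (1 + h))))).
    rewrite (mulrDl A) mulrDr lerD//.
      by rewrite ler_pM2l ?powR_gt0//; apply: kA; lra.
    by apply: (le_trans (log_part h h1)); rewrite ler_peMl// mulr_ge0// ltW.
  have -> : h `^ r = h `^ t * h `^ (r - t) by rewrite -powRDpos// addrC subrK.
  rewrite [X in _ <= X]mulrCA ler_pM2l ?powR_gt0// -ler_pdivlMl// mulrA [_^-1 * c]mulrC.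
  exact: HH.
have Dlow r c : (exists H, forall h, H <= h -> c * h `^ r <= h `^ t * kappa h) ->
    (c%:E <= beurling_density r L)%E.
  move=> [H0 HH0]; apply: density_ge => H.
  have [h [x [Hh cnt]]] := lower (Num.max H H0).
  move: Hh; rewrite gt_max => /andP[Hh H0h].
  exists h, x; split=> //; apply: le_trans cnt; rewrite lee_fin; apply: HH0; exact: ltW.
split.
  apply: beurling_dimP => //; first exact: ltW.
  move=> r r0 rt; suff : (1%:E <= beurling_density r L)%E.
    by move=> H; rewrite gt_eqF// (lt_le_trans _ H)// lte_fin.
  have tr0 : 0 < t - r by rewrite subr_gt0.
  apply: Dlow; have [H HH] := kpow (t - r) 1 tr0.
  exists (Num.max H 1) => h; rewrite ge_max => /andP[/HH Hh h1].
  have h0 : 0 < h by lra.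
  have -> : h `^ t = h `^ r * h `^ (t - r) by rewrite -powRDpos// addrC subrK.
  rewrite -mulrA mulrC ler_pM2l ?powR_gt0// mulrC; exact: Hh.
have Dt_ge c : (c%:E < s)%E -> (c%:E <= beurling_density t L)%E.
  move=> /klow[H HH]; apply: Dlow; exists H => h /HH ch.
  by rewrite mulrC ler_wpM2l// powR_ge0.
have Dt_le c : (s < c%:E)%E -> (beurling_density t L <= c%:E)%E.
  move=> sc; have [s' s'E] : exists s', s = s'%:E.
    by case: (s) s0 sc => [s'| |]// _ _; exists s'.
  rewrite s'E lte_fin in sc.
  pose c' := (s' + c) / 2; have c'c : 0 < c - c' by rewrite /c'; lra.
  have [H0 HH0] : exists H, forall h, H <= h -> kappa h <= c'.
    by apply: kup; rewrite s'E lte_fin /c'; lra.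
  have [H [H1 HH]] := ln_le_powR t0 (divr_gt0 c'c A'0).
  apply: (@density_le _ _ _ (Num.max H (Num.max H0 (Num.max 1 g^-1)))) => h x.
  rewrite gt_max => /andP[/ltW Hh]; rewrite gt_max => /andP[/ltW H0h /ltW h1].
  apply: le_trans (upper h x h1) _.
  have {}h1 : 1 <= h by move: h1; rewrite ge_max => /andP[].
  rewrite lee_fin (_ : c * h `^ t = h `^ t * c' + (c - c') * h `^ t); last by ring.
  rewrite lerD//; first by rewrite ler_wpM2l ?powR_ge0// HH0.
  by apply: (le_trans (log_part h h1)); rewrite -ler_pdivlMl// mulrA [_^-1 * _]mulrC; exact: HH.
clear Hgauge klow kup.
apply/eqP; rewrite eq_le; apply/andP; split.
  case: s s0 Dt_le {Dt_ge} => [s'| |]// s0 Dt_le; last by rewrite leey.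
  apply/lee_addgt0Pr => e e0; rewrite -EFinD.
  by apply: Dt_le; rewrite lte_fin ltrDl.
case: s s0 Dt_ge {Dt_le} => [s'| |]// s0 Dt_ge.
  apply/lee_subgt0Pr => e e0; rewrite -EFinB.
  by apply: Dt_ge; rewrite lte_fin gtrBl.
rewrite leye_eq; apply/eqP/eqyP => c _.
by apply: Dt_ge; rewrite ltry.
Qed.

End Density.

(** * The mask of a digit set *)

Section Trigonometry.
Context {R : realType}.
Implicit Types (x y theta : R) (z d : int) (D : seq int).

Lemma cosD_int x z : cos (x + 2 * pi * z%:~R) = cos x.
Proof.
have H (n : nat) (y : R) : cos (y + 2 * pi * n%:~R) = cos y.
  by rewrite -(periodicn (@cosD2pi R) n y) -pmulrn -mulrA [pi * _]mulrC mulrCA !mulr_natl -mulrnA mulnC mulrnA.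
case: z => n; first exact: H.
by rewrite NegzE intrN mulrN -[in RHS](subrK (2 * pi * n.+1%:~R) x) H.
Qed.

Lemma sinD_int x z : sin (x + 2 * pi * z%:~R) = sin x.
Proof.
rewrite -!cosBpihalf addrAC; exact: cosD_int.
Qed.

Lemma cos_eq1_int x : cos (2 * pi * x) = 1 -> exists z : int, x = z%:~R.
Proof.
move=> cx; pose r := x - (Num.floor x)%:~R.
have r01 : 0 <= r < 1 by rewrite /r; have := floor_itv x; rewrite intrD; lra.
have : cos (2 * pi * r) = 1.
  by rewrite -[RHS]cx /r mulrBr -mulrN -intrN cosD_int.
have -> : 2 * pi * r = (pi * r) *+ 2 :> R by rewrite mulr2n; lra.
rewrite cos_mulr2n cos2sin2 mulr2n => s0.
have {}s0 : sin (pi * r) = 0 by apply/eqP; rewrite -sqrf_eq0; apply/eqP; lra.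
exists (Num.floor x); apply/eqP; rewrite -subr_eq0 -/r; apply: contraT => r0.
have : 0 < sin (pi * r).
  have r_gt0 : 0 < r by rewrite lt_neqAle eq_sym r0; case/andP: r01.
  have r_lt1 : r < 1 by case/andP: r01.
  by apply: sin_gt0_pi; rewrite mulr_gt0 ?pi_gt0//= gtr_pMr ?pi_gt0.
by rewrite s0 ltxx.
Qed.

Lemma cisD x y : cis (x + y) = cis x * cis y.
Proof. by rewrite /cis cosD sinD; simpc; rewrite [sin x * cos y + _]addrC. Qed.

Lemma cis0 : cis (0 : R) = 1.
Proof. by rewrite /cis cos0 sin0. Qed.

Lemma conjc_cis x : ((cis x)^*)%C = cis (- x).
Proof. by rewrite /cis /= cosN sinN. Qed.

(** Real part of the mask [(1 / #D) * sum_d exp (2 i pi d y)]; its imaginary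
    part and squared modulus follow. *)
Definition mask_cos D y : R := (size D)%:R^-1 * \sum_(d <- D) cos (2 * pi * d%:~R * y).
Definition mask_sin D y : R := (size D)%:R^-1 * \sum_(d <- D) sin (2 * pi * d%:~R * y).
Definition mask_sq D y : R := mask_cos D y ^+ 2 + mask_sin D y ^+ 2.

Lemma mask_sqE D y : mask_sq D y = (size D)%:R^-1 ^+ 2 *
  \sum_(d <- D) \sum_(d' <- D) cos (2 * pi * (d - d')%:~R * y).
Proof.
rewrite /mask_sq /mask_cos /mask_sin !exprMn -mulrDr; congr (_ * _).
rewrite !expr2 !big_distrlr /= -big_split /=; apply: eq_bigr => d _.
rewrite -big_split /=; apply: eq_bigr => d' _.
by rewrite -cosB; congr cos; rewrite intrB; ring.
Qed.

Lemma mask_sq_ge0 D y : 0 <= mask_sq D y.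
Proof. by rewrite addr_ge0// sqr_ge0. Qed.

Lemma mask_sq0 D : (0 < size D)%N -> mask_sq D 0 = 1.
Proof.
move=> D0; rewrite mask_sqE; under eq_bigr do under eq_bigr do rewrite mulr0 cos0.
rewrite !big_const_seq !count_predT !iter_addr_0 -[X in _ * X]mulr_natr -expr2.
by rewrite -exprMn mulVf ?expr1n// pnatr_eq0 -lt0n.
Qed.

Lemma mask_sq_periodic D y (g : nat) z : (0 < g)%N -> (forall d, d \in D -> (g%:Z %| d)%Z) ->
  mask_sq D (y + z%:~R / g%:R) = mask_sq D y.
Proof.
move=> g0 gD; have gN0 : g%:R != 0 :> R by rewrite pnatr_eq0 -lt0n.
have E d : d \in D -> exists k : int, 2 * pi * d%:~R * (y + z%:~R / g%:R) =
   2 * pi * d%:~R * y + 2 * pi * k%:~R :> R.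
  move=> /gD/dvdzP[c ->]; exists (c * z); rewrite mulrDr; congr (_ + _).
  by rewrite !intrM -pmulrn; field.
congr (_ ^+ 2 + _ ^+ 2); rewrite /mask_cos /mask_sin; congr (_ * _);
  apply: eq_big_seq => d /E[k ->]; [exact: cosD_int|exact: sinD_int].
Qed.

(** In the double sum of cosines of [mask_sqE], a total equal to its maximum
    forces every cosine to be 1; take the differences with the digit 0. *)
Lemma mask_sq_eq1 D y : 0 \in D -> mask_sq D y = 1 ->
  forall d, d \in D -> exists z : int, d%:~R * y = z%:~R.
Proof.
move=> D0 w1 d dD; apply: cos_eq1_int.
have nN0 : (size D)%:R != 0 :> R by rewrite pnatr_eq0 size_eq0; case: (D) D0.
have : \sum_(d <- D) \sum_(d' <- D) (1 - cos (2 * pi * (d - d')%:~R * y)) = 0.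
  under eq_bigr do rewrite sumrB; rewrite sumrB.
  move: w1; rewrite mask_sqE => w1.
  rewrite !big_const_seq !count_predT !iter_addr_0 -[X in X - _ = _]mulr_natr -expr2.
  have := congr1 (fun t => (size D)%:R ^+ 2 * t) w1.
  by rewrite mulrA -exprMn divff// expr1n mul1r mulr1 => ->; rewrite subrr.
have pos d1 d2 : 0 <= 1 - cos (2 * pi * (d1 - d2)%:~R * y) :> R.
  by rewrite subr_ge0 cos_le1.
move=> /eqP; rewrite psumr_eq0; last by move=> d1 _; apply: sumr_ge0.
move=> /allP/(_ d dD)/=; rewrite psumr_eq0//= => /allP/(_ 0 D0)/=.
by rewrite subr0 subr_eq0 mulrA => /eqP <-.
Qed.

(** Up to a factor of modulus one, the mask is a nonzero polynomial in [exp (2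
    i pi y)]. *)
Lemma mask_sq_zeros D : uniq D -> 0 \in D ->
  finite_set [set y | 0 <= y <= 1 /\ mask_sq D y = 0].
Proof.
(* [N] is a shift that makes all exponents nonnegative. *)
move=> uD D0; pose N := (\sum_(d <- D) `|d|)%N.
have dN d : d \in D -> 0 <= d + N%:Z.
  move=> dD; have : (`|d| <= N)%N by rewrite /N (big_rem d)//= leq_addr.
  lia.
pose e d := absz (d + N%:Z).
pose p : {poly R[i]} := \sum_(d <- D) 'X^(e d).
have p0 : p != 0.
  apply/eqP => /(congr1 (fun p : {poly R[i]} => p`_(e 0))).
  rewrite coef0 coef_sum (bigD1_seq 0)//= coefXn eqxx big_seq_cond big1 ?addr0.
    by move/eqP; rewrite oner_eq0.
  move=> d /andP[dD d0]; rewrite coefXn (_ : e 0 == e d = false)//.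
  apply/negbTE; apply: contra d0 => /eqP; rewrite /e.
  by have := dN d dD; have := dN 0 D0; lia.
have cisX (n : nat) (y : R) : cis y ^+ n = cis (n%:R * y).
  elim: n => [|n IH]; first by rewrite mul0r cis0.
  by rewrite exprS IH -cisD -natr1 mulrDl mul1r addrC.
have root_p y : mask_sq D y = 0 -> root p (cis (2 * pi * y)).
  move=> wy; rewrite rootE /p horner_sum.
  under eq_big_seq => d dD.
    rewrite hornerXn cisX.
    have -> : (e d)%:R = d%:~R + N%:R :> R.
      rewrite /e pmulrn abszE ger0_norm ?dN// intrD -pmulrn//.
    rewrite mulrDl cisD; over.
  rewrite -mulr_suml mulf_eq0; apply/orP; left.
  move: wy => /eqP; rewrite paddr_eq0 ?sqr_ge0// !sqrf_eq0 /mask_cos /mask_sin.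
  have nN0 : (size D)%:R^-1 != 0 :> R by rewrite invr_eq0 pnatr_eq0 size_eq0; case: (D) D0.
  rewrite !mulf_eq0 (negPf nN0) /= => /andP[/eqP c0 /eqP s0].
  apply/eqP; rewrite [LHS](_ : _ = Complex (\sum_(d <- D) cos (2 * pi * d%:~R * y))
    (\sum_(d <- D) sin (2 * pi * d%:~R * y))); first by rewrite c0 s0.
  elim: (D) => [|d D' IH]; first by rewrite !big_nil.
  by rewrite !big_cons IH /cis; simpc; congr (Complex (_ + _) (_ + _)); [congr cos|congr sin]; ring.
have cis_inj y y' : 0 <= y < 1 -> 0 <= y' < 1 ->
    cis (2 * pi * y) = cis (2 * pi * y') -> y = y'.
  move=> y01 y'01 [Ec Es].
  have : cos (2 * pi * (y - y')) = 1 by rewrite mulrBr cosB Ec Es -!expr2 cos2Dsin2.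
  move=> /cos_eq1_int[z Ez]; apply/eqP; rewrite -subr_eq0 Ez intr_eq0 -absz_eq0 -leqn0 -ltnS.
  rewrite -(ltr_nat R) pmulrn abszE intr_norm -Ez ltr_norml; lra.
apply: (@sub_finite_set _ _ ([set y | 0 <= y < 1 /\ mask_sq D y = 0] `|` [set 1])).
  move=> y [/andP[y0 y1] wy] /=; have [->|y1'] := eqVneq y 1; [by right|left].
  by split=> //; rewrite y0 lt_neqAle y1'.
rewrite finite_setU; split; last exact: finite_set1.
apply: contrapT => /(infinite_set_fset (size p))[B BZ].
apply/negP; rewrite -ltnNge.
have -> : #|` B| = size [seq cis (2 * pi * y) | y <- B] by rewrite size_map.
apply: max_poly_roots => //.
  by apply/allP => _ /mapP[y yB ->]; apply: root_p; have [] := BZ y yB.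
rewrite map_inj_in_uniq ?fset_uniq// => y y' yB y'B; apply: cis_inj.
  by have [] := BZ y yB.
by have [] := BZ y' y'B.
Qed.

Lemma hadamard_cis (q : nat) (b : int) (D L : {fset int}) : (0 < q)%N ->
  hadamard_mx R q b D L \is unitarymx -> forall i j : 'I_q,
  \sum_(k < q) cis (2 * pi * (D`_i - D`_j)%:~R * (L`_k)%:~R / b%:~R : R) =
    (if i == j then q%:R else 0)%:C%C.
Proof.
move=> q0 /unitarymxP H i j.
have qN0 : q%:R != 0 :> R by rewrite pnatr_eq0 -lt0n.
have := congr1 (fun A : 'M[R[i]]_q => A i j) H; rewrite !mxE.
have E k : hadamard_mx R q b D L i k * (map_mx Num.conj (hadamard_mx R q b D L)^T) k j =
   (q%:R^-1)%:C%C * cis (2 * pi * (D`_i - D`_j)%:~R * (L`_k)%:~R / b%:~R : R).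
  rewrite !mxE rmorphM /=.
  have conjE (z : R[i]) : Num.conj z = (z^*)%C :> R[i] by [].
  rewrite !conjE conjc_cis conjc_real mulrACA -rmorphM -cisD -expr2 exprVn sqr_sqrtr//.
  congr (_ * cis _); rewrite intrB; ring.
under eq_bigr do rewrite E.
rewrite -mulr_sumr => {}H.
have := congr1 (fun u : R[i] => (q%:R)%:C%C * u) H.
rewrite mulrA -rmorphM divff// rmorph1 mul1r => ->.
by case: eqP => _; rewrite ?mulr1 ?mulr0 ?rmorph0.
Qed.

(** Expand each square over pairs of digits and sum over [L] first:
    orthogonality of the rows of the Hadamard matrix removes the pairs of
    distinct digits. *)
Lemma sum_mask_sq_hadamard (q : nat) (b : int) (D L : {fset int}) y : (0 < q)%N ->
  hadamard_triple R q b D L ->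
  \sum_(k < q) mask_sq D (y + (L`_k)%:~R / b%:~R) = 1.
Proof.
move=> q0 [Dq _ /(hadamard_cis q0) H].
have qN0 : q%:R != 0 :> R by rewrite pnatr_eq0 -lt0n.
have Re_sum (f : 'I_q -> R[i]) : complex.Re (\sum_k f k) = \sum_k complex.Re (f k).
  by apply: (big_morph (@complex.Re R)) => // -[a c] [a' c'].
have Im_sum (f : 'I_q -> R[i]) : complex.Im (\sum_k f k) = \sum_k complex.Im (f k).
  by apply: (big_morph (@complex.Im R)) => // -[a c] [a' c'].
pose th i j (k : 'I_q) := 2 * pi * (D`_i - D`_j)%:~R * (L`_k)%:~R / b%:~R : R.
have Hc (i j : 'I_q) : \sum_k cos (th i j k) = if i == j then q%:R else 0.
  by rewrite -[RHS]/(complex.Re (_ %:C)%C) -H Re_sum.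
have Hs (i j : 'I_q) : \sum_k sin (th i j k) = 0.
  have := congr1 (@complex.Im R) (H i j); by rewrite Im_sum.
under eq_bigr do rewrite mask_sqE.
rewrite -mulr_sumr (_ : size D = q)//.
have idx (F : int -> R) : \sum_(d <- D) F d = \sum_(i < q) F D`_i.
  by rewrite (big_nth 0) (_ : size D = q)// big_mkord.
under eq_bigr do rewrite idx; rewrite exchange_big /=.
have inner (i : 'I_q) : \sum_(k < q) \sum_(d' <- D)
    cos (2 * pi * (D`_i - d')%:~R * (y + (L`_k)%:~R / b%:~R)) = q%:R.
  under eq_bigr do rewrite idx; rewrite exchange_big /= (bigD1 i)//=.
  rewrite [X in _ + X]big1 ?addr0 => [|j ji].
    under eq_bigr do rewrite subrr mulr0 mul0r cos0.
    by rewrite sumr_const card_ord.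
  under eq_bigr => k _.
    rewrite mulrDr cosD (_ : _ * ((L`_k)%:~R / _) = th i j k); last by rewrite /th mulrA.
    over.
  by rewrite sumrB -!mulr_sumr Hc Hs eq_sym (negPf ji) !mulr0 subr0.
under eq_bigr do rewrite inner.
by rewrite sumr_const card_ord -[X in _ * X]mulr_natr -expr2 -exprMn mulVf ?expr1n.
Qed.

(** The greatest common divisor, by induction on the list of digits and the
    Bezout identity. *)
Lemma common_divisor_lattice D : exists g : nat, (forall d, d \in D -> (g%:Z %| d)%Z) /\
  forall y, (forall d, d \in D -> exists z : int, d%:~R * y = z%:~R) ->
    exists z : int, g%:R * y = z%:~R.
Proof.
elim: D => [|d D [g [gD gy]]].
  by exists 0%N; split => // y _; exists 0; rewrite mul0r.
exists `|gcdz g%:Z d|%N; rewrite abszE ger0_norm//; split.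
  move=> d'; rewrite inE => /predU1P[->|d'D]; first exact: dvdz_gcdr.
  by apply: dvdz_trans (gD _ d'D); exact: dvdz_gcdl.
move=> y Hy.
have [z1 Ez1] : exists z : int, g%:R * y = z%:~R.
  by apply: gy => d' d'D; apply: Hy; rewrite inE d'D orbT.
have [z2 Ez2] := Hy d (mem_head _ _).
have [u [v uv]] := Bezoutz g%:Z d.
exists (u * z1 + v * z2).
rewrite pmulrn abszE ger0_norm// -uv !(intrD, intrM) mulrDl -!mulrA -Ez1 -Ez2//.
Qed.

End Trigonometry.

(** * The Fourier transform of a self-similar measure *)

Section Fourier.
Context {R : realType} (mu : probability (measurableTypeR R) R).
Implicit Types (x y xi : R) (f g : R -> R).

Definition fourier_cos xi : R := \int[mu]_x cos (2 * pi * xi * x).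
Definition fourier_sin xi : R := \int[mu]_x sin (2 * pi * xi * x).
Definition fourier_sq xi : R := fourier_cos xi ^+ 2 + fourier_sin xi ^+ 2.

Lemma measurable_cos_fun : measurable_fun setT (cos : measurableTypeR R -> R).
Proof. by apply: continuous_measurable_fun; exact: continuous_cos. Qed.

Lemma measurable_sin_fun : measurable_fun setT (sin : measurableTypeR R -> R).
Proof. by apply: continuous_measurable_fun; exact: continuous_sin. Qed.

Lemma measurable_cos_lin xi : measurable_fun setT ((fun x => cos (2 * pi * xi * x)) : measurableTypeR R -> R).
Proof.
apply: continuous_measurable_fun => x.
apply: continuous_comp; last exact: continuous_cos.
exact: mulrl_continuous.
Qed.

Lemma measurable_sin_lin xi : measurable_fun setT ((fun x => sin (2 * pi * xi * x)) : measurableTypeR R -> R).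
Proof.
apply: continuous_measurable_fun => x.
apply: continuous_comp; last exact: continuous_sin.
exact: mulrl_continuous.
Qed.

Lemma bounded_integrable (f : measurableTypeR R -> R) (B : R) : measurable_fun setT f -> (forall x, `|f x| <= B) ->
  mu.-integrable setT (EFin \o f).
Proof.
move=> mf fB; apply: measurable_bounded_integrable => //.
  exact: fin_num_fun_lty.
exists B; split; first exact: num_real.
by move=> M BM x _ /=; rewrite (le_trans (fB x))// ltW.
Qed.

Lemma integrable_cos xi : mu.-integrable setT (EFin \o (fun x => cos (2 * pi * xi * x))).
Proof. exact: (bounded_integrable (measurable_cos_lin xi) (fun x => cos_max _)). Qed.

Lemma integrable_sin xi : mu.-integrable setT (EFin \o (fun x => sin (2 * pi * xi * x))).
Proof. exact: (bounded_integrable (measurable_sin_lin xi) (fun x => sin_max _)). Qed.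

Lemma probability_Rintegral_cst (c : R) : \int[mu]_(x in setT) c = c.
Proof.
rewrite Rintegral_cst//; transitivity (c * fine 1%E); last by rewrite mulr1.
by congr (_ * fine _); exact: probability_setT.
Qed.

Lemma integrable_EFinD f g : mu.-integrable setT (EFin \o f) ->
  mu.-integrable setT (EFin \o g) -> mu.-integrable setT (EFin \o (fun x => f x + g x)).
Proof. by move=> fi gi; exact: (integrableD measurableT fi gi). Qed.

Lemma integrable_EFinZ (r : R) f : mu.-integrable setT (EFin \o f) ->
  mu.-integrable setT (EFin \o (fun x => r * f x)).
Proof. by move=> fi; exact: (integrableZl measurableT r fi). Qed.

Lemma EFin_Rintegral f : mu.-integrable setT (EFin \o f) ->
  (\int[mu]_x (f x)%:E = (\int[mu]_x f x)%:E)%E.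
Proof. by move=> fi; rewrite /Rintegral fineK//; exact: integrable_fin_num. Qed.

Section SelfSimilar.
Context (b : int) (D : {fset int}).
Hypothesis b_neq0 : b != 0.
Hypothesis mu_self_similar : forall A : set (measurableTypeR R), measurable A ->
    (mu A = ((#|` D|%:R)^-1 : R)%:E *
      \sum_(d <- D) mu [set (b%:~R * x - d%:~R)%R | x in A])%E.

Definition branch (d : int) (x : measurableTypeR R) : measurableTypeR R := (x + d%:~R) / b%:~R.

Lemma measurable_branch d : measurable_fun setT (branch d).
Proof.
apply: continuous_measurable_fun => x.
apply: (@continuous_comp R R R (fun x => x + d%:~R) (fun x => x / b%:~R)).
  by apply: cvgD; [exact: cvg_id|exact: cvg_cst].
exact: mulrr_continuous.
Qed.

(** The self-similarity identity says that [mu] is the average of its images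
    under the branches; integrate against both sides. *)
Lemma self_similar_ge0_integral f :
  measurable_fun setT (f : measurableTypeR R -> R) -> (forall x, 0 <= f x) ->
  (\int[mu]_x (f x)%:E =
   (#|` D|%:R^-1)%:E * \sum_(d <- D) \int[mu]_x (f ((x + d%:~R) / b%:~R))%:E)%E.
Proof.
move=> mf f0.
have r0 : 0 <= #|` D|%:R^-1 :> R by rewrite invr_ge0.
pose m_of (n : nat) : {measure set (measurableTypeR R) -> \bar R} :=
  pushforward mu (branch D`_n).
pose m_ := m_of (fun n => measurable_branch D`_n).
have muE A : measurable A -> A `<=` setT -> mu A = mscale (NngNum r0) (msum m_ #|` D|) A.
  move=> mA _; rewrite mu_self_similar// /mscale /= /msum.
  rewrite (big_nth 0) big_mkord; congr (_ * _)%E; apply: eq_bigr => i _.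
  rewrite /m_ /m_of /= /pushforward; congr (mu _); apply/seteqP; split => [x [y Ay <-]|x Ax] /=.
    rewrite /branch subrK [X in A X](_ : _ = y)// mulrC mulKf// intr_eq0//.
  exists ((x + (D`_i)%:~R) / b%:~R) => //.
  by rewrite mulrC divfK ?addrK// intr_eq0.
rewrite (eq_measure_integral _ muE) ge0_integral_mscale//; last 2 first.
- exact/measurable_EFinP.
- by move=> x _; rewrite lee_fin.
congr (_ * _)%E; rewrite ge0_integral_measure_sum//; last 2 first.
- by move=> x _; rewrite lee_fin.
- exact/measurable_EFinP.
rewrite (big_nth 0) big_mkord; apply: eq_bigr => i _.
rewrite ge0_integral_pushforward//=; last 2 first.
- exact/measurable_EFinP.
- by move=> x _; rewrite lee_fin.
exact: measurable_branch.
Qed.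

Hypothesis D_gt0 : (0 < #|` D|)%N.

Lemma self_similar_Rintegral f (B : R) :
  measurable_fun setT (f : measurableTypeR R -> R) -> (forall x, `|f x| <= B) ->
  \int[mu]_x f x = #|` D|%:R^-1 * \sum_(d <- D) \int[mu]_x f ((x + d%:~R) / b%:~R).
Proof.
move=> mf fB.
have mfd d : measurable_fun setT ((fun x => f ((x + d%:~R) / b%:~R)) : measurableTypeR R -> R).
  exact: (measurableT_comp mf (measurable_branch d)).
(* Adding the bound [B] reduces the identity to nonnegative functions. *)
have shift h : measurable_fun setT (h : measurableTypeR R -> R) -> (forall x, `|h x| <= B) ->
    (\int[mu]_x (B + h x)%:E = (B + \int[mu]_x h x)%:E)%E.
  move=> mh hB; have ih : mu.-integrable setT (EFin \o h) by exact: (bounded_integrable mh hB).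
  have iB : mu.-integrable setT (EFin \o cst B).
    by apply: (@bounded_integrable (cst B) `|B|).
  rewrite -{2}(probability_Rintegral_cst B) -RintegralD// EFin_Rintegral//.
  exact: integrable_EFinD.
have g0 x : 0 <= B + f x by have := fB x; rewrite ler_norml; lra.
have mg : measurable_fun setT ((fun x => B + f x) : measurableTypeR R -> R).
  by apply: measurable_funD.
have := self_similar_ge0_integral mg g0; rewrite shift//.
under eq_bigr do rewrite shift//.
rewrite sumEFin -EFinM => -[]; rewrite big_split /= mulrDr.
rewrite big_const_seq count_predT iter_addr_0 -[X in _ * X + _]mulr_natl mulKf; last first.
  by rewrite pnatr_eq0 -lt0n.
by move/addrI.
Qed.

Lemma fourier_cosE xi : fourier_cos xi =
  mask_cos D (xi / b%:~R) * fourier_cos (xi / b%:~R)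
  - mask_sin D (xi / b%:~R) * fourier_sin (xi / b%:~R).
Proof.
rewrite {1}/fourier_cos (self_similar_Rintegral (measurable_cos_lin xi) (fun x => cos_max _)).
transitivity (#|` D|%:R^-1 * ((\sum_(d <- D) cos (2 * pi * d%:~R * (xi / b%:~R))) * fourier_cos (xi / b%:~R)
  - (\sum_(d <- D) sin (2 * pi * d%:~R * (xi / b%:~R))) * fourier_sin (xi / b%:~R)));
  last by rewrite /mask_cos /mask_sin mulrBr !mulrA.
congr (_ * _); rewrite !mulr_suml -sumrB; apply: eq_bigr => d _.
have ic := integrable_cos (xi / b%:~R); have isn := integrable_sin (xi / b%:~R).
rewrite -!RintegralZl// -RintegralB//; last 2 first.
- exact: integrable_EFinZ.
- exact: integrable_EFinZ.
apply: eq_Rintegral => x _; rewrite -cosD; congr cos.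
by field; rewrite intr_eq0.
Qed.

Lemma fourier_sinE xi : fourier_sin xi =
  mask_cos D (xi / b%:~R) * fourier_sin (xi / b%:~R)
  + mask_sin D (xi / b%:~R) * fourier_cos (xi / b%:~R).
Proof.
rewrite {1}/fourier_sin (self_similar_Rintegral (measurable_sin_lin xi) (fun x => sin_max _)).
transitivity (#|` D|%:R^-1 * ((\sum_(d <- D) cos (2 * pi * d%:~R * (xi / b%:~R))) * fourier_sin (xi / b%:~R)
  + (\sum_(d <- D) sin (2 * pi * d%:~R * (xi / b%:~R))) * fourier_cos (xi / b%:~R)));
  last by rewrite /mask_cos /mask_sin mulrDr !mulrA.
congr (_ * _); rewrite !mulr_suml -big_split /=; apply: eq_bigr => d _.
have ic := integrable_cos (xi / b%:~R); have isn := integrable_sin (xi / b%:~R).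
rewrite -!RintegralZl// -RintegralD//; last 2 first.
- exact: integrable_EFinZ.
- exact: integrable_EFinZ.
apply: eq_Rintegral => x _; rewrite [RHS]addrC -sinD; congr sin.
by field; rewrite intr_eq0.
Qed.

(** By self-similarity [mu] is the convolution of the uniform measure on [D /
    b] with the image of [mu] under division by [b]. *)
Lemma fourier_sqE xi : fourier_sq xi =
  mask_sq D (xi / b%:~R) * fourier_sq (xi / b%:~R).
Proof. by rewrite /fourier_sq /mask_sq (fourier_cosE xi) (fourier_sinE xi); ring. Qed.

End SelfSimilar.

Lemma fourier_sq0 : fourier_sq 0 = 1.
Proof.
rewrite /fourier_sq /fourier_cos /fourier_sin.
under eq_Rintegral do rewrite mulr0 mul0r cos0.
under [X in _ + X ^+ 2]eq_Rintegral do rewrite mulr0 mul0r sin0.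
by rewrite !probability_Rintegral_cst expr1n expr0n addr0.
Qed.

Lemma fourier_sq_ge0 xi : 0 <= fourier_sq xi.
Proof. by rewrite addr_ge0// sqr_ge0. Qed.

Lemma bounded_Rintegral_le f (B : R) :
  measurable_fun setT (f : measurableTypeR R -> R) -> (forall x, `|f x| <= B) ->
  `|\int[mu]_x f x| <= B.
Proof.
move=> mf fB; have fi := bounded_integrable mf fB.
apply: le_trans (le_normr_Rintegral _ fi) _ => //.
rewrite -[leRHS](probability_Rintegral_cst B); apply: le_Rintegral => //.
- exact: integrable_norm.
- by apply: (@bounded_integrable (cst B) `|B|).
Qed.

(** The topological support carries the measure: a point outside it lies in a
    null interval with rational endpoints, and there are countably many of
    these. *)
Lemma bounded_support : compact (measure_support mu) ->
  exists T : R, 0 < T /\ mu (~` [set x | `|x| <= T]) = 0%E.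
Proof.
move=> /compact_bounded[M [_ HM]].
pose T := Num.max 1 (M + 1).
have T0 : 0 < T by rewrite lt_max ltr01.
exists T; split => //.
pose U (r : rat * rat) : set (measurableTypeR R) := `](ratr r.1), (ratr r.2)[%classic.
pose F (n : nat) : set (measurableTypeR R) :=
  if @choice.unpickle (rat * rat)%type n is Some r then (if mu (U r) == 0%E then U r else set0) else set0.
have FU r : F (choice.pickle r) = if mu (U r) == 0%E then U r else set0.
  by rewrite /F choice.pickleK.
have negl : mu.-negligible (\bigcup_n F n).
  apply: negligible_bigcup => n; rewrite /F; case: choice.unpickle => [r|]; last exact: negligible_set0.
  case: eqP => mr; last exact: negligible_set0.
  by exists (U r); split => //; exact: measurable_itv.
have mT : measurable (~` [set x | `|x| <= T] : set (measurableTypeR R)).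
  apply: measurableC.
  have -> : [set x : R | `|x| <= T] = `[(- T), T]%classic.
    by apply/seteqP; split => x /=; rewrite in_itv /= ler_norml.
  exact: measurable_itv.
apply: measure_negligible mT _; apply: negligibleS negl => x /= /negP xT.
have xM : M + 1 < `|x|.
  by move: xT; rewrite -ltNge; apply: le_lt_trans; rewrite le_max lexx orbT.
have : ~ measure_support mu x.
  by move=> sx; have := HM (M + 1) _ x sx; rewrite /= ltrDl leNgt xM => /(_ ltr01).
move=> /existsNP[V /not_implyP[oV /not_implyP[Vx /negP]]]; rewrite -leNgt measure_le0 => /eqP mV.
have [e /= e0 eV] : exists2 e : R, 0 < e & ball x e `<=` V.
  by move: oV; rewrite openE => /(_ x Vx)/nbhs_ballP[e e0 eV]; exists e.
have [r1 r1x] : exists r1, ratr r1 \in `](x - e), x[ by apply: rat_in_itvoo; rewrite gtrBl.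
have [r2 r2x] : exists r2, ratr r2 \in `]x, (x + e)[ by apply: rat_in_itvoo; rewrite ltrDl.
rewrite !in_itv /= in r1x r2x.
have U0 : mu (U (r1, r2)) = 0%E.
  apply/eqP; rewrite -measure_le0 -mV; apply: le_measure; rewrite ?inE.
  - exact: measurable_itv.
  - exact: open_measurable.
  - move=> y; rewrite /U /= in_itv /= => y12; apply: eV; rewrite /ball /= ltr_norml; lra.
have : U (r1, r2) x by rewrite /U /= in_itv /=; lra.
have -> : U (r1, r2) = F (choice.pickle (r1, r2)) by rewrite FU U0 eqxx.
by move: (choice.pickle _) => n Fn; exists n.
Qed.

Lemma lip_of_derive (f df : R -> R) : (forall x, is_derive x 1 f (df x)) ->
  (forall x, `|df x| <= 1) -> forall x y, `|f x - f y| <= `|x - y|.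
Proof.
move=> Df d1.
suff H x y : x <= y -> `|f x - f y| <= `|x - y|.
  move=> x y; have [/H//|/ltW/H] := leP x y.
  by rewrite distrC [X in _ <= X]distrC.
move=> xy; have cont : {within `[x, y], continuous f}.
  apply: continuous_subspaceT => z; apply: differentiable_continuous.
  by apply/derivable1_diffP; have [] := Df z.
have [c _ E] := @MVT_segment R f df x y xy (fun z _ => Df z) cont.
by rewrite distrC [leRHS]distrC E normrM ler_piMl.
Qed.

Lemma lip_cos x y : `|cos x - cos y| <= `|x - y|.
Proof.
apply: (@lip_of_derive cos (fun x => - sin x)) => z.
by rewrite normrN sin_max.
Qed.

Lemma lip_sin x y : `|sin x - sin y| <= `|x - y|.
Proof. by apply: (@lip_of_derive sin cos) => z; exact: cos_max. Qed.

(** On the support the integrands [cos (2 pi xi x)] and [sin (2 pi xi x)] are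
    Lipschitz in [xi] with constant [2 pi T]. *)
Lemma fourier_sq_lip : compact (measure_support mu) ->
  exists C, forall xi eta, `|fourier_sq xi - fourier_sq eta| <= C * `|xi - eta|.
Proof.
move=> /bounded_support[T [T0 muT]].
exists (8 * pi * T) => xi eta.
have lipI (f : R -> R) : measurable_fun setT (f : measurableTypeR R -> R) ->
    (forall xi, measurable_fun setT ((fun x => f (2 * pi * xi * x)) : measurableTypeR R -> R)) ->
    (forall x, `|f x| <= 1) -> (forall x y, `|f x - f y| <= `|x - y|) ->
    `|\int[mu]_x f (2 * pi * xi * x) - \int[mu]_x f (2 * pi * eta * x)| <= 2 * pi * T * `|xi - eta|.
  move=> mf mfl f1 flip.
  have fi xi' : mu.-integrable setT (EFin \o (fun x => f (2 * pi * xi' * x))).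
    exact: (bounded_integrable (mfl xi')).
  rewrite -RintegralB//.
  set N := ~` _ in muT.
  have mN : measurable (N : set (measurableTypeR R)).
    apply: measurableC.
    have -> : [set x : R | `|x| <= T] = `[(- T), T]%classic.
      by apply/seteqP; split => x /=; rewrite in_itv /= ler_norml.
    exact: measurable_itv.
  pose h x := f (2 * pi * xi * x) - f (2 * pi * eta * x).
  have mh : measurable_fun setT (h : measurableTypeR R -> R) by apply: measurable_funB.
  have h2 x : `|h x| <= 2.
    by apply: le_trans (ler_normB _ _) _; have := f1 (2 * pi * xi * x); have := f1 (2 * pi * eta * x); lra.
  have ih := bounded_integrable mh h2.
  apply: le_trans (le_normr_Rintegral _ ih) _ => //.
  pose c := 2 * pi * T * `|xi - eta|.
  have c0 : 0 <= c by rewrite !mulr_ge0 ?pi_ge0// ltW.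
  have iN : mu.-integrable setT (EFin \o (\1_N : R -> R)).
    by apply: (@bounded_integrable \1_N 1) => // x; rewrite indicE; case: (_ \in _); rewrite ?normr1 ?normr0.
  have ic : mu.-integrable setT (EFin \o cst c).
    by apply: (@bounded_integrable (cst c) `|c|).
  have i2N := integrable_EFinZ 2 iN.
  have IN : \int[mu]_x (\1_N x : R) = 0.
    by rewrite /Rintegral integral_indic// setIT; exact: (congr1 fine muT).
  apply: (@le_trans _ _ (\int[mu]_x (c + 2 * \1_N x))); last first.
    suff -> : \int[mu]_x (c + 2 * \1_N x) = c by [].
    apply: etrans (RintegralD measurableT ic i2N) _.
    have E2 := etrans (RintegralZl 2 measurableT iN) (congr1 ( *%R 2) IN).
    apply: etrans (congr2 +%R (probability_Rintegral_cst c) E2) _.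
    by rewrite mulr0 addr0.
  apply: le_Rintegral => //; [exact: integrable_norm|exact: integrable_EFinD|move=> x _].
  have [xT|xT] := leP `|x| T.
    apply: (@le_trans _ _ c); last by rewrite lerDl mulr_ge0.
    apply: le_trans (flip _ _) _.
    rewrite (_ : _ - _ = 2 * pi * x * (xi - eta)); last by ring.
    rewrite !normrM (ger0_norm (@pi_ge0 R)) (ger0_norm (ler0n _ 2)).
    by rewrite ler_wpM2r// ler_wpM2l// mulr_ge0// pi_ge0.
  rewrite indicE mem_set; last by rewrite /N /= => H; move: xT; rewrite ltNge H.
  by rewrite mulr1; apply: le_trans (h2 x) _; rewrite lerDr.
have Lc := lipI _ (measurable_cos_fun) measurable_cos_lin (fun x => cos_max _) lip_cos.
have Ls := lipI _ (measurable_sin_fun) measurable_sin_lin (fun x => sin_max _) lip_sin.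
have sq_diff (u v K : R) : `|u| <= 1 -> `|v| <= 1 -> `|u - v| <= K -> `|u ^+ 2 - v ^+ 2| <= 2 * K.
  move=> u1 v1 uv; rewrite subr_sqr normrM mulrC ler_pM//.
  by apply: le_trans (ler_normD _ _) _; lra.
have c1 xi' : `|fourier_cos xi'| <= 1 by apply: bounded_Rintegral_le (measurable_cos_lin _) _ => x; exact: cos_max.
have s1 xi' : `|fourier_sin xi'| <= 1 by apply: bounded_Rintegral_le (measurable_sin_lin _) _ => x; exact: sin_max.
rewrite /fourier_sq opprD addrACA; apply: le_trans (ler_normD _ _) _.
have := sq_diff _ _ _ (c1 xi) (c1 eta) Lc; have := sq_diff _ _ _ (s1 xi) (s1 eta) Ls.
by rewrite /fourier_cos /fourier_sin; lra.
Qed.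

End Fourier.

(** * Density of the exponentials in the square-integrable functions *)

Section Completeness.
Context {R : realType} (mu : probability (measurableTypeR R) R).
Local Notation T := (measurableTypeR R).
Implicit Types (f g h : T -> R[i]) (z : R[i]) (xi : R).

Definition nsq (z : R[i]) : R := complex.Re z ^+ 2 + complex.Im z ^+ 2.

Lemma nsq_ge0 z : 0 <= nsq z. Proof. by rewrite addr_ge0// sqr_ge0. Qed.

Lemma normc_nsq z : ComplexField.Normc.normc z = Num.sqrt (nsq z).
Proof. by case: z. Qed.

Lemma nsqM z u : nsq (z * u) = nsq z * nsq u.
Proof. by case: z u => [a b] [c d]; rewrite /nsq /=; ring. Qed.

Lemma nsqD_le z u : nsq (z + u) <= 2 * nsq z + 2 * nsq u.
Proof.
case: z u => [a b] [c d]; rewrite /nsq /=.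
have := sqr_ge0 (a - c); have := sqr_ge0 (b - d); nra.
Qed.

Lemma nsq_cis (x : R) : nsq (cis x) = 1.
Proof. by rewrite /nsq /= cos2Dsin2. Qed.

Lemma nsq_mulJ z : z * (z^*)%C = (nsq z)%:C%C.
Proof. by case: z => [a b]; rewrite /nsq /=; simpc; congr (Complex _ _); ring. Qed.

Lemma ReD z u : complex.Re (z + u) = complex.Re z + complex.Re u. Proof. by case: z u => ? ? []. Qed.
Lemma ImD z u : complex.Im (z + u) = complex.Im z + complex.Im u. Proof. by case: z u => ? ? []. Qed.
Lemma ReM z u : complex.Re (z * u) = complex.Re z * complex.Re u - complex.Im z * complex.Im u.
Proof. by case: z u => ? ? []. Qed.
Lemma ImM z u : complex.Im (z * u) = complex.Re z * complex.Im u + complex.Im z * complex.Re u.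
Proof. by case: z u => ? ? []. Qed.

Lemma cmeasurableD f g : cmeasurable f -> cmeasurable g -> cmeasurable (fun x => f x + g x).
Proof.
move=> [f1 f2] [g1 g2]; split.
  by under eq_fun do rewrite ReD; exact: measurable_funD.
by under eq_fun do rewrite ImD; exact: measurable_funD.
Qed.

Lemma cmeasurableM f g : cmeasurable f -> cmeasurable g -> cmeasurable (fun x => f x * g x).
Proof.
move=> [f1 f2] [g1 g2]; split.
  under eq_fun do rewrite ReM.
  by apply: measurable_funB; exact: measurable_funM.
under eq_fun do rewrite ImM.
by apply: measurable_funD; exact: measurable_funM.
Qed.

Lemma cmeasurable_cst z : cmeasurable (fun _ : T => z).
Proof. by split. Qed.

Lemma cmeasurable_real (f : T -> R) : measurable_fun setT f -> cmeasurable (fun x => (f x)%:C%C).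
Proof. by move=> mf; split. Qed.

Definition expi xi : T -> R[i] := fun x => cis (2 * pi * xi * x).

Lemma cmeasurable_expi xi : cmeasurable (expi xi).
Proof. split; [exact: measurable_cos_lin|exact: measurable_sin_lin]. Qed.

Lemma measurable_nsq f : cmeasurable f -> measurable_fun setT (fun x => nsq (f x)).
Proof.
by move=> [f1 f2]; apply: measurable_funD; exact: measurable_funX.
Qed.

Lemma cmeasurableN f : cmeasurable f -> cmeasurable (fun x => - f x).
Proof.
move=> mf; under eq_fun do rewrite -mulN1r.
by apply: cmeasurableM => //; exact: cmeasurable_cst.
Qed.

Lemma cmeasurableB f g : cmeasurable f -> cmeasurable g -> cmeasurable (fun x => f x - g x).
Proof. by move=> mf mg; apply: cmeasurableD => //; exact: cmeasurableN. Qed.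

Definition sqn f : \bar R := (\int[mu]_x (nsq (f x))%:E)%E.

Lemma sqn_ge0 f : (0 <= sqn f)%E.
Proof. by apply: integral_ge0 => x _; rewrite lee_fin nsq_ge0. Qed.

Lemma emeasurable_nsq f : cmeasurable f -> measurable_fun setT (fun x => (nsq (f x))%:E).
Proof. by move=> mf; apply/measurable_EFinP; exact: measurable_nsq. Qed.

Lemma sqnZ (c : R) f : 0 <= c -> cmeasurable f ->
  (\int[mu]_x (c * nsq (f x))%:E = c%:E * sqn f)%E.
Proof.
move=> c0 mf; rewrite /sqn -ge0_integralZl//; first exact: emeasurable_nsq.
by move=> x _; rewrite lee_fin nsq_ge0.
Qed.

Lemma le_sqn (c : R) f g : 0 <= c -> cmeasurable f -> cmeasurable g ->
  (forall x, nsq (f x) <= c * nsq (g x)) -> (sqn f <= c%:E * sqn g)%E.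
Proof.
move=> c0 mf mg fg; rewrite -sqnZ//; apply: ge0_le_integral => //.
- by move=> x _; rewrite lee_fin nsq_ge0.
- exact: emeasurable_nsq.
- by apply/measurable_EFinP; apply: measurable_funM => //; exact: measurable_nsq.
- by move=> x _; rewrite lee_fin.
Qed.

Lemma sqnD_le f g : cmeasurable f -> cmeasurable g ->
  (sqn (fun x => (f x + g x)%R) <= 2%:E * sqn f + 2%:E * sqn g)%E.
Proof.
move=> mf mg; rewrite -!sqnZ//.
have m2 h : cmeasurable h -> measurable_fun setT (fun x => (2 * nsq (h x))%:E).
  by move=> mh; apply/measurable_EFinP; apply: measurable_funM => //; exact: measurable_nsq.
have p2 h x : (0 <= (2 * nsq (h x))%:E)%E by rewrite lee_fin mulr_ge0// nsq_ge0.
rewrite -ge0_integralD//; last 2 first.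
- exact: m2.
- exact: m2.
apply: ge0_le_integral => //.
- by move=> x _; rewrite lee_fin nsq_ge0.
- by apply: emeasurable_nsq; exact: cmeasurableD.
- by apply: emeasurable_funD; exact: m2.
- by move=> x _; rewrite -EFinD lee_fin nsqD_le.
Qed.

Definition trig_poly (s : seq (R * R[i])) : T -> R[i] :=
  fun x => \sum_(u <- s) u.2 * expi u.1 x.

Lemma cmeasurable_trig_poly s : cmeasurable (trig_poly s).
Proof.
elim: s => [|u s IH].
  rewrite /trig_poly; under eq_fun do rewrite big_nil; exact: cmeasurable_cst.
rewrite /trig_poly; under eq_fun do rewrite big_cons.
apply: cmeasurableD => //; apply: cmeasurableM; [exact: cmeasurable_cst|exact: cmeasurable_expi].
Qed.

Variable Lambda : set R.

(** The closed span, for the squared norm [sqn], of the exponentials with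
    frequencies in [Lambda]. *)
Definition spanned f : Prop := cmeasurable f /\
  forall e : R, 0 < e -> exists s, (forall u, u \in s -> Lambda u.1) /\
    (sqn (fun x => (f x - trig_poly s x)%R) < e%:E)%E.

Lemma spanned_close f : cmeasurable f ->
  (forall e : R, 0 < e -> exists g, spanned g /\ (sqn (fun x => (f x - g x)%R) < e%:E)%E) ->
  spanned f.
Proof.
move=> mf H; split => // e e0.
have e4 : 0 < e / 4 by rewrite divr_gt0.
have [g [[mg Hg] fg]] := H _ e4; have [s [sL gs]] := Hg _ e4.
exists s; split => //.
have mp := cmeasurable_trig_poly s.
have E : (fun x => f x - trig_poly s x) = (fun x => (f x - g x) + (g x - trig_poly s x)).
  by apply/funext => x; rewrite addrA subrK.
rewrite E; apply: le_lt_trans (sqnD_le (cmeasurableB mf mg) (cmeasurableB mg mp)) _.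
have -> : e%:E = (2%:E * (e / 4)%:E + 2%:E * (e / 4)%:E)%E.
  by rewrite -!EFinM -EFinD; congr EFin; lra.
by apply: lteD; rewrite lte_pmul2l.
Qed.

Lemma spanned_trig s : (forall u, u \in s -> Lambda u.1) -> spanned (trig_poly s).
Proof.
move=> sL; split; first exact: cmeasurable_trig_poly.
move=> e e0; exists s; split => //; rewrite /sqn.
under eq_integral do rewrite subrr.
by rewrite integral0_eq// => x _; rewrite /nsq /= expr0n addr0.
Qed.

Lemma spannedD f g : spanned f -> spanned g -> spanned (fun x => f x + g x).
Proof.
move=> [mf Hf] [mg Hg]; split; first exact: cmeasurableD.
move=> e e0; have e4 : 0 < e / 4 by rewrite divr_gt0.
have [s [sL fs]] := Hf _ e4; have [s' [s'L gs]] := Hg _ e4.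
exists (s ++ s'); split; first by move=> u; rewrite mem_cat => /orP[/sL|/s'L].
have mp := cmeasurable_trig_poly s; have mp' := cmeasurable_trig_poly s'.
have E : (fun x => f x + g x - trig_poly (s ++ s') x) =
    (fun x => (f x - trig_poly s x) + (g x - trig_poly s' x)).
  by apply/funext => x; rewrite /trig_poly big_cat /= opprD addrACA.
rewrite E; apply: le_lt_trans (sqnD_le (cmeasurableB mf mp) (cmeasurableB mg mp')) _.
have -> : e%:E = (2%:E * (e / 4)%:E + 2%:E * (e / 4)%:E)%E.
  by rewrite -!EFinM -EFinD; congr EFin; lra.
by apply: lteD; rewrite lte_pmul2l.
Qed.

Lemma spannedZ z f : spanned f -> spanned (fun x => z * f x).
Proof.
move=> [mf Hf]; have mzf : cmeasurable (fun x => z * f x).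
  by apply: cmeasurableM => //; exact: cmeasurable_cst.
split => // e e0; have z1 : 0 < nsq z + 1 by rewrite ltr_wpDl// nsq_ge0.
have [s [sL fs]] := Hf _ (divr_gt0 e0 z1).
exists [seq (k.1, z * k.2) | k <- s]; split; first by move=> _ /mapP[k /sL kL ->].
have mp := cmeasurable_trig_poly s.
apply: (@le_lt_trans _ _ ((nsq z + 1)%:E * sqn (fun x => (f x - trig_poly s x)%R))%E).
  apply: le_sqn; [exact: ltW| |exact: cmeasurableB|].
    by apply: cmeasurableB => //; exact: cmeasurable_trig_poly.
  move=> x; rewrite /trig_poly big_map /=; under eq_bigr do rewrite -mulrA.
  by rewrite -mulr_sumr -mulrBr nsqM ler_wpM2r ?nsq_ge0// lerDl.
by rewrite muleC -lte_pdivlMr// -EFinM.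
Qed.

(** Multiplication by a bounded function is continuous, so it suffices to
    multiply the generating exponentials. *)
Lemma spanned_mul f g (B : R) : spanned f -> cmeasurable g -> (forall x, nsq (g x) <= B) ->
  (forall l, Lambda l -> spanned (fun x => expi l x * g x)) ->
  spanned (fun x => f x * g x).
Proof.
move=> [mf Hf] mg gB Hl; apply: spanned_close; first exact: cmeasurableM.
move=> e e0; have B0 : 0 <= B by apply: le_trans (gB 0); exact: nsq_ge0.
have B1 : 0 < B + 1 by rewrite ltr_wpDl.
have [s [sL fs]] := Hf _ (divr_gt0 e0 B1).
have mp := cmeasurable_trig_poly s.
exists (fun x => trig_poly s x * g x); split.
  elim: s sL {fs mp} => [|k s IH] sL.
    have -> : (fun x => trig_poly [::] x * g x) = trig_poly [::].
      by apply/funext => x; rewrite /trig_poly !big_nil mul0r.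
    exact: spanned_trig.
  have -> : (fun x => trig_poly (k :: s) x * g x) =
     (fun x => k.2 * (expi k.1 x * g x) + trig_poly s x * g x).
    by apply/funext => x; rewrite /trig_poly big_cons mulrDl mulrA.
  apply: spannedD; last by apply: IH => k' k's; apply: sL; rewrite inE k's orbT.
  by apply/spannedZ/Hl/sL; rewrite mem_head.
apply: (@le_lt_trans _ _ ((B + 1)%:E * sqn (fun x => (f x - trig_poly s x)%R))%E).
  apply: le_sqn; [exact: ltW| |exact: cmeasurableB|].
    by apply: cmeasurableB; exact: cmeasurableM.
  move=> x; rewrite -mulrBl nsqM mulrC ler_wpM2r ?nsq_ge0//.
  by apply: (le_trans (gB x)); rewrite lerDl.
by rewrite muleC -lte_pdivlMr// -EFinM.
Qed.

Hypothesis spanned_expi : forall xi, spanned (expi xi).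

Lemma expiD xi eta x : expi (xi + eta) x = expi xi x * expi eta x.
Proof. by rewrite /expi -cisD; congr cis; ring. Qed.

Lemma spanned_mul_expi f xi : spanned f -> spanned (fun x => f x * expi xi x).
Proof.
move=> sf; apply: (@spanned_mul f (expi xi) 1) => //.
- exact: cmeasurable_expi.
- by move=> x; rewrite nsq_cis.
- move=> l _; under eq_fun do rewrite -expiD; exact: spanned_expi.
Qed.

(** Once all exponentials are in the closed span, products of its bounded
    elements are as well. Polynomials in a bounded element can therefore be
    formed, which is how indicator functions are reached. *)
Lemma spanned_mul_bounded f g (B : R) : spanned f -> spanned g -> (forall x, nsq (g x) <= B) ->
  spanned (fun x => f x * g x).
Proof.
move=> sf sg gB; apply: (@spanned_mul f g B) => //; first by case: sg.
by move=> l _; under eq_fun do rewrite mulrC; exact: spanned_mul_expi.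
Qed.

Definition rspanned (f : T -> R) := spanned (fun x => (f x)%:C%C).

Lemma rspannedD (f g : T -> R) : rspanned f -> rspanned g -> rspanned (fun x => f x + g x).
Proof.
move=> sf sg; rewrite /rspanned; under eq_fun do rewrite rmorphD /=.
exact: spannedD.
Qed.

Lemma rspannedZ (c : R) (f : T -> R) : rspanned f -> rspanned (fun x => c * f x).
Proof.
move=> sf; rewrite /rspanned; under eq_fun do rewrite rmorphM /=.
exact: spannedZ.
Qed.

Lemma rspannedM (B : R) (f g : T -> R) : rspanned f -> rspanned g -> (forall x, `|g x| <= B) ->
  rspanned (fun x => f x * g x).
Proof.
move=> sf sg gB; rewrite /rspanned; under eq_fun do rewrite rmorphM /=.
apply: (@spanned_mul_bounded _ _ (B ^+ 2)) => // x.
by rewrite /nsq /= expr0n addr0 -(real_normK (num_real (g x))) lerXn2r ?nnegrE// (le_trans _ (gB x)).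
Qed.

Lemma rspanned1 : rspanned (fun=> 1).
Proof.
rewrite /rspanned (_ : (fun=> _) = expi 0)//.
by apply/funext => x; rewrite /expi mulr0 mul0r cis0.
Qed.

Lemma rspanned_cst (c : R) : rspanned (fun=> c).
Proof. by have := rspannedZ c rspanned1; under eq_fun do rewrite mulr1. Qed.

Lemma rspanned_sin xi : rspanned (fun x => sin (2 * pi * xi * x)).
Proof.
have := spannedD (spannedZ (Complex 0 (- 2^-1)) (spanned_expi xi))
                 (spannedZ (Complex 0 (2^-1)) (spanned_expi (- xi))).
rewrite /rspanned; congr spanned; apply/funext => x.
rewrite /expi mulrN mulNr /cis cosN sinN; simpc.
by congr (Complex _ _); field.
Qed.

Lemma rspanned_cos xi : rspanned (fun x => cos (2 * pi * xi * x)).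
Proof.
have := spannedD (spannedZ (Complex (2^-1) 0) (spanned_expi xi))
                 (spannedZ (Complex (2^-1) 0) (spanned_expi (- xi))).
rewrite /rspanned; congr spanned; apply/funext => x.
rewrite /expi mulrN mulNr /cis cosN sinN; simpc.
by congr (Complex _ _); field.
Qed.

(** Dominated convergence. *)
Lemma rspanned_cvg (fn : nat -> T -> R) (f G : T -> R) :
  (forall n, rspanned (fn n)) -> measurable_fun setT f ->
  (forall x, fn n x @[n --> \oo] --> f x) ->
  (forall n x, (fn n x - f x) ^+ 2 <= G x) -> mu.-integrable setT (EFin \o G) ->
  rspanned f.
Proof.
move=> sfn mf fnf fnG iG; apply: spanned_close; first exact: cmeasurable_real.
have mfn n : measurable_fun setT (fn n) by have [[]] := sfn n.
pose hn (n : nat) (x : T) := ((fn n x - f x) ^+ 2)%:E.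
have mhn n : measurable_fun setT (hn n).
  by apply/measurable_EFinP; apply: measurable_funX; exact: measurable_funB.
have cvhn : {ae mu, forall x, setT x -> hn ^~ x @ \oo --> (cst 0%E) x}.
  apply: aeW => x _; apply/fine_cvgP; split; first exact: nearW.
  have : (fn n x - f x) ^+ 2 @[n --> \oo] --> (0 : R).
    rewrite (_ : 0 = (f x - f x) ^+ 2); last by rewrite subrr expr0n.
    by rewrite expr2; under eq_fun do rewrite expr2; apply: cvgM; apply: cvgB => //; exact: cvg_cst.
  exact.
have dom : {ae mu, forall x n, setT x -> (`|hn n x| <= (EFin \o G) x)%E}.
  by apply: aeW => x n _; rewrite /hn /= lee_fin ger0_norm ?sqr_ge0.
have [_ _] := dominated_convergence measurableT mhn (measurable_cst _) cvhn iG dom.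
rewrite integral_cst// mul0e => /fine_cvgP[cvfin cv] e e0.
have /cvgrPdist_lt/(_ e e0) cve := cv.
have [n []] : exists n, ((\int[mu]_x hn n x)%E \is a fin_num) /\
    `|0 - fine (\int[mu]_x hn n x)%E| < e.
  have [n1 _ H1] := cvfin; have [n2 _ H2] := cve.
  exists (maxn n1 n2); split; [apply: H1|apply: H2] => /=; [exact: leq_maxl|exact: leq_maxr].
rewrite sub0r normrN => hfin he; exists (fun x => (fn n x)%:C%C); split; first exact: sfn.
have -> : sqn (fun x => ((f x)%:C%C - (fn n x)%:C%C)%R) = (\int[mu]_x hn n x)%E.
  apply: eq_integral => x _; rewrite -rmorphB /nsq /hn /= expr0n addr0.
  by rewrite -sqrrN opprB.
by rewrite -(fineK hfin) lte_fin; apply: le_lt_trans he; exact: ler_norm.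
Qed.

(** This cubic preserves the unit interval and fixes 0, 1/2 and 1; its
    iterates push every other point to the nearer endpoint, so polynomials
    alone turn a continuous function into a step function. *)
Definition smoothstep (v : R) : R := v * (v * (3 - 2 * v)).

Lemma smoothstep_itv v : 0 <= v <= 1 -> 0 <= smoothstep v <= 1.
Proof.
move=> /andP[v0 v1]; have v2 : 0 <= 1 + 2 * v by lra.
have := mulr_ge0 (sqr_ge0 (1 - v)) v2; rewrite /smoothstep => H.
rewrite mulr_ge0//=; [lra|rewrite mulr_ge0//; lra].
Qed.

Lemma smoothstep_sym v : smoothstep (1 - v) = 1 - smoothstep v.
Proof. by rewrite /smoothstep; ring. Qed.

Lemma iter_smoothstep_itv n v : 0 <= v <= 1 -> 0 <= iter n smoothstep v <= 1.
Proof. by elim: n => [//|n IH] /IH; exact: smoothstep_itv. Qed.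

Lemma iter_smoothstep_sym n v : iter n smoothstep (1 - v) = 1 - iter n smoothstep v.
Proof. by elim: n => [//|n IH] /=; rewrite IH smoothstep_sym. Qed.

Definition step_limit (v : R) : R := if v < 1 / 2 then 0 else if v == 1 / 2 then 1 / 2 else 1.

Lemma iter_smoothstep_lt n v : 0 <= v -> v < 1 / 2 ->
  0 <= iter n smoothstep v <= v * (v * (3 - 2 * v)) ^+ n.
Proof.
move=> v0 v1; have r0 : 0 <= v * (3 - 2 * v) by nra.
have r1 : v * (3 - 2 * v) <= 1 by nra.
elim: n => [|n /andP[IH0 IH]]; first by rewrite expr0 mulr1 v0 lexx.
set y := iter n smoothstep v in IH0 IH *; rewrite /= -/y /smoothstep.
have yv : y <= v by apply: (le_trans IH); rewrite ler_piMr// exprn_ile1.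
have yr : y * (3 - 2 * y) <= v * (3 - 2 * v) by nra.
have yr0 : 0 <= y * (3 - 2 * y) by nra.
by rewrite mulr_ge0//= exprSr [X in _ <= X]mulrA; apply: ler_pM.
Qed.

Lemma cvg_iter_smoothstep v : 0 <= v <= 1 -> iter n smoothstep v @[n --> \oo] --> step_limit v.
Proof.
have lt_half u : 0 <= u -> u < 1 / 2 -> iter n smoothstep u @[n --> \oo] --> (0 : R).
  move=> u0 u1; apply: (@squeeze_cvgr _ _ _ _ (fun=> 0) (fun n => u * (u * (3 - 2 * u)) ^+ n)).
  - by apply: nearW => n; exact: iter_smoothstep_lt.
  - exact: cvg_cst.
  - by apply: cvg_geometric; rewrite ger0_norm; nra.
move=> /andP[v0 v1]; rewrite /step_limit; case: ltP => [vh|vh]; first exact: lt_half.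
case: eqP => [->|/eqP vn].
  have E n : iter n smoothstep (1 / 2) = 1 / 2.
    by elim: n => [//|n /= ->]; rewrite /smoothstep; field.
  by under eq_fun do rewrite E; exact: cvg_cst.
have -> : (fun n => iter n smoothstep v) = (fun n => 1 - iter n smoothstep (1 - v)).
  by apply/funext => n; rewrite iter_smoothstep_sym opprB addrC subrK.
rewrite -[X in _ --> X]subr0; apply: cvgB; first exact: cvg_cst.
apply: lt_half; first by rewrite subr_ge0.
have vh' : 1 / 2 < v by rewrite lt_neqAle eq_sym vn vh.
lra.
Qed.

Context (B : R).
Hypothesis B_ge0 : 0 <= B.
Hypothesis mu_bounded : mu (~` [set x | `|x| <= B]) = 0%E.

Lemma rspanned_eq (f g : T -> R) : rspanned f -> measurable_fun setT g ->
  (forall x, `|x| <= B -> g x = f x) -> rspanned g.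
Proof.
move=> sf mg gf; apply: spanned_close; first exact: cmeasurable_real.
move=> e e0; exists (fun x => (f x)%:C%C); split => //.
have mf : cmeasurable (fun x => (f x)%:C%C) by case: sf.
suff -> : sqn (fun x => ((g x)%:C%C - (f x)%:C%C)%R) = 0%E by rewrite lte_fin.
rewrite /sqn (ae_eq_integral (cst 0%E))//.
- by rewrite integral_cst// mul0e.
- by apply: emeasurable_nsq; apply: cmeasurableB => //; exact: cmeasurable_real.
- exists (~` [set x | `|x| <= B]); split => //.
    apply: measurableC.
    have -> : [set x : R | `|x| <= B] = `[(- B), B]%classic.
      by apply/seteqP; split => x /=; rewrite in_itv /= ler_norml.
    exact: measurable_itv.
  apply: subsetC => x /= xB _; rewrite gf// subrr /nsq /= expr0n addr0//.
Qed.

Lemma step_limit_itv v : 0 <= step_limit v <= 1.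
Proof. by rewrite /step_limit; case: ifP => _; [|case: ifP => _]; lra. Qed.

(** Iterating [smoothstep] on [(1 + sin (c (x - a))) / 2] separates the two
    sides of [a], for a frequency so low that the sine has the sign of [x - a]
    on the whole ball carrying [mu]. *)
Lemma rspanned_halfline (a : R) : rspanned \1_(`]a, +oo[%classic : set T).
Proof.
pose c := (B + `|a| + 1)^-1; have c0 : 0 < c by rewrite invr_gt0 ltr_wpDl// addr_ge0.
pose xi := c / (2 * pi).
have pi0 : 2 * pi != 0 :> R by rewrite mulf_neq0// gt_eqF// pi_gt0.
pose v (x : T) := 1 / 2 * (1 + sin (c * (x - a))).
have v01 x : 0 <= v x <= 1.
  by rewrite /v; have := sin_geN1 (c * (x - a)); have := sin_le1 (c * (x - a)); lra.
have sv : rspanned v.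
  have -> : v = (fun x => 1 / 2 * (1 + (cos (c * a) * sin (2 * pi * xi * x) +
      (- sin (c * a)) * cos (2 * pi * xi * x)))).
    apply/funext => x; rewrite /v mulrBr sinB /xi.
    have -> : 2 * pi * (c / (2 * pi)) = c by rewrite mulrC divfK.
    by ring.
  apply: rspannedZ; apply: rspannedD; first exact: rspanned1.
  by apply: rspannedD; apply: rspannedZ; [exact: rspanned_sin|exact: rspanned_cos].
have siter n : rspanned (fun x => iter n smoothstep (v x)).
  elim: n => [//|n IH] /=.
  have i01 x := iter_smoothstep_itv n (v01 x).
  apply: (@rspannedM 3) => //.
    apply: (@rspannedM 3) => //.
      have -> : (fun x => 3 - 2 * iter n smoothstep (v x)) = (fun x => 3 + (- 2) * iter n smoothstep (v x)).
        by apply/funext => x; rewrite mulNr.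
      by apply: rspannedD; [exact: rspanned_cst|exact: rspannedZ].
    by move=> x; have := i01 x; rewrite ler_norml; lra.
  by move=> x; have := i01 x => /andP[y0 y1]; rewrite ler_norml; nra.
pose H x := step_limit (v x).
have cvH x : iter n smoothstep (v x) @[n --> \oo] --> H x by exact: cvg_iter_smoothstep.
have mi n : measurable_fun setT (fun x => iter n smoothstep (v x)) by have [[]] := siter n.
have mH : measurable_fun setT H.
  by apply: (@measurable_fun_cvg _ _ _ _ (fun n x => iter n smoothstep (v x))) => // x _; exact: cvH.
have sH : rspanned H.
  apply: (@rspanned_cvg _ _ (cst 1) siter mH cvH); last first.
    by apply: (@bounded_integrable _ _ (cst 1) 1) => // x; rewrite normr1.
  move=> n x; have := iter_smoothstep_itv n (v01 x); have := step_limit_itv (v x).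
  rewrite /= -/(H x) => h1 h2; rewrite -(real_normK (num_real _)).
  by rewrite expr_le1// ler_norml; lra.
(* The polynomial [2 H^2 - H] sends the values 0, 1/2 and 1 of [H] to 0, 0 and
   1. *)
have sI : rspanned (fun x => 2 * (H x * H x) + (- 1) * H x).
  apply: rspannedD; apply: rspannedZ => //; apply: (@rspannedM 1) => // x.
  by have := step_limit_itv (v x); rewrite ler_norml /H; lra.
apply: (rspanned_eq sI); first exact: measurable_indic.
move=> x xB; rewrite indicE.
have cx : `|c * (x - a)| < 2.
  rewrite normrM gtr0_norm// /c mulrC ltr_pdivrMr; last by rewrite ltr_wpDl// addr_ge0.
  have xa : `|x| + `|a| < 2 * (B + `|a| + 1) by have := normr_ge0 a; move: xB B_ge0; lra.
  exact: le_lt_trans (ler_normB x a) xa.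
have sin_pos y : 0 < y -> `|y| < 2 -> 0 < sin y.
  by move=> y0; rewrite gtr0_norm// => y2; apply: sin2_gt0; rewrite y0.
rewrite /H /step_limit /v; have [xa|xa|->] := ltgtP a x.
- have sp : 0 < sin (c * (x - a)) by apply: sin_pos => //; rewrite mulr_gt0// subr_gt0.
  rewrite mem_set; last by rewrite /= in_itv /= andbT.
  rewrite ifF; last by apply/negbTE; rewrite -leNgt; lra.
  by rewrite ifF; [rewrite /= mulr1n; lra|rewrite gt_eqF//; lra].
- have sp : 0 < sin (- (c * (x - a))).
    by apply: sin_pos; rewrite ?normrN// -mulrN mulr_gt0// oppr_gt0 subr_lt0.
  rewrite sinN in sp.
  rewrite memNset; last by rewrite /= in_itv /= andbT; lra.
  by rewrite ifT /= ?mulr0n; lra.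
- rewrite subrr mulr0 sin0 addr0 mulr1 ltxx eqxx memNset /= ?mulr0n; first by lra.
  by rewrite /= in_itv /= ltxx.
Qed.

(** The sets whose indicator is in the closed span form a sigma-algebra, which
    contains the half-lines. *)
Lemma rspanned_indic (A : set T) : measurable A -> rspanned \1_A.
Proof.
pose S : set (set T) := [set A | measurable A /\ rspanned \1_A].
suff SA : forall A, measurable A -> S A by move=> /SA[].
have SC A' : S A' -> S (~` A').
  move=> [mA sA]; split; first exact: measurableC.
  have -> : \1_(~` A') = (fun x => 1 + (- 1) * \1_A' x) :> (T -> R).
    apply/funext => x; rewrite !indicE; have [xA|xA] := pselect (A' x).
      by rewrite (mem_set xA) memNset ?mulN1r ?subrr.
    by rewrite (memNset xA) mem_set// mulr0 addr0.
  by apply: rspannedD; [exact: rspanned1|exact: rspannedZ].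
have SI A1 A2 : S A1 -> S A2 -> S (A1 `&` A2).
  move=> [m1 s1] [m2 s2]; split; first exact: measurableI.
  have -> : \1_(A1 `&` A2) = (fun x => \1_A1 x * \1_A2 x) :> (T -> R) by rewrite indicI.
  by apply: (@rspannedM 1) => // x; rewrite indicE; case: (_ \in _); rewrite ?normr1 ?normr0.
have S0 : S set0.
  split => //; have -> : \1_set0 = (fun=> 0) :> (T -> R) by rewrite indic0.
  exact: rspanned_cst.
have SU A1 A2 : S A1 -> S A2 -> S (A1 `|` A2).
  by move=> s1 s2; rewrite -[_ `|` _]setCK setCU; apply/(SC)/SI; exact: SC.
have SF (F : nat -> set T) : (forall n, S (F n)) -> S (\bigcup_n F n).
  move=> FS; have mU : measurable (\bigcup_n F n) by apply: bigcup_measurable => n _; have [] := FS n.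
  split => //.
  pose E n := \big[setU/set0]_(i < n) F i.
  have SE n : S (E n) by apply: big_ind => // i _.
  apply: (@rspanned_cvg (fun n => \1_(E n)) _ (cst 1)).
  - by move=> n; have [] := SE n.
  - exact: measurable_indic.
  - move=> x; have [[n _ Fnx]|nU] := pselect ((\bigcup_n F n) x).
      rewrite [X in _ --> X]indicE mem_set; last by exists n.
      apply: cvg_near_cst; exists n.+1 => // k /= nk.
      rewrite indicE mem_set// /E -bigcup_mkord; by exists n.
    rewrite [X in _ --> X]indicE memNset//.
    apply: cvg_near_cst; apply: nearW => k.
    rewrite indicE memNset// /E -bigcup_mkord => -[i _ Fi]; apply: nU; by exists i.
  - move=> n x; rewrite !indicE.
    by case: (_ \in _); case: (_ \in _); rewrite /= ?subrr ?subr0 ?sub0r ?expr0n ?sqrrN ?expr1n.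
  - by apply: (@bounded_integrable _ _ (cst 1) 1) => // x; rewrite normr1.
have sigS : sigma_algebra setT S.
  by split => // A' /SC; rewrite setTD.
rewrite RGenOInfty.measurableE => A'; apply: smallest_sub => // _ [a ->]; split.
  exact: measurable_itv.
exact: rspanned_halfline.
Qed.

Import HBNNSimple.

Lemma rspanned_sqr_integrable (f : T -> R) : measurable_fun setT f ->
  (\int[mu]_x ((f x) ^+ 2)%:E < +oo)%E -> rspanned f.
Proof.
suff pos (g : T -> R) : measurable_fun setT g -> (forall x, 0 <= g x) ->
    (\int[mu]_x ((g x) ^+ 2)%:E < +oo)%E -> rspanned g.
  move=> mf f2.
  have mg (s : R) : measurable_fun setT (fun x => Num.max (s * f x) 0).
    by apply: measurable_maxr => //; exact: measurable_funM.
  have hg (s : R) : s ^+ 2 = 1 -> rspanned (fun x => Num.max (s * f x) 0).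
    move=> s1; apply: pos => //; first by move=> x; rewrite le_max lexx orbT.
    apply: le_lt_trans f2; apply: ge0_le_integral => //.
    - by move=> x _; rewrite lee_fin sqr_ge0.
    - by apply/measurable_EFinP; exact: measurable_funX.
    - by apply/measurable_EFinP; exact: measurable_funX.
    - move=> x _; rewrite lee_fin maxEle; case: ifP => _; first by rewrite expr0n sqr_ge0.
      by rewrite exprMn s1 mul1r.
  have := rspannedD (hg 1 _) (rspannedZ (- 1) (hg (- 1) _)).
  rewrite expr1n sqrrN expr1n => /(_ erefl erefl).
  rewrite /rspanned; congr spanned; apply/funext => x; congr (_ %:C)%C.
  rewrite mul1r !mulN1r; move: (f x) => y; rewrite !maxEle.
  by case: (leP y 0) => h1; case: (leP (- y) 0) => h2; lra.
move=> mg g0 ig.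
have mEg : measurable_fun setT (EFin \o g) by exact/measurable_EFinP.
pose gn := nnsfun_approx measurableT mEg.
have sgn n : rspanned (gn n).
  rewrite (_ : (gn n : T -> R) = (fun x => \sum_(i < #|` fset_set (gn n @` setT)|)
     ((fset_set (gn n @` setT))`_i * \1_(gn n @^-1` [set (fset_set (gn n @` setT))`_i]) x))); last first.
    by apply/funext => x; exact: fimfunEord.
  set N := #|` _|; elim: N => [|N IH].
    by under eq_fun do rewrite big_ord0; exact: rspanned_cst.
  under eq_fun do rewrite big_ord_recr /=; apply: rspannedD => //.
  apply: rspannedZ; apply: rspanned_indic; exact: measurable_funPTI.
have cvgn x : gn n x @[n --> \oo] --> g x.
  have /fine_cvgP[_] := @cvg_nnsfun_approx _ _ _ _ measurableT _ mEg (fun x _ => g0 x) x I.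
  exact.
have gn_le n x : gn n x <= g x.
  have nd : nondecreasing_seq (fun n => gn n x).
    by move=> n1 n2 n12; have /lefP := nd_nnsfun_approx measurableT mEg n12; apply.
  have := nondecreasing_cvgn_le nd (cvgP _ (cvgn x)) n.
  by rewrite (cvg_lim _ (cvgn x)).
apply: (@rspanned_cvg gn g (fun x => (g x) ^+ 2)) => //.
  move=> n x; have gn0 : 0 <= gn n x by exact: fun_ge0.
  rewrite -sqrrN opprB lerXn2r ?nnegrE ?subr_ge0//; last by rewrite lerBlDr lerDl.
apply/integrableP; split; first by apply/measurable_EFinP; exact: measurable_funX.
by under eq_integral => x _ do rewrite /= ger0_norm ?sqr_ge0//.
Qed.

(** A square-integrable function is approximated by simple functions, after
    splitting into real and imaginary, then positive and negative parts. *)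
Lemma spanned_L2 f : cmeasurable f -> (sqn f < +oo)%E -> spanned f.
Proof.
move=> [mRe mIm] f2.
have part (F : R[i] -> R) : measurable_fun setT (fun x => F (f x)) ->
    (forall z, F z ^+ 2 <= nsq z) -> rspanned (fun x => F (f x)).
  move=> mF FN; apply: rspanned_sqr_integrable => //.
  apply: le_lt_trans f2; apply: ge0_le_integral => //.
  - by move=> x _; rewrite lee_fin sqr_ge0.
  - by apply/measurable_EFinP; exact: measurable_funX.
  - by apply: emeasurable_nsq.
  - by move=> x _; rewrite lee_fin.
have sRe := part (@complex.Re R) mRe (fun z => ler_wpDr (sqr_ge0 _) (lexx _)).
have sIm := part (@complex.Im R) mIm (fun z => ler_wpDl (sqr_ge0 _) (lexx _)).
have := spannedD sRe (spannedZ (Complex 0 1) sIm).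
congr spanned; apply/funext => x; case: (f x) => a c /=; simpc.
by [].
Qed.

End Completeness.

(** * From the Parseval identity to a spectrum *)

Section Spectrum.
Context {R : realType} (mu : probability (measurableTypeR R) R).
Local Notation T := (measurableTypeR R).

Definition fourier (xi : R) : R[i] := Complex (fourier_cos mu xi) (fourier_sin mu xi).

Lemma conjcN (z : R[i]) : (- z)^*%C = - z^*%C.
Proof. by case: z. Qed.

Lemma conjcM (z u : R[i]) : (z * u)^*%C = z^*%C * u^*%C.
Proof. by case: z u => [a b] [c d]; simpc; congr (Complex _ _); ring. Qed.

Lemma nsq_fourier xi : nsq (fourier xi) = fourier_sq mu xi. Proof. by []. Qed.

Lemma fourierN xi : fourier (- xi) = (fourier xi)^*%C.
Proof.
rewrite /fourier /= /fourier_cos /fourier_sin; congr (Complex _ _).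
  by apply: eq_Rintegral => x _; rewrite mulrN mulNr cosN.
rewrite -mulN1r -RintegralZl//; last exact: integrable_sin.
by apply: eq_Rintegral => x _; rewrite mulrN mulNr sinN mulN1r.
Qed.

Lemma fourier0 : fourier 0 = 1.
Proof.
rewrite /fourier /fourier_cos /fourier_sin.
under eq_Rintegral do rewrite mulr0 mul0r cos0.
under [X in Complex _ X]eq_Rintegral do rewrite mulr0 mul0r sin0.
by rewrite !probability_Rintegral_cst.
Qed.

Lemma Re_trig_poly_integral (s : seq (R * R[i])) :
  mu.-integrable setT (EFin \o (fun x => complex.Re (trig_poly s x))) /\
  \int[mu]_x complex.Re (trig_poly s x) = complex.Re (\sum_(k <- s) k.2 * fourier k.1).
Proof.
elim: s => [|k s [IHi IH]].
  rewrite /trig_poly big_nil; under eq_Rintegral do rewrite big_nil.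
  rewrite probability_Rintegral_cst; split => //.
  under [X in mu.-integrable _ (EFin \o X)]eq_fun do rewrite big_nil.
  by apply: (@bounded_integrable _ _ (cst 0) 0) => // x; rewrite normr0.
have E x : complex.Re (trig_poly (k :: s) x) = (complex.Re k.2 * cos (2 * pi * k.1 * x)
    + (- complex.Im k.2) * sin (2 * pi * k.1 * x)) + complex.Re (trig_poly s x).
  by rewrite /trig_poly big_cons ReD ReM mulNr.
have i1 := integrable_EFinZ (complex.Re k.2) (integrable_cos mu k.1).
have i2 := integrable_EFinZ (- complex.Im k.2) (integrable_sin mu k.1).
have i12 := integrable_EFinD i1 i2.
split.
  under [X in mu.-integrable _ (EFin \o X)]eq_fun do rewrite E.
  exact: integrable_EFinD.
under eq_Rintegral do rewrite E.
apply: etrans (RintegralD measurableT i12 IHi) _.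
rewrite big_cons ReD -IH; congr (_ + _).
apply: etrans (RintegralD measurableT i1 i2) _.
rewrite ReM -mulNr; congr (_ + _); rewrite RintegralZl//.
  exact: integrable_cos.
exact: integrable_sin.
Qed.

(** The Gram matrix of the exponentials consists of the values of the Fourier
    transform at the differences of the frequencies. *)
Lemma sqn_trig_poly (s : seq (R * R[i])) :
  sqn mu (trig_poly s) =
  (complex.Re (\sum_(k <- s) \sum_(k' <- s) k.2 * (k'.2)^*%C * fourier (k.1 - k'.1)))%:E.
Proof.
pose s2 := [seq (k.1 - k'.1, k.2 * (k'.2)^*%C) | k <- s, k' <- s].
have E x : nsq (trig_poly s x) = complex.Re (trig_poly s2 x).
  rewrite -[LHS]/(complex.Re (nsq (trig_poly s x))%:C%C) -nsq_mulJ; congr complex.Re.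
  rewrite /trig_poly rmorph_sum big_distrlr /= /s2 big_allpairs_dep /=.
  apply: eq_bigr => k _; apply: eq_bigr => k' _.
  rewrite conjcM mulrACA /expi conjc_cis -cisD; congr (_ * cis _); ring.
rewrite /sqn; under eq_integral do rewrite E.
have [si sE] := Re_trig_poly_integral s2.
by rewrite EFin_Rintegral// sE /s2 big_allpairs_dep.
Qed.

Lemma fourier_sq_le1 xi : fourier_sq mu xi <= 1.
Proof.
(* The variance of the exponential is nonnegative. *)
have [c0 s0] : fourier_cos mu 0 = 1 /\ fourier_sin mu 0 = 0 by have [-> ->] := fourier0.
have [cN sN] : fourier_cos mu (- xi) = fourier_cos mu xi /\
    fourier_sin mu (- xi) = - fourier_sin mu xi by have [-> ->] := fourierN xi.
have := sqn_ge0 mu (trig_poly [:: (xi, 1); (0, - fourier xi)]).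
rewrite sqn_trig_poly lee_fin !big_cons !big_nil !addr0 /= !subrr.
rewrite subr0 sub0r c0 s0 cN sN.
rewrite /fourier_sq; nra.
Qed.

Context (p : nat -> R).
Hypothesis p_orth : forall i j, i != j -> fourier_sq mu (p i - p j) = 0.

Lemma fourier_orth i j : fourier (p i - p j) = (i == j)%:R.
Proof.
have [->|ij] := eqVneq i j; first by rewrite subrr fourier0.
have /eqP := p_orth ij; rewrite /fourier_sq paddr_eq0 ?sqr_ge0// !sqrf_eq0.
by rewrite /fourier => /andP[/eqP-> /eqP->].
Qed.

(** Pythagoras: for orthonormal exponentials the squared distance of an
    exponential to its orthogonal projection is 1 minus the sum of the squared
    coefficients. *)
Lemma sqn_expi_minus_projection xi n :
  sqn mu (fun x => (expi xi x - trig_poly [seq (p i, fourier (xi - p i)) | i <- iota 0 n] x)%R)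
  = (1 - \sum_(i < n) fourier_sq mu (xi - p i))%:E.
Proof.
pose c i := fourier (xi - p i).
have -> : (fun x => expi xi x - trig_poly [seq (p i, c i) | i <- iota 0 n] x) =
   trig_poly ((xi, 1) :: [seq (p i, - c i) | i <- iota 0 n]).
  apply/funext => x; rewrite /trig_poly big_cons !big_map /= mul1r -sumrN.
  by congr (_ + _); apply: eq_bigr => i _; rewrite mulNr.
rewrite sqn_trig_poly; congr EFin.
set s2 := [seq (p i, - c i) | i <- iota 0 n].
have J1 : ((1 : R[i])^*)%C = 1 by exact: conjc1.
have iotaE : iota 0 n = index_iota 0 n by rewrite /index_iota subn0.
have k1 : (xi, 1 : R[i]).1 = xi by [].
have k2 : (xi, 1 : R[i]).2 = 1 by [].
rewrite big_cons big_cons k1 k2 subrr fourier0 J1 !mulr1.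
have E1 : \sum_(k <- s2) 1 * (k.2)^*%C * fourier (xi - k.1) =
    (- \sum_(i < n) fourier_sq mu (xi - p i))%:C%C.
  rewrite /s2 big_map iotaE big_mkord rmorphN rmorph_sum -sumrN; apply: eq_bigr => i _.
  rewrite -[RHS]/(- (nsq (c i))%:C%C) -nsq_mulJ mul1r.
  by rewrite -[LHS]/((- c i)^*%C * c i) conjcN mulNr mulrC.
have E2 : \sum_(k <- s2) \sum_(k' <- (xi, 1) :: s2) k.2 * (k'.2)^*%C * fourier (k.1 - k'.1) = 0.
  rewrite {1}/s2 big_map iotaE big_mkord big1// => i _.
  rewrite big_cons k1 k2 J1 /s2 big_map iotaE big_mkord (bigD1 i)//= big1 ?addr0.
    rewrite -[X in _ + X]/(- c i * (- c i)^*%C * fourier (p i - p i)).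
    rewrite mulr1 subrr fourier0 mulr1 conjcN mulrNN -{1}(opprB xi) fourierN -/(c i).
    by rewrite mulNr addNr.
  by move=> j ji; rewrite (fourier_orth i j) (_ : _ == _ = false) ?mulr0// eq_sym; exact/negbTE.
by rewrite E1 E2 addr0 ReD.
Qed.

Lemma L2norm_sqn (f : T -> R[i]) : (L2norm mu f `^ 2 = sqn mu f)%E.
Proof.
rewrite /L2norm powR_Lnorm//; apply: eq_integral => x _ /=.
by rewrite normc_nsq ger0_norm ?sqrtr_ge0// powR_mulrn ?sqrtr_ge0// sqr_sqrtr ?nsq_ge0.
Qed.

Lemma L2norm_lt (f : T -> R[i]) (eps : R) :
  0 < eps -> (sqn mu f < (eps ^+ 2)%:E)%E -> (L2norm mu f < eps%:E)%E.
Proof.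
move=> e0; apply: contraTT; rewrite -!leNgt -L2norm_sqn => h.
rewrite -powR_mulrn ?(ltW e0)// -poweR_EFin; apply: gt0_ler_poweR => //.
  by rewrite in_itv /= lee_fin (ltW e0) leey.
by rewrite in_itv /= Lnorm_ge0 leey.
Qed.

Lemma in_L2_sqn (f : T -> R[i]) : in_L2 mu f <-> cmeasurable f /\ (sqn mu f < +oo)%E.
Proof.
split=> -[mf fo]; split=> //; first by rewrite -L2norm_sqn poweR_lty.
by apply: (@lty_poweRy _ _ 2); rewrite ?L2norm_sqn.
Qed.

Lemma sqn_expi xi : sqn mu (expi xi) = 1%E.
Proof.
rewrite /sqn; under eq_integral do rewrite nsq_cis.
by rewrite integral_cst//= mul1e; exact: probability_setT.
Qed.

Lemma L2inner_expi xi eta : L2inner mu (expi xi) (expi eta) = fourier (xi - eta).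
Proof.
rewrite /L2inner /cintegral /fourier /fourier_cos /fourier_sin.
have E x : expi xi x * (expi eta x)^*%C = cis (2 * pi * (xi - eta) * x).
  by rewrite /expi conjc_cis -cisD; congr cis; ring.
by congr Complex; apply: eq_Rintegral => x _; rewrite E.
Qed.

(** Terms of equal frequency are collected, so that the sum runs over a finite
    set of frequencies. *)
Lemma trig_poly_fset (s : seq (R * R[i])) :
  exists (S : {fset R}) (c : R -> R[i]),
    (forall l, l \in S -> exists2 u, u \in s & u.1 = l) /\
    trig_poly s = (fun x => \sum_(l <- S) c l * expi l x).
Proof.
exists [fset u.1 | u in s]%fset, (fun l => \sum_(u <- s | u.1 == l) u.2); split.
  by move=> l /imfsetP[u us ->]; exists u.
apply/funext => x; rewrite /trig_poly.
under [RHS]eq_bigr => l _ do rewrite mulr_suml.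
rewrite (exchange_big_dep predT)//= big_seq [RHS]big_seq; apply: eq_bigr => u us.
under eq_bigl do rewrite eq_sym.
rewrite -big_filter filter_pred1_uniq ?big_seq1 ?fset_uniq//.
by apply/imfsetP; exists u.
Qed.

Hypothesis p_complete : forall xi eta : R, 0 < eta ->
  exists n, 1 - eta < \sum_(i < n) fourier_sq mu (xi - p i).
Context (B : R).
Hypothesis B_ge0 : 0 <= B.
Hypothesis mu_bounded : mu (~` [set x | `|x| <= B]) = 0%E.

(** The Parseval identity puts every exponential in the closed span of the
    chosen ones, and the exponentials span all square-integrable functions
    since [mu] is carried by a bounded set. *)
Lemma frequencies_spectrum : is_spectrum mu (range p).
Proof.
have spE xi : spanned mu (range p) (expi xi).
  split; first exact: cmeasurable_expi.
  move=> e e0; have [n hn] := p_complete xi e0.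
  exists [seq (p i, fourier (xi - p i)) | i <- iota 0 n]; split.
    by move=> u /mapP[i _ ->]; exists i.
  by rewrite sqn_expi_minus_projection lte_fin ltrBlDr -ltrBlDl.
split; first by apply: (sub_countable (card_image_le _ _)).
split.
- move=> l _; apply/in_L2_sqn; split; first exact: cmeasurable_expi.
  by rewrite [sqn _ _]sqn_expi ltry.
- move=> _ _ [i _ <-] [j _ <-]; rewrite [LHS]L2inner_expi fourier_orth.
  have [->|ij] := eqVneq i j; first by rewrite eqxx.
  rewrite (_ : p i == p j = false)//; apply/negbTE/eqP => pij.
  have := fourier_orth i j; rewrite pij subrr fourier0 (negbTE ij) => /eqP.
  by rewrite oner_eq0.
move=> f /in_L2_sqn[mf f2] eps eps0.
have [_ /(_ (eps ^+ 2))] := spanned_L2 spE B_ge0 mu_bounded mf f2.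
rewrite exprn_gt0// => /(_ isT)[s [sp hs]].
have [S [c [Sp E]]] := trig_poly_fset s.
exists S, c; split; first by move=> l /Sp[u /sp + <-].
by apply: L2norm_lt => //; rewrite E in hs.
Qed.

End Spectrum.

(** * Translates of one spectrum with prescribed dimension and density *)

Section TranslatedSpectra.
Context {R : realType} (mu : probability (measurableTypeR R) R).

Lemma fourier_sqN xi : fourier_sq mu (- xi) = fourier_sq mu xi.
Proof. by rewrite -!nsq_fourier fourierN; case: (fourier mu xi) => a c; rewrite /nsq /= sqrrN. Qed.

(** Let [g] be the greatest common divisor of the digits. Dividing by [g], the
    mask has period 1 and modulus 1 only at the integers, so the squared
    Fourier transform is a scaling function to which
    [clustered_spectrum_exists] applies, the Hadamard set [L] giving the
    spectrum of the first level. Orthogonality and completeness only see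
    differences of frequencies and the Parseval identity at all base points,
    hence survive every translation. *)
Lemma translated_spectra (q bn : nat) (D L : {fset int}) (t : R) (s : \bar R) :
  (1 < q)%N -> (q < bn)%N -> 0 \in D -> #|` D| = q -> hadamard_triple R q bn%:Z D L ->
  is_self_similar_measure bn%:Z D mu -> 0 < t < ln q%:R / ln bn%:R -> (0 <= s)%E ->
  exists (g : R) (lam : nat -> int),
    0 < g /\ forall a, spectra_dim_density mu t s (affine_points lam g a).
Proof.
move=> q1 qb D0 Dq had [cs ss] /andP[t0 t1] s0.
have b1 : (1 < bn)%N by exact: ltn_trans qb.
have b0 : (0 < bn)%N by exact: ltnW.
have bR0 : bn%:R != 0 :> R by rewrite pnatr_eq0 -lt0n.
have bZR : bn%:Z%:~R = bn%:R :> R by rewrite pmulrn.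
have [g [gD gL]] := common_divisor_lattice (R := R) D.
have g0 : (0 < g)%N.
  rewrite lt0n; apply/eqP => g0; move: q1; rewrite -Dq.
  have -> : D = [fset 0]%fset.
    apply/fsetP => d; rewrite in_fset1; apply/idP/eqP => [/gD|-> //].
    by rewrite g0 dvd0z => /eqP.
  by rewrite cardfs1.
have gR0 : 0 < g%:R :> R by rewrite ltr0n.
have gRN : g%:R != 0 :> R by rewrite gt_eqF.
pose w (x : R) := mask_sq D (x / g%:R).
pose Phi (x : R) := fourier_sq mu (x / g%:R).
pose ell1 (i : nat) : int := g%:Z * (L`_i - L`_0).
have sD : (0 < size D)%N by move: (ltnW q1); rewrite -Dq.
have w_per (x : R) (z : int) : w (x + z%:~R) = w x.
  by rewrite /w mulrDl mask_sq_periodic.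
have w_ge0 x : 0 <= w x by exact: mask_sq_ge0.
have w0 : w 0 = 1 by rewrite /w mul0r mask_sq0.
have P_ge0 x : 0 <= Phi x by exact: fourier_sq_ge0.
have P_le1 x : Phi x <= 1 by exact: fourier_sq_le1.
have P0 : Phi 0 = 1 by rewrite /Phi mul0r fourier_sq0.
have P_scale x : Phi x = w (x / bn%:R) * Phi (x / bn%:R).
  have bZ0 : bn%:Z != 0 by rewrite -lt0n.
  by rewrite /Phi /w (fourier_sqE bZ0 ss)// bZR mulrAC.
have ell1_spec : level_spectrum q bn w 1 ell1.
  move=> x; rewrite expn1.
  rewrite -[RHS](sum_mask_sq_hadamard (x / bn%:R / g%:R - (L`_0)%:~R / bn%:Z%:~R) (ltnW q1) had).
  apply: eq_bigr => i _; rewrite /level_factor big_ord1 expr1 /w; congr mask_sq.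
  by rewrite bZR /ell1 intrM intrB pmulrn; field; rewrite bR0 gRN.
have w_eq1 x : w x = 1 -> exists z : int, x = z%:~R.
  move=> wx; have [z Ez] : exists z : int, g%:R * (x / g%:R) = z%:~R.
    by apply: gL => d dD; exact: (mask_sq_eq1 D0 wx).
  by exists z; rewrite -Ez mulrC divfK.
have w_zeros : finite_set [set x | 0 <= x <= 1 /\ w x = 0].
  have fz := mask_sq_zeros (R := R) (fset_uniq D) D0.
  apply: sub_finite_set (finite_image (fun y => g%:R * y) fz).
  move=> x [/andP[x0 x1] wx]; exists (x / g%:R); last by rewrite mulrC divfK.
  split; last exact: wx.
  rewrite divr_ge0 ?(ltW gR0)//= ler_pdivrMr// mul1r.
  by apply: le_trans x1 _; rewrite ler1n.
have [T [T0 muT]] := bounded_support cs.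
have [C lip] := fourier_sq_lip cs.
have P_lip x y : `|Phi x - Phi y| <= (C / g%:R) * `|x - y|.
  apply: le_trans (lip _ _) _; rewrite -mulrBl normrM normfV (ger0_norm (ltW gR0)).
  by rewrite mulrA mulrAC.
have ell10 : ell1 0%N = 0 by rewrite /ell1 subrr mulr0.
have [J J0 PJ] := Phi_int_neq0 b0 w_per w_ge0 w0 P_ge0 P0 P_scale qb ell1_spec w_eq1 w_zeros P_lip q1.
have [kappa gk] := gauge_exists s0.
pose G := gauge_count g%:R t kappa.
have G_ge0 h : 0 <= G h by apply: gauge_count_ge0; case: gk.
have G_grow B (B0 : 0 <= B) := gauge_count_grow gk q1 b1 gR0 t0 t1 B0.
have [lam [M [orth compl place scat large]]] := clustered_spectrum_exists b0 w_per w_ge0 w0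
  P_ge0 P_le1 P0 P_scale qb ell1_spec w_eq1 w_zeros P_lip q1 ell10 G_ge0 G_grow J0 PJ.
have lam_inj : injective lam.
  move=> i j ij; apply/eqP; apply: contraT => /orth.
  by rewrite ij subrr P0 => /eqP; rewrite oner_eq0.
exists g%:R, lam; split=> // a.
have [dimE denE] := affine_points_beurling b1 J0 gR0 t0 s0 gk lam_inj place scat large a.
split=> //.
pose p i : R := (lam i)%:~R / g%:R + a.
apply: (@frequencies_spectrum _ mu p _ _ T (ltW T0) muT).
  move=> i j ij; have := orth _ _ ij; rewrite /Phi => <-; congr fourier_sq.
  by rewrite /p; field.
move=> xi eta eta0; have [n hn] := compl ((a - xi) * g%:R) eta eta0.
exists n; apply: (lt_le_trans hn); rewrite le_eqVlt; apply/orP; left; apply/eqP.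
apply: eq_bigr => i _; rewrite -fourier_sqN /Phi; congr fourier_sq.
by rewrite /p; field.
Qed.

End TranslatedSpectra.

(** * Cardinality *)

Section Continuum.
Context {R : realType}.

Lemma neq_first (A B : set nat) : A <> B ->
  exists k, (k \in A) != (k \in B) /\ forall j, (j < k)%N -> (j \in A) = (j \in B).
Proof.
move=> AB; have ex : exists k, (k \in A) != (k \in B).
  apply/not_existsP => h; apply: AB; apply/seteqP.
  have e k : (k \in A) = (k \in B) by apply/eqP; apply/negPn/negP/h.
  by split=> k /mem_set; [rewrite e|rewrite -e] => /set_mem.
exists (ex_minn ex); case: ex_minnP => k kAB kmin; split=> // j jk.
by apply/eqP; apply: contraTT jk => /kmin; rewrite -leqNgt.
Qed.

Definition ternary_sum (A : set nat) n : R := \sum_(k < n) ((k : nat) \in A)%:R / 3 ^+ k.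

(** A set of natural numbers is encoded by the number whose ternary digits are
    its characteristic function; with digits 0 and 1 only, the first
    difference dominates the tail. *)
Definition ternary (A : set nat) : R := sup (range (ternary_sum A)).

Lemma ternary_sum_tail A m n : ternary_sum A (m + n) <= ternary_sum A m + (3 / 2) * (3 ^- m).
Proof.
suff : ternary_sum A (m + n) <= ternary_sum A m + (3 / 2) * (3 ^- m - 3 ^- (m + n)).
  move=> /le_trans; apply; rewrite lerD2l ler_wpM2l//.
  by rewrite lerBlDr lerDl invr_ge0 exprn_ge0.
elim: n => [|n IH]; first by rewrite addn0 subrr mulr0 addr0.
rewrite addnS {1}/ternary_sum big_ord_recr /= -/(ternary_sum A (m + n)).
have h : 0 < (3 : R) ^- (m + n) by rewrite invr_gt0 exprn_gt0.
have : (((m + n)%N \in A)%:R : R) <= 1 by case: (_ \in _).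
move=> /(ler_wpM2r (ltW h)); rewrite exprS invfM.
move: IH; lra.
Qed.

Lemma ternary_ge A n : ternary_sum A n <= ternary A.
Proof.
apply: ub_le_sup; last by exists n.
exists (3 / 2) => _ [k _ <-]; have := ternary_sum_tail A 0 k.
by rewrite add0n {2}/ternary_sum big_ord0 add0r expr0 invr1 mulr1.
Qed.

Lemma ternary_le A m : ternary A <= ternary_sum A m + (3 / 2) * (3 ^- m).
Proof.
apply: ge_sup; first by exists (ternary_sum A 0%N), 0%N.
move=> _ [n _ <-].
have [mn|nm] := leqP m n; first by rewrite -(subnKC mn) ternary_sum_tail.
apply: ler_wpDr; first by rewrite mulr_ge0 ?invr_ge0 ?exprn_ge0.
rewrite -(subnKC (ltnW nm)).
elim: (m - n)%N => [|k IH]; first by rewrite addn0.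
rewrite addnS; apply: le_trans IH _.
by rewrite [leRHS]/ternary_sum big_ord_recr /= lerDl divr_ge0 ?exprn_ge0.
Qed.

Lemma ternary_inj : injective ternary.
Proof.
suff lt A B k : k \in A -> k \notin B -> (forall j, (j < k)%N -> (j \in A) = (j \in B)) ->
    ternary B < ternary A.
  move=> A B AB; apply: contrapT => /neq_first[k [kAB kmin]].
  have := kAB; case kA : (k \in A); case kB : (k \in B) => // _.
    by have := lt A B k kA (negbT kB) kmin; rewrite AB ltxx.
  by have := lt B A k kB (negbT kA) (fun j h => esym (kmin j h)); rewrite AB ltxx.
move=> kA kB kmin.
apply: le_lt_trans (ternary_le B k.+1) _; apply: lt_le_trans (ternary_ge A k.+1).
rewrite /ternary_sum !big_ord_recr /= (negbTE kB) kA mul0r addr0 mul1r.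
rewrite (eq_bigr (fun j : 'I_k => ((j : nat) \in A)%:R / 3 ^+ j)).
  rewrite ltrD2l exprS invfM; have : 0 < (3 : R) ^- k by rewrite invr_gt0 exprn_gt0.
  lra.
by move=> j _; rewrite kmin.
Qed.

(** Each point of [L], labelled by the natural number [F] assigns to it, is
    recorded by its Dedekind cut. *)
Definition cut_code (L : set R) (F : R -> nat) : set nat :=
  [set n | exists x r, [/\ L x, (ratr r : R) < x & n = choice.pickle (F x, r)]].

(** Equal codes give each point of [L] a point of [L'] with the same label,
    hence with the same cut. *)
Lemma cut_code_sub (L L' : set R) (F F' : R -> nat) :
  {in L' &, injective F'} -> cut_code L F `<=` cut_code L' F' -> cut_code L' F' `<=` cut_code L F ->
  {in L &, injective F} -> L `<=` L'.
Proof.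
move=> F'inj s1 s2 Finj x Lx.
have step r : ratr r < x -> exists x', [/\ L' x', F' x' = F x & ratr r < x'].
  move=> rx; have [] := s1 (choice.pickle (F x, r)); first by exists x, r.
  move=> x' [r' [Lx' r'x' /(pcan_inj choice.pickleK)[E1 E2]]].
  by exists x'; rewrite E2.
have step' x' r : L' x' -> F' x' = F x -> ratr r < x' -> ratr r < x.
  move=> Lx' Fx' rx'; have [] := s2 (choice.pickle (F' x', r)); first by exists x', r.
  move=> y [r' [Ly r'y /(pcan_inj choice.pickleK)[E1 E2]]].
  have <- : y = x by apply: Finj; rewrite ?inE// -E1.
  by rewrite E2.
have [r0 /andP[_ r0x]] : exists r : rat, x - 1 < ratr r < x.
  have /rat_in_itvoo[r] : x - 1 < x by rewrite ltrBlDr ltrDl.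
  by rewrite in_itv /= => h; exists r.
have [x' [Lx' Fx' _]] := step _ r0x.
suff -> : x = x' by [].
apply/eqP; rewrite eq_le; apply/andP; split; rewrite leNgt; apply/negP => h.
  have [r rh] := rat_in_itvoo h.
  move: rh; rewrite in_itv /= => /andP[h1 h2].
  have [y [Ly Fy ry]] := step _ h2.
  have E : y = x' by apply: F'inj; rewrite ?inE// Fx'.
  by move: ry; rewrite E ltNge (ltW h1).
have [r rh] := rat_in_itvoo h.
move: rh; rewrite in_itv /= => /andP[h1 h2].
by have := step' _ _ Lx' Fx' h2; rewrite ltNge (ltW h1).
Qed.

(** A labelled countable set is determined by a set of natural numbers, hence
    by a real number. *)
Lemma countable_sets_card : ([set L : set R | countable L] #<= [set: R])%card.
Proof.
suff /choice[F Finj] : forall L : set R, exists F : R -> nat, countable L -> {in L &, injective F}.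
  apply/pcard_injP; exists (fun L => ternary (cut_code L (F L))) => L L' /set_mem cL /set_mem cL' /ternary_inj E.
  by apply/seteqP; split; [apply: (@cut_code_sub _ _ (F L) (F L'))|
    apply: (@cut_code_sub _ _ (F L') (F L))]; rewrite ?E//; apply: Finj.
by move=> L; have [/countable_injP[F FP]|nc] := pselect (countable L); [exists F|exists (fun=> 0%N)].
Qed.

(** The set with shift [u / g] lies in [(u + Z) / g], and [u] runs through
    numbers of the open unit interval, no two of which differ by an integer. *)
Lemma affine_points_inj (lam : nat -> int) (g : R) : 0 < g ->
  injective (fun x => affine_points lam g ((1 + expR x)^-1 / g)).
Proof.
move=> g0 x y.
have u01 (z : R) : 0 < (1 + expR z)^-1 < 1.
  have e0 := expR_gt0 z.
  by rewrite invr_gt0 addr_gt0//= invf_lt1 ?ltrDl ?addr_gt0.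
set u := (1 + expR x)^-1; set v := (1 + expR y)^-1 => E.
have : affine_points lam g (v / g) ((lam 0%N)%:~R / g + u / g) by rewrite -E; exists 0%N.
move=> [i _]; rewrite -!mulrDl => /(mulIf (invr_neq0 (lt0r_neq0 g0))) iE.
have uv : u - v = (lam i - lam 0%N)%:~R by rewrite intrB; lra.
have z0 : lam i - lam 0%N = 0.
  apply/eqP; rewrite -absz_eq0 -leqn0 -ltnS -ltz_nat abszE -(@ltr_int R) intr_norm -uv.
  have /andP[] := u01 x; have /andP[] := u01 y; rewrite -/u -/v ltr_norml; lra.
move: uv; rewrite z0 => /subr0_eq /invr_inj /addrI; exact: expR_inj.
Qed.

End Continuum.

Theorem theorem1p4 (R : realType) (q : nat) (b : int) (D : {fset int})
    (mu : probability (measurableTypeR R) R) (t : R) (s : \bar R)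
    (hq : (2 <= q)%N) (hqb : q%:Z < b)
    (hD0 : 0 \in D) (hDq : #|` D| = q)
    (hHad : exists L : {fset int}, hadamard_triple R q b D L)
    (hmu : is_self_similar_measure b D mu)
    (ht : 0 < t < ln q%:R / ln b%:~R)
    (hs : (0%E <= s)%E) :
  (spectra_dim_density mu t s #= [set: R])%card.
Proof.
case: b hqb hHad hmu ht => // bn; rewrite ltz_nat => qb [L had] ss.
rewrite -pmulrn => ht.
have [g [lam [g0 fam]]] := translated_spectra hq qb hD0 hDq had ss ht hs.
rewrite card_eq_le; apply/andP; split.
  apply: card_le_trans countable_sets_card; apply: subset_card_le.
  by move=> Lam [[]].
apply/pcard_leP/injfunPex; exists (fun x => affine_points lam g ((1 + expR x)^-1 / g)).
  by move=> x _; exact: fam.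
by move=> x y _ _; exact: affine_points_inj.
Qed.
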